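(* Let $V$ be an $\mathbb{F}((t))$-module, $\mathbf{1}$ a vector of $V$, $\mathcal{D}$ an $\mathbb{F}$-linear operator on $V$, $U$ an $\mathbb{F}((t))$-submodule of $V$, and $$Y_0(\cdot,x):U\to\mathcal{E}(V)=\mathrm{Hom}_{\mathbb{F}((t))}(V,V((x))),\quad u\mapsto Y_0(u,x)=u(x)=\sum_{n\in\mathbb{Z}}u_nx^{-n-1},$$ an $\mathbb{F}$-linear map, satisfying all the following conditions: $\mathcal{D}\mathbf{1}=0$; $\mathcal{D}(f(t)v)=f(t)\mathcal{D}v+f'(t)v$ for $f(t)\in\mathbb{F}((t))$, $v\in V$; and for $u\in U$, $f(t)\in\mathbb{F}((t))$, $$[\mathcal{D},Y_0(u,x)]=\frac{d}{dx}Y_0(u,x),\qquad Y_0(u,x)\mathbf{1}\in V[[x]]\ \text{ and }\ \lim_{x\to0}Y_0(u,x)\mathbf{1}=u,\qquad Y_0(f(t)u,x)=f(t+x)Y_0(u,x);$$ the set $U(x)=\{Y_0(u,x)\mid u\in U\}$ is compatible; and $V$ is linearly spanned over $\mathbb{F}((t))$ by the vectors $u^{(1)}_{m_1}\cdots u^{(r)}_{m_r}\mathbf{1}$ for $r\ge0$, $u^{(i)}\in U$, $m_i\in\mathbb{Z}$. Suppose that there exists an $\mathbb{F}$-linear map $\psi_x$ from $V$ to $\mathbb{F}((t))((x))\langle U(x)\rangle$ such that $$\psi_x(f(t)v)=f(t+x)\psi_x(v)\quad\text{for }f(t)\in\mathbb{F}((t)),\ v\in V,$$ $$\psi_x(\mathbf{1})=1_V,\qquad\psi_x(u_nv)=u(x)_n\psi_x(v)\quad\text{for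 }u\in U,\ n\in\mathbb{Z},\ v\in V.$$ For $v\in V$, set $Y(v,x)=\psi_x(v)\in\mathcal{E}(V)$. Then $Y(\cdot,x)$ extends $Y_0(\cdot,x)$, and $(V,Y,\mathbf{1})$ carries the structure of a nonlocal vertex $\mathbb{F}((t))$-algebra. Furthermore, if $U(x)$ is $\mathcal{S}_t$-local, $V$ is a weak quantum vertex $\mathbb{F}((t))$-algebra.
   Context: $\mathbb{F}$ is a field of characteristic $0$; $t,x,x_0,x_1,\dots$ are commuting formal variables. $V((x))$ is the space of lower truncated Laurent series; $V((x_1,\dots,x_r))$ consists of series globally truncated from below in all variables. $\mathbb{F}_*(x_1,\dots,x_r)$ is the localization of $\mathbb{F}[[x_1,\dots,x_r]]$ at the nonzero polynomials; $\iota_{x_{i_1},\dots,x_{i_r}}:\mathbb{F}_*(x_1,\dots,x_r)\to\mathbb{F}((x_{i_1}))\cdots((x_{i_r}))$ is the unique algebra embedding extending the identity of $\mathbb{F}[[x_1,\dots,x_r]]$. Powers of $x_0+x_2$ are expanded in nonnegative powers of the second variable; $\delta(x)=\sum_{n\in\mathbb{Z}}x^n$; $f(t+x)=e^{x\,d/dt}f(t)\in\mathbb{F}((t))[[x]]$; for $f\in\mathbb{F}_*(x_1,x_2)$, $f(t+x_1,t+x_2)=e^{t(\partial_{x_1}+\partial_{x_2})}f\in\mathbb{F}_*(t,x_1,x_2)$. Nonlocal vertex algebra over $\mathbb{F}$: a vector space $V$ with a linear map $Y(\cdot,x):V\to\mathrm{Hom}(V,V((x)))$ and $\mathbf{1}\in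 V$ with $Y(\mathbf{1},x)v=v$, $Y(v,x)\mathbf{1}\in V[[x]]$, $\lim_{x\to0}Y(v,x)\mathbf{1}=v$, and for all $u,v,w\in V$ there is $l\in\mathbb{N}$ with $(x_0+x_2)^lY(u,x_0+x_2)Y(v,x_2)w=(x_0+x_2)^lY(Y(u,x_0)v,x_2)w$. Nonlocal vertex $\mathbb{F}((t))$-algebra: a nonlocal vertex algebra over $\mathbb{F}$ which is also an $\mathbb{F}((t))$-module with $Y(f(t)u,x)(g(t)v)=f(t+x)g(t)Y(u,x)v$. It is a weak quantum vertex $\mathbb{F}((t))$-algebra if for any $u,v\in V$ there exist finitely many $u^{(i)},v^{(i)}\in V$, $f_i\in\mathbb{F}_*(x_1,x_2)$ with $$x_0^{-1}\delta\left(\tfrac{x_1-x_2}{x_0}\right)Y(u,x_1)Y(v,x_2)-x_0^{-1}\delta\left(\tfrac{x_2-x_1}{-x_0}\right)\sum_i\iota_{t,x_2,x_1}(f_i(t+x_1,t+x_2))Y(v^{(i)},x_2)Y(u^{(i)},x_1)=x_2^{-1}\delta\left(\tfrac{x_1-x_0}{x_2}\right)Y(Y(u,x_0)v,x_2).$$ For an $\mathbb{F}((t))$-module $V$, $\mathcal{E}(V)=\mathrm{Hom}_{\mathbb{F}((t))}(V,V((x)))$, which is an $\mathbb{F}((t))((x))$-module. A subset of $\mathcal{E}(V)$ is compatible if for every finite sequence $a_1(x),\dots,a_r(x)$ in it there is $k\in\mathbb{N}$ with $\left(\prod_{i<j}(x_i-x_j)^k\right)a_1(x_1)\cdots a_r(x_r)\in\mathrm{Hom}(V,V((x_1,\dots,x_r)))$.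 For a pair $(a(x),b(x))$ with $p(x_1,x_2)a(x_1)b(x_2)\in\mathrm{Hom}(V,V((x_1,x_2)))$, $p(x_1,x_2)=(x_1-x_2)^k$, define $a(x)_nb(x)\in\mathcal{E}(V)$ by $$Y_{\mathcal{E}}(a(x),x_0)b(x)=\sum_{n\in\mathbb{Z}}a(x)_nb(x)x_0^{-n-1}=x_0^{-k}\left((x_1-x)^ka(x_1)b(x)\right)|_{x_1=x+x_0}.$$ $\langle U(x)\rangle$ is the smallest compatible $\mathbb{F}((t))$-subspace of $\mathcal{E}(V)$ containing $U(x)$ and $1_V$ and closed under all $(a(x),b(x))\mapsto a(x)_nb(x)$; $\mathbb{F}((t))((x))\langle U(x)\rangle$ is its $\mathbb{F}((t))((x))$-span (which is again compatible and closed). A subset $U$ of $\mathcal{E}(V)$ is $\mathcal{S}_t$-local if for any $a(x),b(x)\in U$ there exist finitely many $u^{(i)}(x),v^{(i)}(x)\in U$, $f_i\in\mathbb{F}_*(x_1,x_2)$ and $k\in\mathbb{N}$ with $$(x_1-x_2)^ka(x_1)b(x_2)=(x_1-x_2)^k\sum_i\iota_{t,x_2,x_1}(f_i(t+x_1,t+x_2))u^{(i)}(x_2)v^{(i)}(x_1).$$ *)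

(* Defs.v *)
From HB Require Import structures.
From mathcomp Require Import all_boot all_order all_algebra.
From mathcomp Require Import all_classical.
From mathcomp Require Import zify ring.

Set Implicit Arguments.
Unset Strict Implicit.
Unset Printing Implicit Defensive.

Import Order.TTheory GRing.Theory Num.Theory.

Local Open Scope classical_set_scope.
Local Open Scope ring_scope.

Record powser (R : Type) := Powser { pcoef :> nat -> R }.

Lemma powserP (R : Type) (f g : powser R) : (forall n, f n = g n) -> f = g.
Proof. by case: f g => f [g] /= fg; congr Powser; apply/funext. Qed.

HB.instance Definition _ (R : Type) := gen_eqMixin (powser R).
HB.instance Definition _ (R : Type) := gen_choiceMixin (powser R).

Section PowserZmod.
Variable R : zmodType.
Implicit Types f g h : powser R.

Definition powser_zero : powser R := Powser (fun=> 0).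
Definition powser_add f g := Powser (fun n => f n + g n).
Definition powser_opp f := Powser (fun n => - f n).

Let addA : associative powser_add.
Proof. by move=> f g h; apply: powserP => n; rewrite /= addrA. Qed.
Let addC : commutative powser_add.
Proof. by move=> f g; apply: powserP => n; rewrite /= addrC. Qed.
Let add0 : left_id powser_zero powser_add.
Proof. by move=> f; apply: powserP => n; rewrite /= add0r. Qed.
Let addN : left_inverse powser_zero powser_opp powser_add.
Proof. by move=> f; apply: powserP => n; rewrite /= addNr. Qed.

HB.instance Definition _ := GRing.isZmodule.Build (powser R) addA addC add0 addN.
End PowserZmod.

Section PowserRing.
Variable R : comNzRingType.
Implicit Types f g h : powser R.

Definition powser_one : powser R := Powser (fun n => (n == 0%N)%:R).
Definition powser_mul f g : powser R :=
  Powser (fun n => \sum_(i < n.+1) f i * g (n - i)%N).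

Let trunc N f : {poly R} := \poly_(i < N.+1) f i.

Let coef_trunc N f n : (n <= N)%N -> (trunc N f)`_n = f n.
Proof. by move=> nN; rewrite coef_poly ltnS nN. Qed.

Let powser_mulE N f g n : (n <= N)%N ->
  powser_mul f g n = (trunc N f * trunc N g)`_n.
Proof.
move=> nN; rewrite coefM /=; apply: eq_bigr => i _.
have iN : (i <= N)%N by rewrite (leq_trans _ nN)// -ltnS.
by rewrite !coef_trunc// (leq_trans (leq_subr _ _) nN).
Qed.

Let mulA : associative powser_mul.
Proof.
move=> f g h; apply: powserP => n; rewrite !(powser_mulE _ _ (leqnn n)).
have -> : (trunc n f * trunc n (powser_mul g h))`_n
  = (trunc n f * (trunc n g * trunc n h))`_n.
  rewrite !coefM; apply: eq_bigr => i _; congr (_ * _).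
  by rewrite coef_trunc ?leq_subr// (powser_mulE (N := n)) ?leq_subr.
have -> : (trunc n (powser_mul f g) * trunc n h)`_n
  = ((trunc n f * trunc n g) * trunc n h)`_n.
  rewrite !coefM; apply: eq_bigr => i _; congr (_ * _).
  have iN : (i <= n)%N by rewrite -ltnS.
  by rewrite coef_trunc// (powser_mulE (N := n)).
by rewrite mulrA.
Qed.

Let mulC : commutative powser_mul.
Proof.
by move=> f g; apply: powserP => n; rewrite !(powser_mulE _ _ (leqnn n)) mulrC.
Qed.

Let mul1 : left_id powser_one powser_mul.
Proof.
move=> f; apply: powserP => n /=.
rewrite big_ord_recl /= mul1r subn0 big1 ?addr0// => i _.
by rewrite mul0r.
Qed.

Let mulDl : left_distributive powser_mul +%R.
Proof.
move=> f g h; apply: powserP => n /=; rewrite -big_split /=.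
by apply: eq_bigr => i _; rewrite mulrDl.
Qed.

Let one_neq0 : powser_one != 0.
Proof.
by apply/eqP => /(congr1 (fun f : powser R => f 0%N))/eqP; rewrite /= oner_eq0.
Qed.

HB.instance Definition _ := GRing.Zmodule_isComNzRing.Build (powser R)
  mulA mulC mul1 mulDl one_neq0.

Definition powser_unit : {pred powser R} := fun f => `[< exists g, g * f = 1 >].
Definition powser_inv f : powser R := xget f [set g | g * f = 1].

Let mulVf : {in powser_unit, left_inverse 1 powser_inv *%R}.
Proof.
by move=> f /asboolP uf; exact: (@xgetPex _ f [set g | g * f = 1] uf).
Qed.

Let unitPl f g : g * f = 1 -> powser_unit f.
Proof. by move=> gf; apply/asboolP; exists g. Qed.

Let inv_out : {in [predC powser_unit], powser_inv =1 id}.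
Proof.
move=> f /asboolP uf; apply: (xgetPN f) => g gf.
by apply: uf; exists g.
Qed.

HB.instance Definition _ := GRing.ComNzRing_hasMulInverse.Build (powser R)
  mulVf unitPl inv_out.
End PowserRing.

Section PowserDomain.
Variable R : idomainType.
Implicit Types f g h : powser R.

Lemma powser_order f : f != 0 ->
  exists2 n, f n != 0 & forall m, (m < n)%N -> f m = 0.
Proof.
move=> f0; have ex : exists n, f n != 0.
  apply: contrapT => nex; case/negP: f0; apply/eqP/powserP => n.
  by apply: contrapT => /eqP fn; apply: nex; exists n.
exists (ex_minn ex); case: ex_minnP => // n _ nmin m mn.
by apply/eqP; apply: contraTT mn => /nmin; rewrite -leqNgt.
Qed.

Let mulf_eq0 f g : f * g = 0 -> (f == 0) || (g == 0).
Proof.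
move=> fg; apply: contrapT => /negP; rewrite negb_or => /andP[].
move=> /powser_order[n fn nmin] /powser_order[m gm mmin].
have /eqP := congr1 (fun h : powser R => h (n + m)%N) fg.
have nS : (n < (n + m).+1)%N by lia.
rewrite /= (bigD1 (Ordinal nS)) //= big1 => [|i].
  by rewrite addr0 addKn mulf_eq0 (negbTE fn) (negbTE gm).
rewrite -val_eqE /= => ni; have [lt_in|le_ni] := ltnP i n.
  by rewrite nmin // mul0r.
by rewrite [g _]mmin ?mulr0 //; have := ltn_ord i; lia.
Qed.

HB.instance Definition _ :=
  GRing.ComUnitRing_isIntegral.Build (powser R) mulf_eq0.
End PowserDomain.

Section PowserInv.
Variable K : fieldType.
Implicit Types f g : powser K.

Let invseq f := fix invseq n : seq K :=
  if n is m.+1 then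
    rcons (invseq m)
      (- (f 0%N)^-1 * \sum_(i < m.+1) f (m.+1 - i)%N * (invseq m)`_i)
  else [:: (f 0%N)^-1].

Let size_invseq f n : size (invseq f n) = n.+1.
Proof. by elim: n => //= n IHn; rewrite size_rcons IHn. Qed.

Let invseq_stable f n i : (i <= n)%N -> (invseq f n)`_i = (invseq f i)`_i.
Proof.
elim: n => [|n IHn]; first by rewrite leqn0 => /eqP->.
rewrite leq_eqVlt => /predU1P[->//|]; rewrite ltnS => le_in.
by rewrite /= nth_rcons size_invseq ltnS le_in IHn.
Qed.

Lemma powser_invertible f : f 0%N != 0 -> exists g, f * g = 1.
Proof.
move=> f0; exists (Powser (fun n => (invseq f n)`_n)); apply: powserP => -[|n].
  by rewrite /= big_ord_recl big_ord0 /= addr0 mulfV.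
rewrite [LHS]big_ord_recl /= subn0.
rewrite nth_rcons size_invseq ltnn eqxx mulrA mulrN mulfV // mulN1r.
rewrite addrC; apply/eqP; rewrite subr_eq0; apply/eqP.
rewrite (reindex_inj rev_ord_inj) /=; apply: eq_bigr => i _.
have le_in : (i <= n)%N by rewrite -ltnS.
rewrite /bump leq0n add1n !subSS subKn // subSn //.
by rewrite (invseq_stable _ le_in).
Qed.
End PowserInv.

(* [s] is the coefficient sequence of an element of [M((x))]. *)
Definition lower_truncated (M : nmodType) (s : int -> M) : Prop :=
  exists N : int, forall n : int, n < N -> s n = 0.

Record laurent (K : fieldType) := Laurent {
  lcoef :> int -> K;
  lcoef_truncated : lower_truncated lcoef }.

Lemma laurentP (K : fieldType) (f g : laurent K) :
  (forall n, f n = g n) -> f = g.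
Proof.
case: f g => f fP [g gP] /= fg; have {}fg : f = g by apply/funext.
by subst g; congr Laurent; exact: Prop_irrelevance.
Qed.

HB.instance Definition _ (K : fieldType) := gen_eqMixin (laurent K).
HB.instance Definition _ (K : fieldType) := gen_choiceMixin (laurent K).

Section LaurentField.
Variable K : fieldType.
Implicit Types f g h : laurent K.

Lemma laurent_add_subproof f g : lower_truncated (fun n => f n + g n).
Proof.
case: f g => f [N fN] [g [M gM]]; exists (Num.min N M) => n /=.
by rewrite lt_min => /andP[/fN-> /gM->]; rewrite addr0.
Qed.
Lemma laurent_opp_subproof f : lower_truncated (fun n => - f n).
Proof. by case: f => f [N fN]; exists N => n /fN /= ->; rewrite oppr0. Qed.
Lemma laurent_const_subproof (a : K) :
  lower_truncated (fun n : int => if n == 0 then a else 0).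
Proof. by exists 0 => n n0; rewrite lt_eqF. Qed.

Definition laurent_add f g := Laurent (laurent_add_subproof f g).
Definition laurent_opp f := Laurent (laurent_opp_subproof f).
Definition laurent_const (a : K) := Laurent (laurent_const_subproof a).

Let addA : associative laurent_add.
Proof. by move=> f g h; apply: laurentP => n; rewrite /= addrA. Qed.
Let addC : commutative laurent_add.
Proof. by move=> f g; apply: laurentP => n; rewrite /= addrC. Qed.
Let add0 : left_id (laurent_const 0) laurent_add.
Proof. by move=> f; apply: laurentP => n; rewrite /= if_same add0r. Qed.
Let addN : left_inverse (laurent_const 0) laurent_opp laurent_add.
Proof. by move=> f; apply: laurentP => n; rewrite /= if_same addNr. Qed.

HB.instance Definition _ :=
  GRing.isZmodule.Build (laurent K) addA addC add0 addN.

Let shiftp (N : int) f : powser K := Powser (fun n => f (N + n%:Z)).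

Lemma laurent_mul_lt f g N M n : (forall m, m < N -> f m = 0) ->
  (forall m, m < M -> g m = 0) -> n < N + M ->
  \sum_(i \in [set: int]) f i * g (n - i) = 0.
Proof.
move=> fN gM nNM; apply: fsbig1 => i _; have [/fN->|Ni] := ltP i N.
  by rewrite mul0r.
by rewrite [g _]gM ?mulr0 //; lia.
Qed.

Let mul_ge f g N M (k : nat) : (forall m, m < N -> f m = 0) ->
  (forall m, m < M -> g m = 0) ->
  \sum_(i \in [set: int]) f i * g (N + M + k%:Z - i)
  = (shiftp N f * shiftp M g) k.
Proof.
move=> fN gM; pose r := [seq N + Posz i | i <- iota 0 k.+1].
have ur : uniq r by rewrite map_inj_uniq ?iota_uniq // => i j; lia.
rewrite (fsbigE r) //= => [|i _ ir]; last first.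
  have [/fN->|Ni] := ltP i N; first by rewrite mul0r.
  rewrite [g _]gM ?mulr0 // ltNge; apply: contra ir => ki.
  by apply/mapP; exists `|i - N|%N; rewrite ?mem_iota; lia.
under eq_bigl do rewrite in_setT.
rewrite big_map -[iota _ _]/(index_iota 0 k.+1) big_mkord.
by apply: eq_bigr => i _; congr (_ * g _); have := ltn_ord i; lia.
Qed.

Lemma laurent_mul_subproof f g :
  lower_truncated (fun n => \sum_(i \in [set: int]) f i * g (n - i)).
Proof.
have [N fN] := lcoef_truncated f; have [M gM] := lcoef_truncated g.
by exists (N + M) => n; exact: laurent_mul_lt.
Qed.

Definition laurent_mul f g := Laurent (laurent_mul_subproof f g).

Let mulP f g N M : (forall m, m < N -> f m = 0) ->
    (forall m, m < M -> g m = 0) ->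
  (forall m, m < N + M -> laurent_mul f g m = 0) /\
  shiftp (N + M) (laurent_mul f g) = shiftp N f * shiftp M g.
Proof.
move=> fN gM; split=> [m|]; first exact: laurent_mul_lt.
by apply: powserP => k; exact: mul_ge.
Qed.

Let shift_eq N f g : (forall m, m < N -> f m = 0) ->
  (forall m, m < N -> g m = 0) -> shiftp N f = shiftp N g -> f = g.
Proof.
move=> fN gN fg; apply: laurentP => n; have [nN|Nn] := ltP n N.
  by rewrite fN ?gN.
have := congr1 (fun h : powser K => h `|n - N|%N) fg; rewrite /=.
by have -> : N + `|n - N|%N%:Z = n by lia.
Qed.

Let mulA : associative laurent_mul.
Proof.
move=> f g h; have [N fN] := lcoef_truncated f.
have [M gM] := lcoef_truncated g; have [P hP] := lcoef_truncated h.
have [gh0 gh] := mulP gM hP; have [fg0 fg] := mulP fN gM.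
have [] := mulP fN gh0; have [] := mulP fg0 hP.
rewrite fg gh mulrA -addrA => l0 l r0 r.
by apply: (shift_eq r0 l0); rewrite l r.
Qed.

Let mulC : commutative laurent_mul.
Proof.
move=> f g; have [N fN] := lcoef_truncated f.
have [M gM] := lcoef_truncated g.
have [fg0 fg] := mulP fN gM; have [gf0 gf] := mulP gM fN.
by rewrite addrC in gf0 gf; apply: (shift_eq fg0 gf0); rewrite fg gf mulrC.
Qed.

Lemma laurent_constM a f n : laurent_mul (laurent_const a) f n = a * f n.
Proof.
rewrite /= (fsbigE [:: 0 : int]) //= => [|i _].
  by rewrite big_cons big_nil in_setT eqxx subr0 addr0.
by rewrite inE => /negbTE->; rewrite mul0r.
Qed.

Let mul1 : left_id (laurent_const 1) laurent_mul.
Proof. by move=> f; apply: laurentP => n; rewrite laurent_constM mul1r. Qed.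

Let mulDl : left_distributive laurent_mul +%R.
Proof.
move=> f g h; have [P hP] := lcoef_truncated h.
have [N0 fN0] := lcoef_truncated f; have [M0 gM0] := lcoef_truncated g.
pose N := Num.min N0 M0.
have fN m : m < N -> f m = 0 by rewrite lt_min => /andP[/fN0].
have gN m : m < N -> g m = 0 by rewrite lt_min => /andP[_ /gM0].
have fgN m : m < N -> (f + g) m = 0 by move=> mN; rewrite /= fN ?gN ?addr0.
have [fh0 fh] := mulP fN hP; have [gh0 gh] := mulP gN hP.
have [fgh0 fgh] := mulP fgN hP; apply: (shift_eq fgh0) => [m mNP|].
  by change (laurent_mul f h m + laurent_mul g h m = 0); rewrite fh0 ?gh0 ?addr0.
have shiftD Q (p q : laurent K) : shiftp Q (p + q) = shiftp Q p + shiftp Q q.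
  exact: powserP.
by rewrite fgh !shiftD fh gh mulrDl.
Qed.

Let one_neq0 : laurent_const 1 != 0.
Proof.
by apply/eqP => /(congr1 (fun f : laurent K => f 0))/eqP; rewrite /= oner_eq0.
Qed.

HB.instance Definition _ := GRing.Zmodule_isComNzRing.Build (laurent K)
  mulA mulC mul1 mulDl one_neq0.

Lemma laurent_order f : f != 0 ->
  exists2 N, f N != 0 & forall m, m < N -> f m = 0.
Proof.
move=> f0; have [N fN] := lcoef_truncated f.
have : shiftp N f != 0.
  apply: contra f0 => /eqP f0; apply/eqP/(shift_eq (N := N)) => // [m _|].
    by rewrite /= if_same.
  by rewrite f0; apply: powserP => n; rewrite /= if_same.
move=> /powser_order[n fn nmin]; exists (N + n%:Z) => // m mn.
have [/fN//|Nm] := ltP m N.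
have := nmin `|m - N|%N; rewrite /=.
have -> : N + `|m - N|%N%:Z = m by lia.
by apply; lia.
Qed.

Let unshift_truncated N (p : powser K) :
  lower_truncated (fun n => if n < N then 0 else p `|n - N|%N).
Proof. by exists N => n ->. Qed.

Let laurent_invertible f : f != 0 -> exists g, g * f = 1.
Proof.
move=> /laurent_order[N fN0 fN].
have [|p fp] := @powser_invertible _ (shiftp N f); first by rewrite /= addr0.
pose g := Laurent (unshift_truncated (- N) p).
have gN m : m < - N -> g m = 0 by rewrite /g /= => ->.
exists g; rewrite mulrC; have [] := mulP fN gN; rewrite addrN => fg0 fg.
apply: (shift_eq fg0) => [m m0|]; first by rewrite /= lt_eqF.
rewrite fg; have -> : shiftp (- N) g = p.
  by apply: powserP => n; rewrite /= ltNge lerDl /=; congr (p _); lia.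
rewrite fp.
by apply: powserP => -[|n].
Qed.

Definition laurent_inv f : laurent K := xget 0 [set g | g * f = 1].

Let mulVf f : f != 0 -> laurent_inv f * f = 1.
Proof.
by move=> /laurent_invertible e; exact: (@xgetPex _ 0 [set g | g * f = 1] e).
Qed.

Let inv0 : laurent_inv 0 = 0.
Proof.
by apply: xgetPN => g /eqP; rewrite mulr0 eq_sym oner_eq0.
Qed.

HB.instance Definition _ := GRing.ComNzRing_isField.Build (laurent K) mulVf inv0.
End LaurentField.

Section LaurentConst.
Variable F : fieldType.

Lemma laurent_const1 : laurent_const (1 : F) = 1.
Proof. by []. Qed.

Lemma laurent_constD (a b : F) :
  laurent_const (a + b) = laurent_const a + laurent_const b.
Proof. by apply: laurentP => n /=; case: ifP => //; rewrite addr0. Qed.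

Lemma laurent_const_mul (a b : F) :
  laurent_const (a * b) = laurent_const a * laurent_const b.
Proof.
apply: laurentP => n; rewrite [RHS]laurent_constM /=.
by case: ifP => //; rewrite mulr0.
Qed.
End LaurentConst.

(* The F((t))-module [V], regarded as a vector space over F. *)
Definition over_base (F : fieldType) (V : lmodType (laurent F)) : Type := V.

Section OverBase.
Variables (F : fieldType) (V : lmodType (laurent F)).

HB.instance Definition _ := GRing.Zmodule.on (over_base V).

Definition base_scale (a : F) (v : over_base V) : over_base V :=
  laurent_const a *: (v : V).

Let scaleA a b v : base_scale a (base_scale b v) = base_scale (a * b) v.
Proof. by rewrite /base_scale scalerA laurent_const_mul. Qed.
Let scale1 : left_id 1 base_scale.
Proof. by move=> v; rewrite /base_scale laurent_const1 scale1r. Qed.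
Let scaleDr : right_distributive base_scale +%R.
Proof. by move=> a u v; exact: scalerDr. Qed.
Let scaleDl v : {morph base_scale^~ v : a b / a + b}.
Proof. by move=> a b; rewrite /base_scale laurent_constD scalerDl. Qed.

HB.instance Definition _ := GRing.Zmodule_isLmodule.Build F (over_base V)
  scaleA scale1 scaleDr scaleDl.
End OverBase.

Section LaurentOps.
Variable K : fieldType.

Lemma lseries_subproof (s : nat -> K) :
  lower_truncated (fun n : int => if n is Posz m then s m else 0).
Proof. by exists 0 => -[]. Qed.

(* The series [\sum_(n >= 0) s n x^n], in K[[x]], as an element of K((x)). *)
Definition lseries (s : nat -> K) : laurent K := Laurent (lseries_subproof s).

Lemma lderiv_subproof (f : laurent K) :
  lower_truncated (fun n => (n + 1)%:~R * f (n + 1)).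
Proof.
case: f => f [N fN]; exists (N - 1) => n nN /=.
by rewrite fN ?mulr0 //; lia.
Qed.

Definition lderiv (f : laurent K) : laurent K := Laurent (lderiv_subproof f).
End LaurentOps.

(* [f(t + x) = e^{x d/dt} f(t)]; the outer variable of the codomain
   F((t))((x)) is [x]. *)
Definition taylor_shift (F : fieldType) (f : laurent F) : laurent (laurent F) :=
  lseries (fun n => iter n (@lderiv F) f / n`!%:R).

Local Open Scope quotient_scope.

Section Localization.
Variable F : fieldType.

(* [g b a] is the coefficient of [x1^a x2^b] in [g : powser2], and [h n b a]
   that of [t^n x1^a x2^b] in [h : powser3]. *)
Definition powser2 := powser (powser F).
Definition powser3 := powser powser2.

Definition is_polynomial (p : powser2) : Prop :=
  exists N : nat, forall a b : nat, (N <= a)%N || (N <= b)%N -> p b a = 0.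

Definition Fstar2 : set {fraction powser2} :=
  [set f | exists g p : powser2,
     [/\ p != 0, is_polynomial p & f = tofrac g / tofrac p]].

Definition dx1 (g : powser2) : powser2 :=
  Powser (fun b => Powser (fun a => g b a.+1 *+ a.+1)).
Definition dx2 (g : powser2) : powser2 :=
  Powser (fun b => Powser (fun a => g b.+1 a *+ b.+1)).

(* [e^{t (d/dx1 + d/dx2)}] on F[[x1, x2]] *)
Definition exp_shift (g : powser2) : powser3 :=
  Powser (fun n => Powser (fun b => Powser (fun a =>
    iter n (fun h => dx1 h + dx2 h) g b a / n`!%:R))).

(* The inclusion of F[[t, x1, x2]] into F((t))((x2))((x1)): for [h] in the
   codomain, [h a b n] is the coefficient of [t^n x1^a x2^b]. *)
Definition incl_t21 (h : powser3) : laurent (laurent (laurent F)) :=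
  lseries (fun a => lseries (fun b => lseries (fun n => h n b a))).
End Localization.

Lemma frac_numden (R : idomainType) (f : {fraction R}) :
  f * tofrac \d_(repr f) = tofrac \n_(repr f).
Proof.
elim/quotW: f => x; move: (repr _) (reprK (\pi_{fraction R} x)) => r <-.
unlock tofrac; rewrite -[LHS]FracField.pi_mul; apply/eqmodP.
rewrite /= FracField.equivfE /FracField.mulf.
rewrite !numden_Ratio ?mulf_neq0 ?oner_neq0 ?denom_ratioP //.
by rewrite !mulr1 mulrC.
Qed.

(* The extension to fractions of an injective ring morphism into a field. *)
Definition frac_lift (R : idomainType) (L : fieldType) (phi : R -> L)
    (f : {fraction R}) : L :=
  phi \n_(repr f) / phi \d_(repr f).

Lemma frac_liftE (R : idomainType) (L : fieldType) (phi : {rmorphism R -> L})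
    (g p : R) : injective phi -> p != 0 ->
  frac_lift phi (tofrac g / tofrac p) = phi g / phi p.
Proof.
move=> phi_inj p0; set f := tofrac g / tofrac p.
have phi0 q : q != 0 -> phi q != 0 by rewrite raddf_eq0.
have /eqP : g * \d_(repr f) = \n_(repr f) * p.
  apply/eqP; rewrite -tofrac_eq !rmorphM /= -frac_numden /f mulrAC.
  by rewrite divfK ?tofrac_eq0.
rewrite -(inj_eq phi_inj) !rmorphM /= => /eqP gp.
by apply/eqP; rewrite eqr_div ?phi0 ?denom_ratioP // gp.
Qed.

(* [f(t + x1, t + x2)] in the fraction field of F[[t, x1, x2]]: as
   [e^{t (d/dx1 + d/dx2)}] is a ring morphism, it sends [g / p] to the quotient
   of the images of [g] and [p]. *)
Definition frac_shift (F : fieldType) (f : {fraction powser2 F}) :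
    {fraction powser3 F} :=
  frac_lift (fun g => tofrac (exp_shift g)) f.

(* [iota_{t, x2, x1}] *)
Definition iota_t21 (F : fieldType) :
    {fraction powser3 F} -> laurent (laurent (laurent F)) :=
  frac_lift (@incl_t21 F).

(* A formal series in [x], [(x, y)] or [(x, y, z)], infinite in all directions,
   is the function mapping exponents to coefficients. The sums over infinite
   index sets below have finitely many nonzero terms wherever the
   corresponding formal expression is defined. *)

Section FormalCalculus.
Variable K : fieldType.

Definition binz (n : int) (i : nat) : K :=
  (\prod_(j < i) (n - j%:Z)%:~R) / i`!%:R.

(* The coefficient of [y^i z^j] in [(y + c z)^n], expanded in nonnegative powers
   of [z]. *)
Definition pow_lin (c : K) (n i j : int) : K :=
  if (i + j == n) && (0 <= j) then binz n `|j| * c ^+ `|j| else 0.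

(* The coefficient of [x^l y^m z^k] in [x^-1 delta((y - z) / (e x))],
   where [e] is [1] or [-1]. *)
Definition delta3 (e : K) (l m k : int) : K :=
  e ^ (l + 1) * pow_lin (-1) (- l - 1) m k.

Variable V : lmodType K.

(* The action of K((x)) on V((x)) *)
Definition fmul1 (f : laurent K) (s : int -> V) (n : int) : V :=
  \sum_(i \in [set: int]) f i *: s (n - i).

Definition fmul2 (p : int -> int -> K) (A : int -> int -> V) (m n : int) : V :=
  \sum_(i \in [set: int * int]) p i.1 i.2 *: A (m - i.1) (n - i.2).

Definition fmul3 (p : int -> int -> int -> K) (A : int -> int -> int -> V)
    (l m n : int) : V :=
  \sum_(i \in [set: int * int * int])
    p i.1.1 i.1.2 i.2 *: A (l - i.1.1) (m - i.1.2) (n - i.2).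

(* [A(x0 + x2, x2)] for [A(x1, x2)], as a series in [(x0, x2)] *)
Definition subst_02 (A : int -> int -> V) (p q : int) : V :=
  \sum_(i \in [set: int * int]) pow_lin 1 i.1 p i.2 *: A i.1 (q - i.2).

(* [A(x + x0, x)] for [A(x1, x)], as a series in [(x0, x)] *)
Definition subst_x0 (A : int -> int -> V) (p q : int) : V :=
  \sum_(i \in [set: int * int]) pow_lin 1 i.1 i.2 p *: A i.1 (q - i.2).

(* [s] lies in V((x, y)) *)
Definition lower_truncated2 (s : int -> int -> V) : Prop :=
  exists N : int, forall m n : int, (m < N) || (n < N) -> s m n = 0.

(* [s] lies in V((x_1, ..., x_r)) *)
Definition lower_truncatedn r (s : 'rV[int]_r -> V) : Prop :=
  exists N : int, forall (n : 'rV[int]_r) (i : 'I_r), n 0 i < N -> s n = 0.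

(* [s] multiplied by [x_i - x_j] *)
Definition mulXB r (i j : 'I_r) (s : 'rV[int]_r -> V) (n : 'rV[int]_r) : V :=
  s (n - delta_mx 0 i) - s (n - delta_mx 0 j).

(* [s] multiplied by [\prod_(i < j) (x_i - x_j)^k] *)
Definition mul_vandermonde r (k : nat) (s : 'rV[int]_r -> V) :
    'rV[int]_r -> V :=
  (\big[comp/idfun]_(i < r) \big[comp/idfun]_(j < r | (i < j)%N)
     iter k (mulXB i j)) s.

(* [a] lies in Hom(V, V((x))); [a v n] is the coefficient of [x^n] in
   [a(x) v]. *)
Definition hom_laurent (a : V -> int -> V) : Prop :=
  linear a /\ forall v, lower_truncated (a v).

(* [a_n] for [a(x) = \sum_n a_n x^(-n-1)] *)
Definition mode (a : V -> int -> V) (n : int) (v : V) : V := a v (- n - 1).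

(* [a(x1) b(x2) w], as a series in [(x1, x2)] *)
Definition prod12 (a b : V -> int -> V) (w : V) (m n : int) : V :=
  a (b w n) m.

(* [a(x2) b(x1) w], as a series in [(x1, x2)] *)
Definition prod21 (a b : V -> int -> V) (w : V) (m n : int) : V :=
  a (b w m) n.

(* [a_1(x_1) ... a_r(x_r) w] *)
Definition prodn r (a : 'I_r -> V -> int -> V) (w : V) (n : 'rV[int]_r) : V :=
  foldr (fun i v => a i v (n 0 i)) w (enum 'I_r).

Definition cst_series (v : V) (n : int) : V := if n == 0 then v else 0.
End FormalCalculus.

(* The action on V((x2))((x1)) of F((t))((x2))((x1)), for an F((t))-module V *)
Definition fmul21 (F : fieldType) (V : lmodType (laurent F))
    (h : laurent (laurent (laurent F))) (A : int -> int -> V) : int -> int -> V :=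
  fmul2 (fun m n => h m n) A.


Section NonlocalVertexAlgebra.
Variables (F : fieldType) (V : lmodType F).
Variables (Y : V -> V -> int -> V) (vac : V).

(* [(x0 + x2)^l Y(u, x0 + x2) Y(v, x2) w
    = (x0 + x2)^l Y(Y(u, x0) v, x2) w] *)
Definition weak_associativity : Prop :=
  forall u v w : V, exists l : nat,
    fmul2 (pow_lin 1 l) (subst_02 (prod12 (Y u) (Y v) w))
    = fmul2 (pow_lin 1 l) (fun m n => Y (Y u v m) w n).

Definition nonlocal_vertex_algebra : Prop :=
  [/\ linear Y,
      forall v, hom_laurent (Y v),
      forall v, Y vac v = cst_series v,
      forall v, (forall n : int, n < 0 -> Y v vac n = 0) /\ Y v vac 0 = v
    & weak_associativity].
End NonlocalVertexAlgebra.

Section FtVertexAlgebra.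
Variables (F : fieldType) (V : lmodType (laurent F)).
Variables (Y : V -> V -> int -> V) (vac : V).

Definition nonlocal_vertex_Ft_algebra : Prop :=
  @nonlocal_vertex_algebra F (over_base V) Y vac /\
  forall (f g : laurent F) (u v : V),
    Y (f *: u) (g *: v) = fmul1 (taylor_shift f) (g *: Y u v).

Definition jacobi_identity (u v : V) r (u' v' : 'I_r -> V)
    (f : 'I_r -> {fraction powser2 F}) : Prop :=
  forall w : V,
    fmul3 (delta3 1)
      (fun l m n => cst_series (prod12 (Y u) (Y v) w m n) l)
    - fmul3 (fun l m n => delta3 (-1) l n m)
        (fun l m n => cst_series
           ((\sum_i fmul21 (iota_t21 (frac_shift (f i)))
                      (prod21 (Y (v' i)) (Y (u' i)) w)) m n) l)
    = fmul3 (fun l m n => delta3 1 n m l)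
        (fun l m n => cst_series (Y (Y u v l) w n) m).

Definition weak_quantum_vertex_Ft_algebra : Prop :=
  nonlocal_vertex_Ft_algebra /\
  forall u v : V, exists r (u' v' : 'I_r -> V)
    (f : 'I_r -> {fraction powser2 F}),
    (forall i, Fstar2 (f i)) /\ jacobi_identity u v u' v' f.

End FtVertexAlgebra.

Section FieldSpace.
Variables (F : fieldType) (V : lmodType (laurent F)).
Implicit Types (a b : V -> int -> V) (S : set (V -> int -> V)).

(* [E(V) = Hom_{F((t))}(V, V((x)))] *)
Definition Espace : set (V -> int -> V) := [set a | hom_laurent a].

Definition one_field : V -> int -> V := @cst_series (laurent F) V.

(* The action of F((t))((x)) on E(V) *)
Definition Escale (f : laurent (laurent F)) a : V -> int -> V :=
  fun v => fmul1 f (a v).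

Definition compatible S : Prop :=
  forall r (a : 'I_r -> V -> int -> V), (forall i, S (a i)) ->
  exists k : nat,
    let A := fun w => mul_vandermonde k (prodn a w) in
    linear (A : over_base V -> 'rV[int]_r -> over_base V) /\
    forall w, lower_truncatedn (A w).

(* [(x1 - x)^k a(x1) b(x) w] *)
Definition prod_times (k : nat) a b (w : V) : int -> int -> V :=
  fmul2 (pow_lin (-1) k) (prod12 a b w).

Definition pair_compatible (k : nat) a b : Prop :=
  linear (prod_times k a b : over_base V -> int -> int -> over_base V) /\
  forall w, lower_truncated2 (prod_times k a b w).

(* [Y_E(a(x), x0) b(x) w], as a series in [(x0, x)]. It does not depend on the
   choice of [k] among those satisfying [pair_compatible k a b]. *)
Definition YE a b (w : V) (p q : int) : V :=
  let k := xget 0%N [set k | pair_compatible k a b] in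
  subst_x0 (prod_times k a b w) (p + k%:Z) q.

(* [a(x)_n b(x)] *)
Definition nprod (n : int) a b : V -> int -> V :=
  fun w q => YE a b w (- n - 1) q.

Definition closed_compatible_subspace S : Prop :=
  [/\ S `<=` Espace, submod_closed [in S], compatible S
    & forall n a b, S a -> S b -> S (nprod n a b)].

(* [<U(x)>] for [S = U(x)], as an intersection; for compatible [S] some
   closed compatible subspace does contain it. *)
Definition generated S : set (V -> int -> V) :=
  smallest closed_compatible_subspace (S `|` [set one_field]).

(* The F((t))((x))-span of [S] *)
Definition Espan S : set (V -> int -> V) :=
  [set a | exists r (f : 'I_r -> laurent (laurent F)) (b : 'I_r -> V -> int -> V),
    (forall i, S (b i)) /\ a = \sum_i Escale (f i) (b i)].

Definition St_local S : Prop :=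
  forall a b, S a -> S b ->
  exists r (u v : 'I_r -> V -> int -> V) (f : 'I_r -> {fraction powser2 F})
    (k : nat),
    (forall i, [/\ S (u i), S (v i) & Fstar2 (f i)]) /\
    forall w : V,
      fmul2 (pow_lin (-1) k) (prod12 a b w)
      = fmul2 (pow_lin (-1) k)
          (\sum_i fmul21 (iota_t21 (frac_shift (f i))) (prod21 (u i) (v i) w)).

(* The vectors [u^(1)_{m_1} ... u^(r)_{m_r} 1] with the [u^(i)] in [U] *)
Definition monomials (U : set V) (Y0 : V -> V -> int -> V) (vac : V) : set V :=
  [set v | exists s : seq (V * int), (forall um, um \in s -> U um.1) /\
     v = foldr (fun um => mode (Y0 um.1) um.2) vac s].

Definition linear_span (S : set V) : set V :=
  [set v | exists r (f : 'I_r -> laurent F) (w : 'I_r -> V),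
    (forall i, S (w i)) /\ v = \sum_i f i *: w i].
End FieldSpace.

(* Main.v *)
(* The identity psi(u_n v) = psi(u)_n psi(v), assumed for u in U, extends to all
   u in V by induction on u, since n-th products of compatible fields satisfy the
   same iterate formula as the modes. Here a(x)_n b(x) is a coefficient in x0 of
   (x1 - x2)^k a(x1) b(x2) at x1 = x + x0, x2 = x. This substitution turns a factor
   x1 - x3 into x + x0 - x3, which divides a power of x - x3 modulo any given power
   of x0; hence relations that hold up to factors x_i - x_j survive it. This gives
   compatibility of the fields psi(v), as well as the propagation of S_t-locality
   from U to V, first in the second field and then in the first; the coefficients
   f(t + x1, t + x2) are differentiated in the process, and they form a family
   stable under products and divided powers of the two derivations.
   As (x1 - x2)^k psi(u, x1) psi(v, x2) w lies in V((x1, x2)), weak associativity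
   compares two expansions of one series, and so does the Jacobi identity once
   S_t-locality is known. The creation property comes from D: the series
   G = (x1 - x2)^k u(x1) psi(b, x2) 1 satisfies D G = (d/dx1 + d/dx2) G, which
   excludes negative powers. *)

(* Series are plain functions of exponents, so each identity is a rearrangement of finitely
   supported sums; [trunc], [fusable], [finl], [okf], [laurent12_0] and [laurent2_01] record the
   truncation that a given rearrangement consumes. Factors x_i - x_j are kept as a list chosen
   before the vector w, since both compatibility and locality require uniformity in w. The maps
   [psi] and D are linear over F only, whereas the scalars form F((t)); they pass through the
   substitution because its coefficients are binomials, hence constants. Locality has to be extended
   in two stages. To exchange a with b_n c, a is moved past b, and the fields a' so produced are
   moved past c; for a in U locality keeps every a' in U, so an induction on the second field,
   uniform over U, closes. To exchange b_n c with v, v is moved past c, which produces uncontrolled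
   fields v'; hence b must already exchange with every v', which is the first stage. *)
Require Import Defs.
From HB Require Import structures.
From mathcomp Require Import all_boot all_order all_algebra.
From mathcomp Require Import all_classical.
From mathcomp Require Import zify ring.

Set Implicit Arguments.
Unset Strict Implicit.
Unset Printing Implicit Defensive.

Import Order.TTheory GRing.Theory Num.Theory.

Local Open Scope classical_set_scope.
Local Open Scope ring_scope.

(** * Sums over the integers *)

Section IntSums.
Variable M : zmodType.
Implicit Types f g : int -> M.

(** Equal to 0 by convention when the support is infinite, so additivity always needs a finiteness
    hypothesis. *)
Definition isum f : M := \sum_(i \in [set: int]) f i.

Definition fin f := exists N : nat, forall i : int, (N < absz i)%N -> f i = 0.

Definition window (N : nat) : seq int :=
  [seq Posz k - Posz N | k <- iota 0 N.*2.+1].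

Lemma mem_window N i : (i \in window N) = (absz i <= N)%N.
Proof.
apply/mapP/idP => [[k]|iN]; first by rewrite mem_iota => ? ->; lia.
by exists (absz (i + N%:Z)); rewrite ?mem_iota; lia.
Qed.

Lemma uniq_window N : uniq (window N).
Proof. by rewrite map_inj_uniq ?iota_uniq // => i j; lia. Qed.

Lemma isumE f N : (forall i : int, (N < absz i)%N -> f i = 0) ->
  isum f = \sum_(i <- window N) f i.
Proof.
move=> fN; rewrite /isum (fsbigE (window N)) ?uniq_window //; last first.
  by move=> i _; rewrite mem_window -ltnNge => /fN.
by apply: eq_bigl => i; rewrite in_setT.
Qed.

Lemma eq_isum f g : f =1 g -> isum f = isum g.
Proof. by move=> /funext->. Qed.

Lemma isum0 f : (forall i, f i = 0) -> isum f = 0.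
Proof. by move=> f0; apply: fsbig1. Qed.

Lemma isum1 f i : (forall j, j != i -> f j = 0) -> isum f = f i.
Proof.
move=> f0; rewrite /isum (fsbigE [:: i]) //= => [|j _].
  by rewrite big_cons big_nil in_setT addr0.
by rewrite inE => /f0.
Qed.

Lemma isum_bij f (h k : int -> int) : cancel h k -> cancel k h ->
  isum f = isum (fun i => f (h i)).
Proof. by move=> hk kh; apply: reindex_fsbigT; exists k. Qed.

Lemma isum_shift f c : isum f = isum (fun i => f (i + c)).
Proof. by apply: (@isum_bij f (fun i => i + c) (fun i => i - c)) => i; lia. Qed.

Lemma isum_flip f c : isum f = isum (fun i => f (c - i)).
Proof. by apply: (@isum_bij f (fun i => c - i) (fun i => c - i)) => i; lia. Qed.

Lemma finN f : fin f -> fin (fun i => - f i).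
Proof. by move=> [N fN]; exists N => i /fN->; rewrite oppr0. Qed.

Lemma fin_le f (P Q : int) : (forall i, (i < P) || (Q < i) -> f i = 0) -> fin f.
Proof. by move=> fPQ; exists (`|P| + `|Q|)%N => i Ni; apply: fPQ; lia. Qed.

Lemma fin_shift f c : fin f -> fin (fun i => f (i + c)).
Proof. by move=> [N fN]; exists (N + `|c|)%N => i Ni; apply: fN; lia. Qed.

Lemma isumD f g : fin f -> fin g ->
  isum (fun i => f i + g i) = isum f + isum g.
Proof.
move=> [N fN] [P gP].
have fm i : (maxn N P < absz i)%N -> f i = 0.
  by rewrite gtn_max => /andP[/fN].
have gm i : (maxn N P < absz i)%N -> g i = 0.
  by rewrite gtn_max => /andP[_ /gP].
rewrite (isumE fm) (isumE gm) (isumE (N := maxn N P)) ?big_split //.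
by move=> i Ni; rewrite fm ?gm ?addr0.
Qed.

Lemma isum_fsum (I : Type) (r : seq I) (F : I -> int -> M) :
  (forall k, fin (F k)) -> isum (fun i => \sum_(k <- r) F k i) =
  \sum_(k <- r) isum (F k).
Proof.
move=> finF; elim: r => [|k r IHr].
  by rewrite big_nil isum0 // => i; rewrite big_nil.
rewrite big_cons -IHr -isumD //; last first.
  elim: r {IHr} => [|l r [N rN]].
    by exists 0%N => i _; rewrite big_nil.
  have [P lP] := finF l; exists (maxn N P) => i.
  by rewrite gtn_max big_cons => /andP[/rN-> /lP->]; rewrite addr0.
by apply: eq_isum => i; rewrite big_cons.
Qed.

End IntSums.

Lemma isum_raddf (M N : zmodType) (phi : M -> N) (f : int -> M) :
  phi 0 = 0 -> {morph phi : u v / u + v} -> fin f ->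
  phi (isum f) = isum (fun i => phi (f i)).
Proof.
move=> phi0 phiD [P fP]; rewrite (isumE fP) (isumE (N := P)).
  by elim/big_rec2: _ => // i u v _ <-; rewrite phiD.
by move=> i /fP->.
Qed.

Lemma isumN (M : zmodType) (f : int -> M) : fin f ->
  isum (fun i => - f i) = - isum f.
Proof. by move=> ff; rewrite (@isum_raddf _ _ -%R) ?oppr0 //; exact: opprD. Qed.

Lemma isumB (M : zmodType) (f g : int -> M) : fin f -> fin g ->
  isum (fun i => f i - g i) = isum f - isum g.
Proof. by move=> ff fg; rewrite isumD ?isumN //; apply: finN. Qed.

Lemma isumZ (K : pzRingType) (M : lmodType K) (c : K) (f : int -> M) : fin f ->
  isum (fun i => c *: f i) = c *: isum f.
Proof.
move=> ff; rewrite (@isum_raddf _ _ (fun v => c *: v)) ?scaler0 //.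
by move=> u v; rewrite scalerDr.
Qed.

Lemma isum_scalel (K : pzRingType) (M : lmodType K) (f : int -> K) (v : M) :
  fin f -> isum (fun i => f i *: v) = isum f *: v.
Proof.
move=> ff; rewrite (@isum_raddf _ _ (fun c => c *: v)) ?scale0r //.
by move=> a b; rewrite scalerDl.
Qed.

Definition fin2 (M : zmodType) (g : int -> int -> M) :=
  exists N : nat, forall i j : int, (N < absz i)%N || (N < absz j)%N -> g i j = 0.

Section DoubleSums.
Variable M : zmodType.
Implicit Types g : int -> int -> M.

Lemma fin2_row g i : fin2 g -> fin (g i).
Proof. by move=> [N gN]; exists N => j Nj; rewrite gN // Nj orbT. Qed.

Lemma fin2_sum g : fin2 g -> fin (fun i => isum (g i)).
Proof. by move=> [N gN]; exists N => i Ni; rewrite isum0 // => j; rewrite gN ?Ni. Qed.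

Lemma fin2_swap g : fin2 g -> fin2 (fun i j => g j i).
Proof. by move=> [N gN]; exists N => i j; rewrite orbC => /gN. Qed.

Lemma isum_exchange g : fin2 g ->
  isum (fun i => isum (g i)) = isum (fun j => isum (fun i => g i j)).
Proof.
move=> [N gN].
have rowE i : isum (g i) = \sum_(j <- window N) g i j.
  by apply: isumE => j Nj; rewrite gN ?Nj ?orbT.
have colE j : isum (g ^~ j) = \sum_(i <- window N) g i j.
  by apply: isumE => i Ni; rewrite gN ?Ni.
rewrite (isumE (N := N)) => [|i Ni]; last first.
  by rewrite isum0 // => j; rewrite gN ?Ni.
rewrite [RHS](isumE (N := N)) => [|j Nj]; last first.
  by rewrite isum0 // => i; rewrite gN ?Nj ?orbT.
under eq_bigr do rewrite rowE; under [RHS]eq_bigr do rewrite colE.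
by rewrite exchange_big.
Qed.
End DoubleSums.

(** * Binomial coefficients *)

Section Binomials.
Variable K : fieldType.
Hypothesis charK : [pchar K] =i pred0.

(* Extended by [0] to negative [p], so that Pascal's rule holds for all [p]. *)
Definition bz (m p : int) : K := if p is Posz i then binz K m i else 0.

Lemma natS_neq0 (n : nat) : n.+1%:R != 0 :> K.
Proof. by rewrite ((pcharf0P K).1 charK). Qed.

Lemma intf_neq0 (n : int) : n != 0 -> n%:~R != 0 :> K.
Proof.
case: n => [[|n] //|n] _; first exact: natS_neq0.
by rewrite NegzE mulrNz oppr_eq0; apply: natS_neq0.
Qed.

Lemma bz_lt0 m p : p < 0 -> bz m p = 0.
Proof. by case: p. Qed.

Lemma bz0 m : bz m 0 = 1.
Proof. by change (binz K m 0 = 1); rewrite /binz big_ord0 fact0 divr1. Qed.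

Lemma bzE m p : 0 <= p -> bz m p = binz K m `|p|.
Proof. by case: p. Qed.

(** With [bz0] this recursion determines the coefficients in characteristic 0; most identities below
    are proved by induction on p, cancelling the integer p + 1. *)
Lemma bz_rec m p : (p + 1)%:~R * bz m (p + 1) = (m - p)%:~R * bz m p.
Proof.
have [p0|] := leP 0 p; last first.
  case: p => // -[|p] _; last by rewrite !bz_lt0 ?mulr0 //; lia.
  by rewrite NegzE addNr mul0r bz_lt0 ?mulr0.
case: p p0 => // i _; have -> : Posz i + 1 = Posz i.+1 by lia.
rewrite /bz /binz big_ord_recr factS natrM /=.
have c0 := natS_neq0 i; have b0 : i`!%:R != 0 :> K.
  by case: i`! (fact_gt0 i) => // n _; apply: natS_neq0.
rewrite -!pmulrn; move: (\prod_(j < i) _) (i`!%:R) (i.+1%:R) b0 c0.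
by move=> a b c b0 c0; field; rewrite b0 c0.
Qed.

Lemma bz_ind_rec (P : int -> Prop) :
  (forall p, p < 0 -> P p) -> P 0 -> (forall p, 0 <= p -> P p -> P (p + 1)) ->
  forall p, P p.
Proof.
move=> Pneg P0 PS [n|n]; last exact: Pneg.
elim: n => // n IHn; have -> : Posz n.+1 = n%:Z + 1 by lia.
exact: PS.
Qed.

Lemma intf_inj (p : int) (a b : K) : p != 0 -> p%:~R * a = p%:~R * b -> a = b.
Proof. by move=> p0 /(mulfI (intf_neq0 p0)). Qed.

Lemma bzS m p : bz (m + 1) p = bz m p + bz m (p - 1).
Proof.
elim/bz_ind_rec: p => [p p0|//|p p0 IHp].
- by rewrite !bz_lt0 ?addr0 //; lia.
- by rewrite !bz0 bz_lt0 ?addr0.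
apply: (@intf_inj (p + 1)); first by lia.
rewrite bz_rec IHp !mulrDr bz_rec addrK.
have := bz_rec m (p - 1); rewrite subrK => e.
have -> : (m + 1 - p)%:~R * bz m (p - 1) = p%:~R * bz m p.
  by rewrite e; congr (_%:~R * _); lia.
by rewrite -!mulrDl -!intrD; congr (_%:~R * _); lia.
Qed.

Lemma bz_mulm m p : m%:~R * bz (m - 1) p = (m - p)%:~R * bz m p.
Proof.
rewrite -bz_rec -{3}(subrK 1 m) bzS addrK mulrDr bz_rec -mulrDl -intrD.
by congr (_%:~R * _); lia.
Qed.

Lemma bz_absorb m p : (p + 1)%:~R * bz (m + 1) (p + 1) = (m + 1)%:~R * bz m p.
Proof. by rewrite bz_rec -bz_mulm addrK. Qed.

Lemma bz_diag p : 0 <= p -> bz p p = 1.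
Proof.
elim/bz_ind_rec: p => [p|_|p p0 IHp _]; [by lia | exact: bz0|].
by apply: (@intf_inj (p + 1)); [lia | rewrite bz_absorb IHp].
Qed.

Lemma bz_gt m p : 0 <= m -> m < p -> bz m p = 0.
Proof.
move=> m0; have [p0|p0] := leP 0 p; last by rewrite bz_lt0.
elim/bz_ind_rec: p p0 => [p|//|p p0 IHp]; [by lia | by lia|move=> _ mp].
apply: (@intf_inj (p + 1)); first by lia.
rewrite bz_rec mulr0; have [->|pm] := eqVneq m p; first by rewrite subrr mul0r.
by rewrite IHp ?mulr0 //; lia.
Qed.

(** For m >= 0 the expansions of (x + y)^m in nonnegative powers of y and of x coincide; the
    comparison of expansions in weak associativity rests on this. *)
Lemma bz_sym m p : 0 <= m -> bz m (m - p) = bz m p.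
Proof.
have H k : forall p, 0 <= p -> bz (p + Posz k) p = bz (p + Posz k) (Posz k).
  elim: k => [|k IHk] q q0; first by rewrite addr0 bz0 bz_diag.
  have [e|e] := eqVneq q 0; first by rewrite e bz0 add0r bz_diag.
  apply: (@intf_inj k.+1%:Z) => //.
  have -> : k.+1%:Z = k%:Z + 1 by lia.
  rewrite addrA bz_absorb -IHk //.
  have := bz_mulm (q + k%:Z + 1) q; rewrite addrK => ->.
  by congr (_%:~R * _); lia.
move=> m0; have [p0|p0] := leP 0 p; last first.
  by rewrite (bz_lt0 _ p0) bz_gt //; lia.
have [pm|pm] := leP p m; last by rewrite bz_lt0 ?bz_gt //; lia.
have -> : m = p + Posz `|m - p|%N by lia.
by rewrite H //; congr bz; lia.
Qed.

Lemma bz_fin m n p : fin (fun l => bz m l * bz n (p - l)).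
Proof.
apply: (@fin_le _ _ 0 p) => l /orP[] ?; first by rewrite bz_lt0 ?mul0r.
by rewrite (@bz_lt0 n) ?mulr0 //; lia.
Qed.

(** Both sides satisfy [bz_rec] in p: the factor m + n - p splits as (m - l) + (n - (p - l)), each
    part raises one lower index, and after a shift of l the two sums recombine with the factor l +
    (p + 1 - l). *)
Lemma bz_Vandermonde m n p :
  bz (m + n) p = isum (fun l => bz m l * bz n (p - l)).
Proof.
elim/bz_ind_rec: p => [p p0||p p0 IHp].
- rewrite bz_lt0 // isum0 // => l; have [l0|l0] := ltP l 0.
    by rewrite bz_lt0 ?mul0r.
  by rewrite (@bz_lt0 n) ?mulr0 //; lia.
- rewrite bz0 (@isum1 _ _ 0) => [|l l0]; first by rewrite subr0 !bz0 mulr1.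
  have [l0'|l0'] := ltP l 0; first by rewrite bz_lt0 ?mul0r.
  by rewrite (@bz_lt0 n) ?mulr0 //; lia.
apply: (@intf_inj (p + 1)); first by lia.
rewrite bz_rec IHp.
have mulE c (h : int -> K) : fin h -> c * isum h = isum (fun l => c * h l).
  by move=> fh; rewrite (@isum_raddf _ _ ( *%R c)) ?mulr0 //; exact: mulrDr.
rewrite !mulE; try exact: bz_fin.
pose f l := (m - l)%:~R * bz m l * bz n (p - l).
pose g l := bz m l * ((n - (p - l))%:~R * bz n (p - l)).
have ff : fin f.
  apply: (@fin_le _ _ 0 p) => l /orP[] ?; rewrite /f.
    by rewrite bz_lt0 ?mulr0 ?mul0r.
  by rewrite (@bz_lt0 n) ?mulr0 //; lia.
have gf : fin g.
  apply: (@fin_le _ _ 0 p) => l /orP[] ?; rewrite /g.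
    by rewrite bz_lt0 ?mul0r.
  by rewrite (@bz_lt0 n) ?mulr0 //; lia.
transitivity (isum f + isum g).
  rewrite -isumD //; apply: eq_isum => l; rewrite /f /g.
  have -> : m + n - p = (m - l) + (n - (p - l)) by lia.
  by rewrite intrD; move: (bz m l) (bz n _) => a b; ring.
rewrite [isum f](@isum_shift _ _ (- 1)) -isumD //; last exact: fin_shift.
apply: eq_isum => l; rewrite /f /g.
have := bz_rec m (l - 1); rewrite subrK => <-.
have := bz_rec n (p - l); have -> : p - l + 1 = p + 1 - l by lia.
move=> <-; have -> : p - (l - 1) = p + 1 - l by lia.
transitivity ((l + (p + 1 - l))%:~R * (bz m l * bz n (p + 1 - l))).
  by rewrite intrD; move: (bz m l) (bz n _) => a b; ring.
by congr (_%:~R * _); lia.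
Qed.

Lemma bz_trinomial m i p : bz m i * bz i p = bz m p * bz (m - p) (i - p).
Proof.
have [p0|p0] := ltP p 0; first by rewrite !(@bz_lt0 _ p) // mulr0 mul0r.
have [ip|ip] := ltP i p.
  rewrite (@bz_lt0 _ (i - p)) ?mulr0; last by lia.
  have [i0|i0] := ltP i 0; first by rewrite bz_lt0 ?mul0r.
  by rewrite (bz_gt i0) ?mulr0.
have -> : i = p + Posz `|i - p|%N by lia.
elim: {ip i}`|_|%N => [|k IHk].
  by rewrite addr0 subrr bz_diag // bz0.
have -> : p + k.+1%:Z = p + k%:Z + 1 by lia.
apply: (@intf_inj (p + k%:Z + 1)); first by lia.
apply: (@intf_inj (k%:Z + 1)); first by lia.
transitivity ((p + k%:Z + 1)%:~R * bz m (p + k%:Z + 1) *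
              ((k%:Z + 1)%:~R * bz (p + k%:Z + 1) p)); first by ring.
have := bz_mulm (p + k%:Z + 1) p; rewrite addrK.
have -> : p + k%:Z + 1 - p = k%:Z + 1 by lia.
move=> <-; rewrite bz_rec.
transitivity ((p + k%:Z + 1)%:~R * (m - (p + k%:Z))%:~R *
              (bz m (p + k%:Z) * bz (p + k%:Z) p)); first by ring.
rewrite IHk; have -> : p + k%:Z - p = k%:Z by lia.
have := bz_rec (m - p) k%:Z => e.
transitivity ((p + k%:Z + 1)%:~R * bz m p *
  ((k%:Z + 1)%:~R * bz (m - p) (k%:Z + 1))); last by ring.
rewrite e; have -> : m - (p + k%:Z) = m - p - k%:Z by lia.
move: (bz m p) (bz _ _) => a b; ring.
Qed.

Lemma bz_opp m (i : nat) : bz (- m - 1) i = (-1) ^+ i * bz (m + i%:Z) i.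
Proof.
elim: i => [|i IHi]; first by rewrite !bz0 mulr1.
apply: (@intf_inj i.+1%:Z) => //.
have -> : Posz i.+1 = i%:Z + 1 by lia.
rewrite bz_rec IHi [RHS]mulrCA addrA bz_absorb exprS.
have -> : - m - 1 - i%:Z = - (m + i%:Z + 1) by lia.
by rewrite mulrNz; ring.
Qed.

End Binomials.

Arguments bz : simpl never.

(** * Substitution of x + x0 and x for consecutive variables *)

Section Diagonal.
Variables (K : fieldType) (charK : [pchar K] =i pred0) (V : lmodType K).
Implicit Types G : int -> int -> V.

(* The coefficient of [x0^p x^q] in [G(x + x0, x)] *)
Definition J2 (p : int) G (q : int) : V :=
  isum (fun m => bz K m p *: G m (q - m + p)).

(** The coefficients of (x1 - x2) G(x1, x2). *)
Definition d2 G (m n : int) : V := G (m - 1) n - G m (n - 1).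

Lemma trunc2D G G' : lower_truncated2 G -> lower_truncated2 G' ->
  lower_truncated2 (fun m n => G m n + G' m n).
Proof.
move=> [N GN] [N' GN']; exists (Num.min N N') => m n mn.
by rewrite GN ?GN' ?addr0 //; lia.
Qed.

Lemma trunc2N G : lower_truncated2 G -> lower_truncated2 (fun m n => - G m n).
Proof. by move=> [N GN]; exists N => m n /GN->; rewrite oppr0. Qed.

Lemma trunc2_shift G a b : lower_truncated2 G ->
  lower_truncated2 (fun m n => G (m + a) (n + b)).
Proof. by move=> [N GN]; exists (N - `|a| - `|b|) => m n mn; apply: GN; lia. Qed.

Lemma J2_fin p G q : lower_truncated2 G ->
  fin (fun m => bz K m p *: G m (q - m + p)).
Proof.
move=> [N GN]; apply: (@fin_le _ _ N (q + p - N)) => m mN.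
by rewrite GN ?scaler0 //; lia.
Qed.

Lemma eq_J2 p G G' q : (forall m n, G m n = G' m n) -> J2 p G q = J2 p G' q.
Proof. by move=> GG'; apply: eq_isum => m; rewrite GG'. Qed.

Lemma J2_lt0 p G q : p < 0 -> J2 p G q = 0.
Proof. by move=> p0; apply: isum0 => m; rewrite bz_lt0 ?scale0r. Qed.

Lemma J2D p G G' q : lower_truncated2 G -> lower_truncated2 G' ->
  J2 p (fun m n => G m n + G' m n) q = J2 p G q + J2 p G' q.
Proof.
move=> tG tG'; rewrite /J2 -isumD; try exact: J2_fin.
by apply: eq_isum => m; rewrite scalerDr.
Qed.

Lemma J2N p G q : lower_truncated2 G ->
  J2 p (fun m n => - G m n) q = - J2 p G q.
Proof.
move=> tG; rewrite /J2 -isumN; last exact: J2_fin.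
by apply: eq_isum => m; rewrite scalerN.
Qed.

Lemma J2B p G G' q : lower_truncated2 G -> lower_truncated2 G' ->
  J2 p (fun m n => G m n - G' m n) q = J2 p G q - J2 p G' q.
Proof. by move=> tG tG'; rewrite J2D ?J2N //; apply: trunc2N. Qed.

Lemma J2_0 p q : J2 p (fun _ _ => 0) q = 0.
Proof. by apply: isum0 => m; rewrite scaler0. Qed.

Lemma J2_X2 p G q : J2 p (fun m n => G m (n - 1)) q = J2 p G (q - 1).
Proof. by apply: eq_isum => m; congr (_ *: G _ _); lia. Qed.

(** The factor x1 - x2 becomes x0 under x1 = x + x0, x2 = x; on coefficients this is Pascal's rule,
    valid for every p because [bz] is extended by 0. *)
Lemma J2_d2 p G q : lower_truncated2 G -> J2 p (d2 G) q = J2 (p - 1) G q.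
Proof.
move=> tG; rewrite J2B; last first.
- by have := trunc2_shift 0 (- 1) tG; under eq_fun do under eq_fun do rewrite addr0.
- by have := trunc2_shift (- 1) 0 tG; under eq_fun do under eq_fun do rewrite addr0.
rewrite J2_X2 {1}/J2 (@isum_shift _ _ 1) /J2 -isumB; last exact: J2_fin.
  apply: eq_isum => m.
  have -> : q - (m + 1) + p = q - m + (p - 1) by lia.
  have -> : q - 1 - m + p = q - m + (p - 1) by lia.
  by rewrite addrK -scalerBl bzS // addrC addKr.
case: tG => N GN; apply: (@fin_le _ _ N (q + p - N)) => m mN.
by rewrite GN ?scaler0 //; lia.
Qed.

Lemma J2_iter_d2 k p G q : lower_truncated2 G ->
  J2 p (iter k d2 G) q = J2 (p - k%:Z) G q.
Proof.
elim: k p G => [|k IHk] p G tG; first by rewrite subr0.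
rewrite iterSr IHk ?J2_d2 //; first by rewrite (_ : p - _ - 1 = p - k.+1%:Z) //; lia.
apply: trunc2D; last apply: trunc2N.
- by have := trunc2_shift (- 1) 0 tG; under eq_fun do under eq_fun do rewrite addr0.
- by have := trunc2_shift 0 (- 1) tG; under eq_fun do under eq_fun do rewrite addr0.
Qed.

End Diagonal.

(** Compatibility with scalars is only asked for binomial coefficients, so that the lemma also
    covers D and [psi], which are linear over F but not over F((t)). *)
Lemma J2_raddf (K : fieldType) (V W : lmodType K) (phi : V -> W) p G q :
  {morph phi : u v / u + v} ->
  (forall m v, phi (bz K m p *: v) = bz K m p *: phi v) ->
  lower_truncated2 G -> phi (J2 p G q) = J2 p (fun m n => phi (G m n)) q.
Proof.
move=> phiD phiZ tG; rewrite /J2 isum_raddf //; last exact: J2_fin.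
  by apply: eq_isum => m; rewrite phiZ.
by apply: (@addrI _ (phi 0)); rewrite -phiD !addr0.
Qed.

(* A series in [x_0, ..., x_(r-1)] is a function of exponents [e : nat -> int] that
   only depends on [e 0, ..., e (r - 1)]. *)
Definition dec (i : nat) (e : nat -> int) : nat -> int :=
  fun j => e j - (j == i)%:Z.

(** Recovers the exponents before a fusion: [e] belongs to the fused series, x_i and x_(i+1) receive
    m and n, later variables move up by one, and the entry e i is discarded. *)
Definition ins (i : nat) (m n : int) (e : nat -> int) : nat -> int :=
  fun j => if (j < i)%N then e j else if j == i then m
    else if j == i.+1 then n else e j.-1.

(* The variable into which the [j]-th one is turned by fusing [x_i], [x_(i+1)] *)
Definition fuse (i j : nat) : nat := if (j <= i)%N then j else j.-1.

Lemma ins_fst i m n e : ins i m n e i = m.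
Proof. by rewrite /ins ltnn eqxx. Qed.

Lemma ins_snd i m n e : ins i m n e i.+1 = n.
Proof. by rewrite /ins ltnNge leqnSn gtn_eqF //= eqxx. Qed.

Lemma ins_lt i m n e j : (j < i)%N -> ins i m n e j = e j.
Proof. by rewrite /ins => ->. Qed.

Lemma ins_gt i m n e j : (i < j)%N -> ins i m n e j.+1 = e j.
Proof. by move=> ij; rewrite /ins ifF ?ifF //; lia. Qed.

Lemma decC i j e : dec i (dec j e) = dec j (dec i e).
Proof. by apply/funext => k; rewrite /dec; lia. Qed.

Lemma ins_dec i m n e : ins i m n (dec i e) = ins i m n e.
Proof. by apply/funext => k; rewrite /ins /dec; do ?case: ifP => ?; lia. Qed.

Lemma dec_ins1 i m n e : dec i (ins i m n e) = ins i (m - 1) n e.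
Proof. by apply/funext => k; rewrite /ins /dec; do ?case: ifP => ?; lia. Qed.

Lemma dec_ins2 i m n e : dec i.+1 (ins i m n e) = ins i m (n - 1) e.
Proof. by apply/funext => k; rewrite /ins /dec; do ?case: ifP => ?; lia. Qed.

Lemma dec_ins i k m n e : k != i -> k != i.+1 ->
  dec k (ins i m n e) = ins i m n (dec (fuse i k) e).
Proof.
move=> ki ki1; apply/funext => l; rewrite /ins /dec /fuse.
by do ?case: ifP => ?; lia.
Qed.

Lemma dec_fuse i k e : k != i -> k != i.+1 -> dec (fuse i k) e i = e i.
Proof. by move=> ki ki1; rewrite /dec /fuse; case: leqP => ?; lia. Qed.

(** * Series in several variables and the fusion of two consecutive ones *)

Section Series.
Variables (K : fieldType) (charK : [pchar K] =i pred0) (V : lmodType K).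
Notation ser := ((nat -> int) -> V).
Implicit Types A B : ser.

(** Multiplication by x_i, by x_i - x_j, and by a product of such differences: lowering an exponent
    of the argument multiplies by the variable. *)
Definition Xm i A : ser := fun e => A (dec i e).
Definition dl i j A : ser := fun e => A (dec i e) - A (dec j e).
Definition mulL (s : seq (nat * nat)) A : ser :=
  foldr (fun ij B => dl ij.1 ij.2 B) A s.

(* The coefficient of [x0^p] after substituting [x_i = x + x0, x_(i+1) = x];
   the fused variable [x] is the [i]-th one of the result. *)
Definition J i p A : ser :=
  fun e => J2 p (fun m n => A (ins i m n e)) (e i).

(** Makes the sums in [J i p A] finite. Unlike in [trunc], the bound may depend on the exponents of
    the other variables. *)
Definition fusable i A :=
  forall e, lower_truncated2 (fun m n => A (ins i m n e)).

Definition trunc r A :=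
  exists N : int, forall e j, (j < r)%N -> e j < N -> A e = 0.

Lemma dlE i j A : dl i j A = Xm i A - Xm j A.
Proof. by []. Qed.

Lemma dlC i j k l A : dl i j (dl k l A) = dl k l (dl i j A).
Proof.
apply/funext => e; rewrite /dl opprD addrACA -opprD.
by rewrite (decC i k) (decC i l) (decC j k) (decC j l).
Qed.

Lemma dl_opp i j A : dl j i A = - dl i j A.
Proof. by apply/funext => e; rewrite /dl !fctE opprB. Qed.

Lemma dlD i j A B : dl i j (A + B) = dl i j A + dl i j B.
Proof. by apply/funext => e; rewrite /dl !fctE opprD addrACA. Qed.

Lemma dlN i j A : dl i j (- A) = - dl i j A.
Proof. by apply/funext => e; rewrite /dl !fctE opprD. Qed.

Lemma dl0 i j : dl i j 0 = 0.
Proof. by apply/funext => e; rewrite /dl subrr. Qed.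

Lemma mulL_cat s s' A : mulL (s ++ s') A = mulL s (mulL s' A).
Proof. by rewrite /mulL foldr_cat. Qed.

Lemma mulL_dl s i j A : mulL s (dl i j A) = dl i j (mulL s A).
Proof. by elim: s => //= -[k l] s ->; rewrite dlC. Qed.

Lemma mulLC s s' A : mulL s (mulL s' A) = mulL s' (mulL s A).
Proof. by elim: s' => //= -[k l] s' IHs; rewrite mulL_dl IHs. Qed.

Lemma mulLD s A B : mulL s (A + B) = mulL s A + mulL s B.
Proof. by elim: s => //= -[i j] s ->; rewrite dlD. Qed.

Lemma mulLN s A : mulL s (- A) = - mulL s A.
Proof. by elim: s => //= -[i j] s ->; rewrite dlN. Qed.

Lemma mulLB s A B : mulL s (A - B) = mulL s A - mulL s B.
Proof. by rewrite mulLD mulLN. Qed.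

Lemma mulL0 s : mulL s 0 = 0.
Proof. by elim: s => //= -[i j] s ->; rewrite dl0. Qed.

Lemma trunc_Xm r i A : trunc r A -> trunc r (Xm i A).
Proof.
move=> [N AN]; exists N => e j jr eN; apply: (AN _ j) => //.
by rewrite /dec; lia.
Qed.

Lemma trunc_add r A B : trunc r A -> trunc r B -> trunc r (A + B).
Proof.
move=> [N AN] [N' BN]; exists (Num.min N N') => e j jr eN.
by rewrite !fctE (AN _ j) ?(BN _ j) ?addr0 //; lia.
Qed.

Lemma trunc_opp r A : trunc r A -> trunc r (- A).
Proof.
by move=> [N AN]; exists N => e j jr eN; rewrite !fctE (AN _ j) ?oppr0.
Qed.

Lemma trunc_dl r i j A : trunc r A -> trunc r (dl i j A).
Proof. by move=> tA; rewrite dlE; apply: trunc_add; [|apply: trunc_opp]; apply: trunc_Xm. Qed.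

Lemma trunc_mulL r s A : trunc r A -> trunc r (mulL s A).
Proof. by move=> tA; elim: s => //= -[i j] s; apply: trunc_dl. Qed.

Lemma fusableD i A B : fusable i A -> fusable i B -> fusable i (A + B).
Proof. by move=> lA lB e; apply: trunc2D. Qed.

Lemma fusableN i A : fusable i A -> fusable i (- A).
Proof. by move=> lA e; apply: trunc2N. Qed.

Lemma fusableX i k A : fusable i A -> fusable i (Xm k A).
Proof.
move=> lA e; rewrite /Xm; have [->|ki] := eqVneq k i.
  have [N AN] := lA e; exists N => m n mn; rewrite dec_ins1 AN //; lia.
have [->|ki1] := eqVneq k i.+1.
  have [N AN] := lA e; exists N => m n mn; rewrite dec_ins2 AN //; lia.
by have [N AN] := lA (dec (fuse i k) e); exists N => m n mn; rewrite dec_ins ?AN.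
Qed.

Lemma fusable_dl i j k A : fusable i A -> fusable i (dl j k A).
Proof. by move=> lA; rewrite dlE; apply: fusableD; [|apply: fusableN]; apply: fusableX. Qed.

Lemma fusable_mulL i s A : fusable i A -> fusable i (mulL s A).
Proof. by move=> tA; elim: s => //= -[k j] s; apply: fusable_dl. Qed.

Lemma trunc_fusable r i A : (i < r)%N -> trunc r.+1 A -> fusable i A.
Proof.
move=> ir [N AN] e; exists N => m n /orP[mN|nN].
  by rewrite (AN _ i) ?ins_fst //; lia.
by rewrite (AN _ i.+1) ?ins_snd //; lia.
Qed.

Lemma J_lt0 i p A : p < 0 -> J i p A = 0.
Proof. by move=> p0; apply/funext => e; rewrite /J J2_lt0. Qed.

Lemma JD i p A B : fusable i A -> fusable i B -> J i p (A + B) = J i p A + J i p B.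
Proof. by move=> lA lB; apply/funext => e; rewrite /J J2D. Qed.

Lemma JN i p A : fusable i A -> J i p (- A) = - J i p A.
Proof. by move=> lA; apply/funext => e; rewrite /J J2N. Qed.

Lemma JB i p A B : fusable i A -> fusable i B -> J i p (A - B) = J i p A - J i p B.
Proof. by move=> lA lB; rewrite JD ?JN //; apply: fusableN. Qed.

Lemma J_X i k p A : k != i -> J i p (Xm k A) = Xm (fuse i k) (J i p A).
Proof.
move=> ki; apply/funext => e; rewrite /Xm /J.
have [->|ki1] := eqVneq k i.+1.
  have -> : fuse i i.+1 = i by rewrite /fuse ltnn.
  rewrite [dec i e i]/dec eqxx -J2_X2.
  by apply: eq_J2 => m n; rewrite dec_ins2 ins_dec.
by rewrite dec_fuse //; apply: eq_J2 => m n; rewrite dec_ins.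
Qed.

Lemma J_dl i k l p A : fusable i A -> k != i -> l != i ->
  J i p (dl k l A) = dl (fuse i k) (fuse i l) (J i p A).
Proof.
move=> lA ki li; rewrite !dlE JB; try exact: fusableX.
by rewrite !J_X.
Qed.

Lemma J_d i p A : fusable i A -> J i p (dl i i.+1 A) = J i (p - 1) A.
Proof.
move=> lA; apply/funext => e; rewrite /J -J2_d2 //.
by apply: eq_J2 => m n; rewrite /dl dec_ins1 dec_ins2.
Qed.

Lemma dl_split i j k A : dl i k A = dl i j A + dl j k A.
Proof. by apply/funext => e; rewrite /dl !fctE addrA subrK. Qed.

(** In x_k - x_i = (x_k - x_(i+1)) - (x_i - x_(i+1)) the second difference becomes x0, which lowers
    p by one. *)
Lemma J_dli i k p A : fusable i A -> k != i ->
  J i p (dl k i A) = dl (fuse i k) i (J i p A) - J i (p - 1) A.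
Proof.
move=> lA ki; rewrite (dl_split k i.+1) (dl_opp i) JD; try exact/fusableN/fusable_dl.
  rewrite JN ?J_d ?J_dl //; last exact: fusable_dl.
    by rewrite {2}/fuse ltnn.
  by rewrite eqn_leq ltnn.
exact: fusable_dl.
Qed.

Lemma trunc_J i r p A : (i < r)%N -> trunc r.+1 A -> trunc r (J i p A).
Proof.
(* The exponents m and e i - m + p of the two fused variables can both be at least N only if e i >=
   2 N - p. *)
move=> ir [N AN]; exists (Num.min N (N + N - p)) => e j jr eN.
apply: isum0 => m; rewrite (_ : A _ = 0) ?scaler0 //.
have [ji|ji|ji] := ltngtP j i.
- by rewrite (AN _ j) ?ins_lt //; lia.
- by rewrite (AN _ j.+1) ?ins_gt //; lia.
have [mN|mN] := ltP m N; first by rewrite (AN _ i) ?ins_fst //; lia.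
by rewrite (AN _ i.+1) ?ins_snd // -ji; lia.
Qed.

Definition validL r (s : seq (nat * nat)) :=
  all (fun ij => [&& (ij.1 < r)%N, (ij.2 < r)%N & ij.1 != ij.2]) s.

(* With [x_i = x + x0] and [x_(i+1) = x], a factor [x_j - x_i] becomes
   [x_j - x - x0], which divides a power of [x_j - x] modulo a power of [x0]. *)
Lemma collapse r i (s : seq (nat * nat)) : (i < r)%N -> validL r.+1 s ->
  forall q0 : nat, exists2 s', validL r s' &
  forall (T : ser -> Prop) A,
    (forall B C, T B -> T C -> T (B + C)) -> (forall B, T B -> T (- B)) ->
    (forall j k B, T B -> T (dl j k B)) -> T 0 -> fusable i A ->
    (forall q, T (J i q (mulL s A))) ->
    forall q : int, q <= q0%:Z -> T (mulL s' (J i q A)).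
Proof.
(* The predicate [T] will be truncation when compatibility is propagated and vanishing when locality
   is; only its closure properties matter here. *)
move=> ir; elim: s => [_ q0|[j k] s IHs /= /andP[/and3P[/= jr kr jk] vs] q0].
  by exists [::] => // T A _ _ _ _ _ TA q _; apply: TA.
have fuse_lt l : (l < r.+1)%N -> (fuse i l < r)%N.
  by rewrite /fuse => ?; case: (leqP l i) => ?; lia.
(* The essential case: a factor x_c - x_i whose other variable x_c lies outside the fused pair. *)
have main (c : nat) : c != i -> c != i.+1 -> (c < r.+1)%N ->
    exists2 s', validL r s' & forall (T : ser -> Prop) A,
    (forall B C, T B -> T C -> T (B + C)) -> (forall B, T B -> T (- B)) ->
    (forall j k B, T B -> T (dl j k B)) -> T 0 -> fusable i A ->
    (forall q, T (J i q (mulL s (dl c i A)))) ->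
    forall q : int, q <= q0%:Z -> T (mulL s' (J i q A)).
  move=> ci ci1 cr; have [s' vs' s'P] := IHs vs q0.
  have fci : fuse i c != i.
    by rewrite /fuse; case: (leqP c i) => ?; lia.
  exists (nseq q0.+1 (fuse i c, i) ++ s').
    rewrite /validL all_cat; apply/andP; split=> //; apply/allP => x /nseqP[-> _] /=.
    by rewrite fuse_lt ?ir ?fci.
  move=> T A TD TN Td T0 lA TA.
  have TmulL t B : T B -> T (mulL t B).
    by move=> TB; elim: t => //= -[a b] t; apply: Td.
  have H := s'P T (dl c i A) TD TN Td T0 (fusable_dl _ _ lA) TA.
  (* Since x_c - x = (x_c - x - x0) + x0, each factor x_c - x leaves a term controlled by [H] and
     one in which the power of x0 has dropped; below x0^0 nothing remains. *)
  have claim (d : nat) : forall q : int, q <= q0%:Z -> q < d%:Z ->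
      T (mulL (nseq d (fuse i c, i)) (mulL s' (J i q A))).
    elim: d => [|d IHd] q qq0 qd; first by rewrite J_lt0 // !mulL0.
    have := H q qq0; rewrite J_dli // mulLB mulL_dl => Hq.
    rewrite -[nseq _ _]/([:: (fuse i c, i)] ++ nseq d (fuse i c, i)).
    rewrite mulL_cat mulLC /= -(subrK (mulL s' (J i (q - 1) A)) (dl _ _ _)) mulLD.
    by apply: TD; [apply: TmulL | apply: IHd; lia].
  by move=> q qq0; rewrite mulL_cat; apply: claim => //; lia.
have mulLdl A : dl j k (mulL s A) = mulL s (dl j k A) by rewrite mulL_dl.
have [ji|ji] := eqVneq j i.
  have [ki1|ki1] := eqVneq k i.+1.
    (* The factor x_i - x_(i+1) is turned into x0 itself, so the remaining list has to be handled up
       to one power more. *)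
    have [s' vs' s'P] := IHs vs q0.+1; exists s' => // T A TD TN Td T0 lA TA q qq0.
    have := s'P T (dl j k A) TD TN Td T0 (fusable_dl _ _ lA) _ (q + 1).
    rewrite ji ki1 J_d // addrK; apply; last by lia.
    by move=> q'; have := TA q'; rewrite mulLdl ji ki1.
  have ki : k != i by rewrite -ji eq_sym.
  have [s' vs' s'P] := main k ki ki1 kr.
  exists s' => // T A TD TN Td T0 lA TA; apply: s'P => // q.
  rewrite -[mulL _ _]opprK -mulLN -dl_opp JN; last exact/fusable_mulL/fusable_dl.
  by apply: TN; have := TA q; rewrite mulLdl ji.
have [ki|ki] := eqVneq k i.
  have [ji1|ji1] := eqVneq j i.+1; last first.
    have [s' vs' s'P] := main j ji ji1 jr.
    exists s' => // T A TD TN Td T0 lA TA; apply: s'P => // q.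
    by have := TA q; rewrite mulLdl ki.
  have [s' vs' s'P] := IHs vs q0.+1; exists s' => // T A TD TN Td T0 lA TA q qq0.
  have := s'P T (dl k j A) TD TN Td T0 (fusable_dl _ _ lA) _ (q + 1).
  rewrite ji1 ki J_d // addrK; apply; last by lia.
  move=> q'; rewrite -[mulL _ _]opprK -mulLN -dl_opp JN; last exact/fusable_mulL/fusable_dl.
  by apply: TN; have := TA q'; rewrite mulLdl ki ji1.
have [fjk|fjk] := eqVneq (fuse i j) (fuse i k).
  by exfalso; move: fjk jk ji ki; rewrite /fuse; case: (leqP j i) => ?; case: (leqP k i) => ?; lia.
have [s' vs' s'P] := IHs vs q0; exists ((fuse i j, fuse i k) :: s').
  by rewrite /= !fuse_lt ?fjk.
move=> T A TD TN Td T0 lA TA q qq0 /=; rewrite -mulL_dl -J_dl //.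
apply: s'P => //; first exact: fusable_dl.
by move=> q'; rewrite -mulLdl; apply: TA.
Qed.

End Series.

(** The kernels [pow_lin] and [delta3] are homogeneous, so sums over index tuples reduce to a line
    parametrized by [h]. *)
Lemma fs_inj (M : zmodType) (T : choiceType) (h : int -> T) (f : T -> M) :
  injective h -> (forall x, (forall i, h i != x) -> f x = 0) ->
  \sum_(x \in [set: T]) f x = isum (fun i => f (h i)).
Proof.
move=> h_inj f0.
rewrite /isum -(@fsbig_image _ _ _ _ _ [set: int] h f); last by move=> i j _ _ /h_inj.
apply/esym/fsbig_widen => // x [_ /= hx]; apply: f0 => i.
by apply/eqP => hi; apply: hx; exists i.
Qed.

(** * Products of fields *)

Section PowLin.
Variables (K : fieldType) (charK : [pchar K] =i pred0) (V : lmodType K).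
Implicit Types A : int -> int -> V.

(** The coefficients of (x1 + c x2)^n A, expanded in nonnegative powers of x2; n may be negative. *)
Definition plc (c : K) (n : int) A (a b : int) : V :=
  isum (fun j => (bz K n j * c ^+ absz j) *: A (a - n + j) (b - j)).

Lemma fmul2_pow_lin c n A : fmul2 (pow_lin c n) A = plc c n A.
Proof.
apply/funext => a; apply/funext => b; rewrite /fmul2.
rewrite (@fs_inj _ _ (fun j => (n - j, j))) => [|i j []//|[i j] hij]; last first.
  rewrite /pow_lin ifF ?scale0r //=; apply/negP => /andP[/eqP ijn _].
  by have := hij j; rewrite -ijn addrK eqxx.
apply: eq_isum => j; rewrite /pow_lin /= subrK eqxx /=.
case: ifP => j0; last by rewrite bz_lt0 ?mul0r ?scale0r //; lia.
by rewrite bzE //; congr (_ *: A _ _); lia.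
Qed.

Lemma plcS c n A a b :
  (forall a b, fin (fun j => (bz K n j * c ^+ absz j) *: A (a - n + j) (b - j))) ->
  plc c (n + 1) A a b = plc c n A (a - 1) b + c *: plc c n A a (b - 1).
Proof.
move=> finA; rewrite /plc -isumZ; last exact: finA.
rewrite [X in _ = _ + X](@isum_shift _ _ (- 1)) -isumD; last 2 first.
- exact: finA.
- have [N fN] := finA a (b - 1); exists N.+1 => i iN.
  by rewrite fN ?scaler0 //; lia.
apply: eq_isum => j; rewrite scalerA bzS //.
have -> : a - (n + 1) + j = a - 1 - n + j by lia.
have -> : a - n + (j - 1) = a - 1 - n + j by lia.
have -> : b - 1 - (j - 1) = b - j by lia.
rewrite -scalerDl; congr (_ *: _); rewrite mulrDl; congr (_ + _).
have [j0|j0] := leP j 0; first by rewrite bz_lt0 ?mul0r ?mulr0 //; lia.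
by rewrite mulrCA; congr (_ * _); rewrite -exprS; congr (_ ^+ _); lia.
Qed.

Lemma plc_nat_fin c (n : nat) A a b :
  fin (fun j => (bz K n j * c ^+ absz j) *: A (a - n%:Z + j) (b - j)).
Proof.
apply: (@fin_le _ _ 0 n) => j /orP[j0|jn]; first by rewrite bz_lt0 ?mul0r ?scale0r.
by rewrite bz_gt ?mul0r ?scale0r //; lia.
Qed.

Lemma plc0 c A a b : plc c 0 A a b = A a b.
Proof.
rewrite /plc (@isum1 _ _ 0) => [|j j0]; first by rewrite bz0 mul1r scale1r !subr0 ?addr0.
have [j0'|j0'] := ltP j 0; first by rewrite bz_lt0 // mul0r scale0r.
by rewrite (@bz_gt _ _ 0) ?mul0r ?scale0r //; lia.
Qed.

Definition s2 A (m n : int) : V := A (m - 1) n + A m (n - 1).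

Lemma plcN1_iter (k : nat) A : plc (-1) k A = iter k (@d2 K V) A.
Proof.
elim: k => [|k IHk]; first by apply/funext=> a; apply/funext => b; exact: plc0.
apply/funext=> a; apply/funext => b; have -> : k.+1%:Z = k%:Z + 1 by lia.
rewrite plcS; last by move=> *; apply: plc_nat_fin.
by rewrite IHk /= /d2 scaleN1r.
Qed.

Lemma plc1_iter (k : nat) A : plc 1 k A = iter k s2 A.
Proof.
elim: k => [|k IHk]; first by apply/funext=> a; apply/funext => b; exact: plc0.
apply/funext=> a; apply/funext => b; have -> : k.+1%:Z = k%:Z + 1 by lia.
rewrite plcS; last by move=> *; apply: plc_nat_fin.
by rewrite IHk /= /s2 scale1r.
Qed.

Lemma subst_x0E A : subst_x0 A = fun p q => J2 p A q.
Proof.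
apply/funext => p; apply/funext => q; rewrite /subst_x0.
rewrite (@fs_inj _ _ (fun m => (m, m - p))) => [|i j []//|[i j] hij]; last first.
  rewrite /pow_lin ifF ?scale0r //=; apply/negP => /andP[/eqP ijn _].
  by have := hij i; rewrite -ijn addrK eqxx.
apply: eq_isum => m; rewrite /pow_lin /= subrK eqxx expr1n mulr1.
case: ifP => p0; last by rewrite bz_lt0 ?scale0r //; lia.
by rewrite bzE //; congr (_ *: A _ _); lia.
Qed.

Lemma subst_02E A p q :
  subst_02 A p q = isum (fun m => bz K m (m - p) *: A m (q - m + p)).
Proof.
rewrite /subst_02.
rewrite (@fs_inj _ _ (fun m => (m, m - p))) => [|i j []//|[i j] hij]; last first.
  rewrite /pow_lin ifF ?scale0r //=; apply/negP => /andP[/eqP ijn _].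
  by have := hij i; rewrite -ijn (_ : p + j - p = j) ?eqxx //; lia.
apply: eq_isum => m; rewrite /pow_lin /= addrC subrK eqxx expr1n mulr1.
case: ifP => p0; last by rewrite bz_lt0 ?scale0r //; lia.
by rewrite bzE //; congr (_ *: A _ _); lia.
Qed.

End PowLin.

Section Fields.
Variables (F : fieldType) (charF : [pchar F] =i pred0).
Variable V : lmodType (laurent F).
Local Notation L := (laurent F).
Implicit Types (a b c : V -> int -> V) (s : seq (V -> int -> V)).

Lemma charL : [pchar L] =i pred0.
Proof.
apply/pcharf0P => n.
have natE : n%:R = laurent_const n%:R :> L.
  elim: n => [|n IHn]; first by apply: laurentP => m /=; rewrite if_same.
  by rewrite -!natr1 IHn laurent_constD.
rewrite natE -((pcharf0P F).1 charF); apply/eqP/eqP => [/(congr1 (fun f : L => f 0)) //|->].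
by apply: laurentP => m /=; rewrite if_same.
Qed.

Section Op.
Variable a : V -> int -> V.
Hypothesis Ea : Espace a.

Lemma E0 n : a 0 n = 0.
Proof.
case: Ea => la _; have := la (-1) 0 0; rewrite scaler0 addr0 => ->.
by rewrite !fctE scaleN1r addNr.
Qed.
Lemma ED u v n : a (u + v) n = a u n + a v n.
Proof. by case: Ea => la _; have := la 1 u v; rewrite !scale1r => ->. Qed.
Lemma EZ x v n : a (x *: v) n = x *: a v n.
Proof.
case: Ea => la _; have := la x v 0; rewrite addr0 => ->.
by rewrite !fctE E0 addr0.
Qed.
Lemma EN v n : a (- v) n = - a v n.
Proof. by rewrite -scaleN1r EZ scaleN1r. Qed.
Lemma EB u v n : a (u - v) n = a u n - a v n.
Proof. by rewrite ED EN. Qed.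
Lemma Etrunc v : lower_truncated (a v).
Proof. by case: Ea. Qed.
Lemma Eisum f n : fin f -> a (isum f) n = isum (fun i => a (f i) n).
Proof. by move=> ff; rewrite (@isum_raddf _ _ (fun v => a v n)) ?E0 // => u v; rewrite ED. Qed.
Lemma EJ2 p G q n : lower_truncated2 G ->
  a (J2 p G q) n = J2 p (fun i j => a (G i j) n) q.
Proof.
move=> tG; rewrite (@J2_raddf _ V V (fun v => a v n)) // => [u v|m v].
  exact: ED.
exact: EZ.
Qed.
End Op.

Lemma Espace_intro a :
  (forall u v n, a (u + v) n = a u n + a v n) ->
  (forall x v n, a (x *: v) n = x *: a v n) ->
  (forall v, lower_truncated (a v)) -> Espace a.
Proof.
move=> aD aZ at_; split=> // x u v; apply/funext => n.
by rewrite aD aZ.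
Qed.

Lemma prod12_d2D k a b u v m n : Espace a -> Espace b ->
  iter k (@d2 L V) (prod12 a b (u + v)) m n =
  iter k (@d2 L V) (prod12 a b u) m n + iter k (@d2 L V) (prod12 a b v) m n.
Proof.
move=> Ea Eb; elim: k m n => [|k IHk] m n /=.
  by rewrite /prod12 (ED Eb) (ED Ea).
by rewrite /d2 !IHk opprD addrACA.
Qed.

Lemma prod12_d2Z k a b x u m n : Espace a -> Espace b ->
  iter k (@d2 L V) (prod12 a b (x *: u)) m n =
  x *: iter k (@d2 L V) (prod12 a b u) m n.
Proof.
move=> Ea Eb; elim: k m n => [|k IHk] m n /=.
  by rewrite /prod12 (EZ Eb) (EZ Ea).
by rewrite /d2 !IHk scalerBr.
Qed.

(** The linearity part of [pair_compatible] is automatic for elements of E(V), which leaves this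
    truncation. *)
Definition pairc k a b :=
  forall w, lower_truncated2 (iter k (@d2 L V) (prod12 a b w)).

Lemma prod_timesE k a b w :
  prod_times k a b w = iter k (@d2 L V) (prod12 a b w).
Proof. by rewrite /prod_times fmul2_pow_lin plcN1_iter //; exact: charL. Qed.

Lemma pair_compatibleE k a b : Espace a -> Espace b ->
  pair_compatible k a b <-> pairc k a b.
Proof.
move=> Ea Eb; split=> [[_ H] w|H].
  by have := H w; rewrite prod_timesE.
split=> [x u v|w]; last by rewrite prod_timesE; apply: H.
rewrite !prod_timesE; apply/funext => m; apply/funext => n.
by rewrite prod12_d2D // prod12_d2Z.
Qed.

Lemma trunc2_d2 k (G : int -> int -> V) :
  lower_truncated2 G -> lower_truncated2 (iter k (@d2 L V) G).
Proof.
move=> tG; elim: k => // k [N GN]; exists N => m n mn /=.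
by rewrite /d2 !GN ?subrr //; lia.
Qed.

Lemma pairc_le k k' a b : (k <= k')%N -> pairc k a b -> pairc k' a b.
Proof.
move=> kk' ab w; rewrite -(subnK kk') iterD.
exact: trunc2_d2.
Qed.

Lemma J2_pairc k k' a b w p q : pairc k a b -> pairc k' a b ->
  J2 (p + k%:Z) (iter k (@d2 L V) (prod12 a b w)) q =
  J2 (p + k'%:Z) (iter k' (@d2 L V) (prod12 a b w)) q.
Proof.
wlog kk' : k k' / (k <= k')%N => [H abk abk'|abk _].
  by have [/H->|/ltnW/H->] := leqP k k'.
rewrite -{2}(subnK kk') iterD [RHS](J2_iter_d2 charL) //.
by rewrite (_ : p + k'%:Z - _ = p + k%:Z) //; lia.
Qed.

(** Any admissible k may replace the one selected in [YE], because extra factors x1 - x2 become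
    powers of x0; this allows one k to serve several pairs. *)
Lemma nprodE k n a b w q : Espace a -> Espace b -> pairc k a b ->
  nprod n a b w q = J2 (k%:Z - n - 1) (iter k (@d2 L V) (prod12 a b w)) q.
Proof.
move=> Ea Eb abk; rewrite /nprod /YE subst_x0E prod_timesE.
set k' := xget _ _.
have abk' : pairc k' a b.
  apply/pair_compatibleE => //.
  apply: (@xgetPex _ 0%N [set k | pair_compatible k a b]); exists k.
  exact/pair_compatibleE.
rewrite (J2_pairc _ _ _ abk' abk).
by rewrite (_ : - n - 1 + k%:Z = k%:Z - n - 1) //; lia.
Qed.

Lemma nprod_E k n a b : Espace a -> Espace b -> pairc k a b ->
  Espace (nprod n a b).
Proof.
move=> Ea Eb abk; apply: Espace_intro => [u v q|x v q|v].
- rewrite !(nprodE _ _ _ Ea Eb abk) -J2D //.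
  by apply: eq_J2 => i j; rewrite prod12_d2D.
- rewrite !(nprodE _ _ _ Ea Eb abk) /J2 -isumZ; last exact: J2_fin.
  by apply: eq_isum => i; rewrite prod12_d2Z // !scalerA mulrC.
have [N GN] := abk v; exists (N + N - (k%:Z - n - 1)) => q qN.
rewrite (nprodE _ _ _ Ea Eb abk); apply: isum0 => m.
by rewrite GN ?scaler0 //; lia.
Qed.

Fixpoint prodL s (w : V) (e : nat -> int) : V :=
  if s is a :: s' then a (prodL s' w (fun j => e j.+1)) (e 0%N) else w.

Fixpoint allE s : Prop := if s is a :: s' then Espace a /\ allE s' else True.

Lemma allE_cat s1 s2 : allE (s1 ++ s2) <-> allE s1 /\ allE s2.
Proof. by elim: s1 => /= [|a s1 IH]; rewrite ?IH; tauto. Qed.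

Lemma prodL_cat s1 s2 w e :
  prodL (s1 ++ s2) w e = prodL s1 (prodL s2 w (fun j => e (size s1 + j)%N)) e.
Proof. by elim: s1 e => //= a s1 IH e; rewrite IH. Qed.

Lemma prodL_ext s w e e' : (forall j, (j < size s)%N -> e j = e' j) ->
  prodL s w e = prodL s w e'.
Proof.
elim: s e e' => //= a s IH e e' ee'; rewrite ee' //.
by rewrite (IH _ (fun j => e' j.+1)) // => j js; apply: ee'.
Qed.

Lemma prodLD s u v e : allE s ->
  prodL s (u + v) e = prodL s u e + prodL s v e.
Proof. by elim: s e => //= a s IH e [Ea Es]; rewrite IH // (ED Ea). Qed.

Lemma prodLZ s x v e : allE s -> prodL s (x *: v) e = x *: prodL s v e.
Proof. by elim: s e => //= a s IH e [Ea Es]; rewrite IH // (EZ Ea). Qed.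

Lemma prodL0 s e : allE s -> prodL s 0 e = 0.
Proof. by move=> Es; have := prodLZ 0 0 e Es; rewrite !scale0r. Qed.

Lemma prodLN s v e : allE s -> prodL s (- v) e = - prodL s v e.
Proof. by move=> Es; rewrite -scaleN1r prodLZ // scaleN1r. Qed.

Lemma prodL_ins s1 s2 a b w k m n e : allE s1 ->
  mulL (nseq k (size s1, (size s1).+1)) (prodL (s1 ++ a :: b :: s2) w)
    (ins (size s1) m n e) =
  prodL s1 (iter k (@d2 L V)
    (prod12 a b (prodL s2 w (fun j => e ((size s1).+1 + j)%N))) m n) e.
Proof.
move=> Es1; elim: k m n => [|k IHk] m n /=; last first.
  rewrite /dl dec_ins1 dec_ins2 !IHk /d2 prodLD // prodLN //.
rewrite prodL_cat /= addn0 ins_fst addn1 ins_snd /prod12.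
rewrite (_ : (fun j : nat => _) = fun j => e ((size s1).+1 + j)%N); last first.
  by apply/funext => j; rewrite !addnS addSn ins_gt //; lia.
by apply: prodL_ext => j js; rewrite ins_lt.
Qed.

Lemma fusable_prodL s1 s2 a b w k : allE s1 -> pairc k a b ->
  fusable (size s1) (mulL (nseq k (size s1, (size s1).+1))
                   (prodL (s1 ++ a :: b :: s2) w)).
Proof.
move=> Es1 abk e.
have [N GN] := abk (prodL s2 w (fun j => e ((size s1).+1 + j)%N)).
by exists N => m n mn; rewrite prodL_ins // GN // prodL0.
Qed.

(** An n-th product inside a longer product is a fusion of two neighbouring variables: the fields to
    its left are linear and pass through the finite sum for the coefficient of x0^(k - n - 1). *)
Lemma prodL_nprod s1 s2 a b w k n : allE s1 -> Espace a -> Espace b ->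
  pairc k a b ->
  prodL (s1 ++ nprod n a b :: s2) w =
  J (size s1) (k%:Z - n - 1) (mulL (nseq k (size s1, (size s1).+1))
                   (prodL (s1 ++ a :: b :: s2) w)).
Proof.
move=> Es1 Ea Eb abk; apply/funext => e; rewrite /J.
rewrite (eq_J2 _ _ (fun m n => @prodL_ins s1 s2 a b w k m n e Es1)).
rewrite -(@J2_raddf _ V V (fun v => prodL s1 v e)) //; last 2 first.
- by move=> u v; rewrite prodLD.
- by move=> m v; rewrite prodLZ.
rewrite prodL_cat /= addn0 (nprodE _ _ _ Ea Eb abk); congr (prodL s1 (J2 _ _ _) e).
by congr (iter _ _ (prod12 _ _ (prodL _ _ _))); apply/funext => j; rewrite addnS addSn.
Qed.

End Fields.

Definition sub (i : nat) (m : int) (e : nat -> int) : nat -> int :=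
  fun j => if j == i then e j - m else e j.

Lemma sub_same i m e : sub i m e i = e i - m.
Proof. by rewrite /sub eqxx. Qed.

Lemma sub_ne i m e j : j != i -> sub i m e j = e j.
Proof. by rewrite /sub => /negbTE->. Qed.

Lemma sub_dec i m j e : sub i m (dec j e) = dec j (sub i m e).
Proof. by apply/funext => k; rewrite /sub /dec; case: ifP => ?; lia. Qed.

Lemma sub_sub i m j n e : sub i m (sub j n e) = sub j n (sub i m e).
Proof. by apply/funext => k; rewrite /sub; do ?case: ifP => ?; lia. Qed.

(** * Compatibility of n-th products *)

Section Closure.
Variables (F : fieldType) (charF : [pchar F] =i pred0).
Variable V : lmodType (laurent F).
Local Notation L := (laurent F).
Implicit Types (a b c : V -> int -> V) (s l : seq (V -> int -> V)).
Implicit Types (A B : (nat -> int) -> V) (f : laurent L).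

(* [a_1(x_1) ... a_r(x_r) w] becomes truncated when multiplied by some product of
   factors [x_i - x_j] that does not depend on [w]. *)
Definition compat s := exists2 t, validL (size s) t &
  forall w, trunc (size s) (mulL t (prodL s w)).

Lemma mulL2 t A : validL 2 t -> exists c : L, [/\ c != 0, c ^+ 2 = 1 &
  mulL t A = fun e => c *: mulL (nseq (size t) (0, 1)%N) A e].
Proof.
elim: t => [_|[j k] t IHt /= /andP[/and3P[/= j2 k2 jk] /IHt[c [c0 c2 tE]]]].
  exists 1; split; rewrite ?oner_neq0 ?expr1n //.
  by apply/funext => e; rewrite scale1r.
have dlZ j' k' : dl j' k' (mulL t A) =
    fun e => c *: dl j' k' (mulL (nseq (size t) (0, 1)%N) A) e.
  by apply/funext => e; rewrite tE /dl scalerBr.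
have [j0|j0] := eqVneq j 0%N.
  have k1 : k = 1%N by lia.
  by exists c; rewrite j0 k1 dlZ.
have j1 : j = 1%N by lia.
have k0 : k = 0%N by lia.
exists (- c); split; rewrite ?oppr_eq0 ?sqrrN // j1 k0 dlZ.
by apply/funext => e; rewrite scaleNr dl_opp !fctE scalerN.
Qed.

Lemma compat_pairc a b : compat [:: a; b] -> exists k, pairc k a b.
Proof.
move=> [t vt tC]; exists (size t) => w.
have [c [c0 _ tE]] := mulL2 (prodL [:: a; b] w) vt.
have := @trunc_fusable _ _ _ 0 _ (isT : (0 < 1)%N) (tC w).
move=> /(_ (fun=> 0)) [N tN]; exists N => m n mn.
have := tN m n mn; rewrite tE => /eqP.
rewrite scaler_eq0 (negbTE c0) /=.
move=> /eqP <-; apply/esym.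
exact: (@prodL_ins F V [::] [::] a b w (size t) m n (fun=> 0) I).
Qed.

Lemma compat_nprod s1 s2 a b n : allE s1 -> Espace a -> Espace b ->
  compat [:: a; b] -> compat (s1 ++ a :: b :: s2) -> compat (s1 ++ nprod n a b :: s2).
Proof.
move=> Es1 Ea Eb /compat_pairc[k abk] [t vt tC]; set i := size s1.
have ir : (i < size (s1 ++ nprod n a b :: s2))%N.
  by rewrite size_cat /= addnS ltnS leq_addr.
have sE : size (s1 ++ a :: b :: s2) = (size (s1 ++ nprod n a b :: s2)).+1.
  by rewrite !size_cat /= !addnS.
rewrite sE in vt tC.
(* Only the coefficient of x0^(k - n - 1) is used, so that exponent is the bound required of
   [collapse]. *)
have [t' vt' t'P] := collapse (charL charF) V ir vt (absz (k%:Z - n - 1)%R).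
exists t' => // w; rewrite (prodL_nprod charF _ _ _ Es1 Ea Eb abk).
apply: (t'P (@trunc _ V (size (s1 ++ nprod n a b :: s2)))); last by lia.
- by move=> B B'; apply: trunc_add.
- by move=> B; apply: trunc_opp.
- by move=> j j' B; apply: trunc_dl.
- by exists 0.
- exact: fusable_prodL.
move=> q; apply: trunc_J => //; rewrite mulLC.
exact: trunc_mulL.
Qed.

Lemma compat_add s1 s2 a b : allE s1 -> compat (s1 ++ a :: s2) -> compat (s1 ++ b :: s2) ->
  compat (s1 ++ (a + b) :: s2).
Proof.
move=> Es1 [t vt tC] [t' vt' t'C]; exists (t ++ t').
  rewrite /validL all_cat; apply/andP; split.
    by move: vt; rewrite !size_cat.
  by move: vt'; rewrite !size_cat.
move=> w; have -> : prodL (s1 ++ (a + b) :: s2) w =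
    prodL (s1 ++ a :: s2) w + prodL (s1 ++ b :: s2) w.
  by apply/funext => e; rewrite !fctE !prodL_cat /= -prodLD.
rewrite !mulL_cat !mulLD; apply: trunc_add.
  by rewrite mulLC; apply: trunc_mulL; move: (tC w); rewrite !size_cat.
by apply: trunc_mulL; move: (t'C w); rewrite !size_cat.
Qed.

(* For fixed exponents of the other variables, the exponents of [x_i] are
   bounded below. *)
Definition finl i A := forall e, exists N : int, forall m, N < m ->
  A (sub i m e) = 0.

(* Multiplication by [f(x_i)], for [f] in [F((t))((x_i))] *)
Definition SC (f : laurent L) i A : (nat -> int) -> V :=
  fun e => isum (fun m => f m *: A (sub i m e)).

Lemma SC_fin f i A e : finl i A -> fin (fun m => f m *: A (sub i m e)).
Proof.
move=> /(_ e) [N AN]; have [P fP] := lcoef_truncated f.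
apply: (@fin_le _ _ P N) => m /orP[/fP->|/AN->]; rewrite ?scale0r //.
by rewrite scaler0.
Qed.

Lemma finl_dl i j k A : finl i A -> finl i (dl j k A).
Proof.
move=> lA e; have [N AN] := lA (dec j e); have [P AP] := lA (dec k e).
exists (Num.max N P) => m mNP; rewrite /dl -!sub_dec AN ?AP ?subrr //; lia.
Qed.

Lemma finl_mulL i t A : finl i A -> finl i (mulL t A).
Proof. by move=> lA; elim: t => //= -[j k] t; apply: finl_dl. Qed.

Lemma SC_dl f i j k A : finl i A -> dl j k (SC f i A) = SC f i (dl j k A).
Proof.
move=> lA; apply/funext => e; rewrite /dl /SC -isumB; try exact: SC_fin.
by apply: eq_isum => m; rewrite !sub_dec scalerBr.
Qed.

Lemma SC_mulL f i t A : finl i A -> mulL t (SC f i A) = SC f i (mulL t A).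
Proof.
move=> lA; elim: t => //= -[j k] t ->; rewrite SC_dl //; exact: finl_mulL.
Qed.

Lemma trunc_SC f i r A : trunc r A -> trunc r (SC f i A).
Proof.
move=> [N AN]; have [P fP] := lcoef_truncated f.
exists (Num.min N (N + P)) => e j jr eN; apply: isum0 => m.
have [/fP->|Pm] := ltP m P; first by rewrite scale0r.
by rewrite (AN _ j) ?scaler0 // /sub; case: ifP => _; lia.
Qed.

Lemma Escale_E f a : Espace a -> Espace (Escale f a).
Proof.
move=> Ea; have ff v n : fin (fun i => f i *: a v (n - i)).
  have [N fN] := lcoef_truncated f; have [P aP] := Etrunc Ea v.
  apply: (@fin_le _ _ N (n - P)) => i /orP[/fN->|?]; first by rewrite scale0r.
  by rewrite aP ?scaler0 //; lia.
apply: Espace_intro => [u v n|x v n|v].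
- rewrite /Escale /fmul1 -[RHS]isumD; [|exact: ff|exact: ff].
  by apply: eq_isum => i; rewrite (ED Ea) scalerDr.
- rewrite /Escale /fmul1 -[RHS]isumZ; last exact: ff.
  by apply: eq_isum => i; rewrite (EZ Ea) !scalerA mulrC.
have [N fN] := lcoef_truncated f; have [P aP] := Etrunc Ea v.
exists (N + P) => n nNP; apply: isum0 => i.
have [/fN->|Ni] := ltP i N; first by rewrite scale0r.
by rewrite aP ?scaler0 //; lia.
Qed.

Lemma finl_prodL s1 s2 a w : allE s1 -> Espace a ->
  finl (size s1) (prodL (s1 ++ a :: s2) w).
Proof.
move=> Es1 Ea e.
have [N aN] := Etrunc Ea (prodL s2 w (fun j => e ((size s1).+1 + j)%N)).
exists (e (size s1) - N) => m mN; rewrite prodL_cat /= addn0.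
rewrite sub_same.
rewrite (_ : (fun j : nat => _) = fun j => e ((size s1).+1 + j)%N); last first.
  by apply/funext => j; rewrite addnS sub_ne ?addSn //; lia.
by rewrite aN ?prodL0 //; lia.
Qed.

Lemma prodL_scale s1 s2 f a w : allE s1 -> Espace a ->
  prodL (s1 ++ Escale f a :: s2) w = SC f (size s1) (prodL (s1 ++ a :: s2) w).
Proof.
move=> Es1 Ea; apply/funext => e; rewrite /SC prodL_cat /= addn0.
set v := prodL s2 w _.
rewrite /Escale /fmul1 -/(isum _) (@isum_raddf _ _ (fun v => prodL s1 v e)).
- apply: eq_isum => m; rewrite prodLZ // prodL_cat /= addn0 sub_same.
  congr (_ *: _); rewrite (@prodL_ext _ _ _ _ e (sub (size s1) m e)) => [|j js].
    by congr (prodL _ (a (prodL _ _ _) _) _); apply/funext => j; rewrite sub_ne //; lia.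
  by rewrite sub_ne //; lia.
- exact: prodL0.
- by move=> u u'; rewrite prodLD.
have [N fN] := lcoef_truncated f; have [P aP] := Etrunc Ea v.
apply: (@fin_le _ _ N (e (size s1) - P)) => i /orP[/fN->|?]; first by rewrite scale0r.
by rewrite aP ?scaler0 //; lia.
Qed.

Lemma compat_scale s1 s2 f a : allE s1 -> Espace a -> compat (s1 ++ a :: s2) ->
  compat (s1 ++ Escale f a :: s2).
Proof.
move=> Es1 Ea [t vt tC]; exists t; first by move: vt; rewrite !size_cat.
move=> w; rewrite prodL_scale // SC_mulL; last exact: finl_prodL.
by apply: trunc_SC; move: (tC w); rewrite !size_cat.
Qed.

Definition skip i (e : nat -> int) : nat -> int := fun j => e (bump i j).
(* Inserts a new variable [x_i], on which the series does not depend. *)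
Definition ext1 i A : (nat -> int) -> V :=
  fun e => if e i == 0 then A (skip i e) else 0.

Lemma ext1_dl i j k A : dl (bump i j) (bump i k) (ext1 i A) = ext1 i (dl j k A).
Proof.
have decE h e : dec (bump i h) e i = e i.
  by rewrite /dec (negbTE (neq_bump _ _)) subr0.
have skipE h e : skip i (dec (bump i h) e) = dec h (skip i e).
  by apply/funext => m; rewrite /skip /dec (inj_eq (can_inj (bumpK i))).
apply/funext => e; rewrite /dl /ext1 !decE !skipE.
by case: ifP => // _; rewrite subrr.
Qed.

Lemma compat_one s1 s2 : allE s1 -> compat (s1 ++ s2) -> compat (s1 ++ @one_field F V :: s2).
Proof.
move=> Es1 [t vt tC]; set i := size s1.
have sE : size (s1 ++ @one_field F V :: s2) = (size (s1 ++ s2)).+1.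
  by rewrite !size_cat /= addnS.
have is' : (i <= size (s1 ++ s2))%N by rewrite size_cat leq_addr.
exists [seq (bump i jk.1, bump i jk.2) | jk <- t].
  apply/allP => _ /mapP[[j k] jkt ->] /=.
  have /= /and3P[/= js ks jk] := allP vt _ jkt.
  by rewrite sE (inj_eq (can_inj (bumpK i))) jk !andbT /bump; lia.
move=> w; have -> : prodL (s1 ++ @one_field F V :: s2) w =
    ext1 i (prodL (s1 ++ s2) w).
  apply/funext => e; rewrite /ext1 !prodL_cat /= addn0 /one_field /cst_series.
  case: ifP => _; last by rewrite prodL0.
  rewrite (@prodL_ext _ _ _ _ e (skip i e)) => [|j js].
    congr (prodL s1 (prodL s2 w _) _); apply/funext => j.
    by rewrite /skip /bump leq_addr add1n addnS.
  by rewrite /skip /bump leqNgt js.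
have -> : mulL [seq (bump i jk.1, bump i jk.2) | jk <- t] (ext1 i (prodL (s1 ++ s2) w))
    = ext1 i (mulL t (prodL (s1 ++ s2) w)).
  by elim: {vt tC} t => //= -[j k] t ->; rewrite ext1_dl.
have [N tN] := tC w; exists (Num.min N 0) => e j js eN.
rewrite /ext1; case: eqP => // ei0.
have ji : j != i by apply/eqP => ji; move: eN; rewrite ji ei0; lia.
apply: (tN _ (unbump i j)).
  by rewrite sE in js; rewrite /unbump; lia.
by rewrite /skip unbumpK ?inE 1?eq_sym //; lia.
Qed.

Section Leaves.
Variable S : set (V -> int -> V).

Fixpoint allS l : Prop := if l is a :: l' then S a /\ allS l' else True.

Hypotheses (S_E : S `<=` @Espace F V) (S_C : forall l, allS l -> compat l).

Lemma allS_cat l1 l2 : allS l1 -> allS l2 -> allS (l1 ++ l2).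
Proof. by elim: l1 => //= a l1 IH [Sa /IH H] /H. Qed.

Lemma allS_E l : allS l -> allE l.
Proof. by elim: l => //= a l IH [/S_E Ea /IH]. Qed.

(* [a] can stand wherever all lists of elements of [S] can. *)
Definition good a := Espace a /\ forall s1 s2, allE s1 -> allE s2 ->
  (forall l, allS l -> compat (s1 ++ l ++ s2)) -> compat (s1 ++ a :: s2).

Lemma Espace_one : Espace (@one_field F V).
Proof.
apply: Espace_intro => [u v n|x v n|v]; rewrite /one_field /cst_series.
- by case: ifP; rewrite ?addr0.
- by case: ifP; rewrite ?scaler0.
by exists 0 => n n0; rewrite lt_eqF.
Qed.

Lemma good_one : good (@one_field F V).
Proof.
split; first exact: Espace_one.
by move=> s1 s2 Es1 Es2 /(_ [::] I); apply: compat_one.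
Qed.

Lemma good_compat1 a b : S a -> good b -> compat [:: a; b].
Proof.
move=> Sa [Eb bC]; apply: (bC [:: a] [::]) => //=; first by split=> //; apply: S_E.
by move=> l Sl; rewrite cats0; apply: S_C.
Qed.

(** Quantifying over lists in [good] is what closes the induction: when b is replaced by a list l of
    elements of S, the product a_n b is replaced by a :: l, again such a list. *)
Lemma good_nprod n a b : S a -> good b -> good (nprod n a b).
Proof.
move=> Sa gb; have Cab := good_compat1 Sa gb; have [Eb bC] := gb.
have Ea := S_E Sa; split.
  by have [k abk] := compat_pairc Cab; apply: nprod_E abk.
move=> s1 s2 Es1 Es2 H; apply: compat_nprod => //.
rewrite -cat_rcons; apply: bC => //.
  by rewrite -cats1; apply/allE_cat.
by move=> l Sl; rewrite cat_rcons; apply: (H (a :: l)).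
Qed.

Lemma good_add a b : good a -> good b -> good (a + b).
Proof.
move=> [Ea aC] [Eb bC]; split.
  apply: Espace_intro => [u v n|x v n|v].
  - by rewrite !fctE (ED Ea) (ED Eb) addrACA.
  - by rewrite !fctE (EZ Ea) (EZ Eb) scalerDr.
  have [N aN] := Etrunc Ea v; have [P bP] := Etrunc Eb v.
  by exists (Num.min N P) => n nNP; change (a v n + b v n = 0); rewrite aN ?bP ?addr0 //; lia.
by move=> s1 s2 Es1 Es2 H; apply: compat_add => //; [apply: aC | apply: bC].
Qed.

Lemma good_scale f a : good a -> good (Escale f a).
Proof.
move=> [Ea aC]; split; first exact: Escale_E.
by move=> s1 s2 Es1 Es2 H; apply: compat_scale => //; apply: aC.
Qed.

Fixpoint all_good s : Prop := if s is a :: s' then good a /\ all_good s' else True.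

Lemma all_goodE s : all_good s -> allE s.
Proof. by elim: s => //= a s IH [[Ea _] /IH]. Qed.

(** The entries of [s] are traded one by one for lists of elements of S, which join the prefix
    [l]. *)
Lemma good_all s l : all_good s -> allS l -> compat (l ++ s).
Proof.
elim: s l => [|a s IH] l; first by move=> _ Sl; rewrite cats0; apply: S_C.
move=> [[Ea aC] gs] Sl; apply: aC => [||l' Sl'].
- exact: allS_E.
- exact: all_goodE.
by rewrite catA; apply: IH => //; apply: allS_cat.
Qed.

Lemma good_compat s : all_good s -> compat s.
Proof. by move=> gs; apply: (@good_all s [::]). Qed.

End Leaves.
End Closure.

(** * The iterate formula for n-th products *)

Section Composition.
Variables (K : fieldType) (charK : [pchar K] =i pred0) (V : lmodType K).
Implicit Types A : (nat -> int) -> V.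

(** Trinomial revision takes the factor C(a, p) out of the sum, and what remains is a Vandermonde
    convolution. This is the coefficient identity behind [J_comp]. *)
Lemma bz_triple (a b p q : int) :
  isum (fun i => bz K i p * bz K a i * bz K b (q - i + p)) =
  bz K (a + b - p) q * bz K a p.
Proof.
have -> : a + b - p = (a - p) + b by lia.
rewrite (bz_Vandermonde charK) (@isum_shift _ _ p).
rewrite mulrC (@isum_raddf _ _ ( *%R (bz K a p))) ?mulr0 //; last 2 first.
- exact: mulrDr.
- exact: bz_fin.
apply: eq_isum => i; have := bz_trinomial charK a (i + p) p.
rewrite addrK mulrA => <-; rewrite [bz K (i + p) p * _]mulrC.
by congr (_ * bz K b _); lia.
Qed.

(* Both sides are a coefficient of [A(x + y2 + x0, x + y2, x)]. *)
Lemma J_comp p q A e : trunc 3 A ->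
  J 0 q (J 0 p A) e = J2 p (fun i j => J 0 i (J 1 j A) e) q.
Proof.
move=> [N AN]; pose r := e 0%N.
(* Both sides preserve total degree, so the exponents a and b of the first two variables determine
   that of the third. *)
pose Phi a b := A (ins 1 b (r - a - b + q + p) (ins 0 a 0 e)).
have PhiN a b : (a < N) || (b < N) || (r + q + p - N < a + b) -> Phi a b = 0.
  move=> H; have [aN|aN] := ltP a N; first by rewrite /Phi (AN _ 0%N).
  have [bN|bN] := ltP b N; first by rewrite /Phi (AN _ 1%N).
  by rewrite /Phi (AN _ 2%N) // ins_snd; lia.
pose B := (absz N + absz (r + q + p - N)%R + absz N)%N.
have PhiB a b : (B < absz a)%N || (B < absz b)%N -> Phi a b = 0.
  by move=> H; apply: PhiN; lia.
transitivity (isum (fun a => isum (fun b =>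
    (bz K (a + b - p) q * bz K a p) *: Phi a b))).
  transitivity (isum (fun b => isum (fun a =>
      (bz K b q * bz K a p) *: Phi a (b - a + p)))).
    rewrite {1}/J {1}/J2; apply: eq_isum => b.
    rewrite /J {1}/J2 -isumZ.
      apply: eq_isum => a; rewrite scalerA; congr (_ *: A _).
      apply/funext => -[|[|[|j]]] //=; rewrite /ins /=.
      by rewrite /r; lia.
    have tA : trunc 3 A by exists N.
    exact: J2_fin (@trunc_fusable _ _ 2 0 A isT tA _).
  rewrite isum_exchange.
    apply: eq_isum => a; rewrite (@isum_shift _ _ (a - p)).
    apply: eq_isum => b; congr (bz K _ _ * _ *: Phi _ _); lia.
  exists (B + B + absz p)%N => b a H.
  by rewrite PhiB ?scaler0 //; lia.
(* The right-hand side becomes a triple sum in which only the binomials depend on i; that sum is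
   evaluated by [bz_triple]. *)
pose G i a b := (bz K i p * bz K a i * bz K b (q - i + p)) *: Phi a b.
have G0 i a b : (i < 0) || (q + p < i) -> G i a b = 0.
  move=> /orP[i0|qi]; rewrite /G; first by rewrite (@bz_lt0 _ a) // mulr0 mul0r scale0r.
  by rewrite (@bz_lt0 _ b) ?mulr0 ?scale0r //; lia.
have GB i a b : (B < absz a)%N || (B < absz b)%N -> G i a b = 0.
  by move=> H; rewrite /G PhiB ?scaler0.
transitivity (isum (fun i => isum (fun a => isum (fun b => G i a b)))); last first.
  rewrite {1}/J2; apply: eq_isum => i; rewrite /J {1}/J2 -isumZ; last first.
    have tA : trunc 2 (J 1 (q - i + p) A) by apply: trunc_J => //; exists N.
    exact: J2_fin (@trunc_fusable _ _ 1 0 _ isT tA _).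
  apply: eq_isum => a; rewrite /J2 scalerA -isumZ; last first.
    have tA : trunc 3 A by exists N.
    exact: J2_fin (@trunc_fusable _ _ 2 1 A isT tA _).
  apply: eq_isum => b; rewrite scalerA; congr (_ *: A _).
  apply/funext => -[|[|[|j]]] //=; rewrite /ins /=.
  by rewrite /r; lia.
rewrite [RHS]isum_exchange; last first.
  exists (B + absz (q + p)%R)%N => i a H.
  apply: isum0 => b; have [Ha|Ha] := ltnP B (absz a); first by rewrite GB ?Ha.
  by apply: G0; lia.
apply: eq_isum => a; rewrite [RHS]isum_exchange; last first.
  exists (B + absz (q + p)%R)%N => i b H.
  have [Ha|Ha] := ltnP B (absz b); first by rewrite GB ?Ha ?orbT.
  by apply: G0; lia.
apply: eq_isum => b; rewrite -bz_triple -isum_scalel //.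
apply: (@fin_le _ _ 0 (q + p)) => i /orP[?|?].
  by rewrite (@bz_lt0 _ a) // mulr0 mul0r.
by rewrite (@bz_lt0 _ b) ?mulr0 //; lia.
Qed.

End Composition.

Section Powers.
Variables (K : fieldType) (charK : [pchar K] =i pred0) (V : lmodType K).
Implicit Types A : (nat -> int) -> V.

Definition dp k i j A := mulL (nseq k (i, j)) A.

Lemma dpS k i j A : dp k.+1 i j A = dl i j (dp k i j A).
Proof. by []. Qed.

Lemma dpC k i j k' i' j' A : dp k i j (dp k' i' j' A) = dp k' i' j' (dp k i j A).
Proof. exact: mulLC. Qed.

Lemma dp_add k l i j A : dp (k + l) i j A = dp k i j (dp l i j A).
Proof. by rewrite /dp nseqD mulL_cat. Qed.

Lemma dp_dl k i j i' j' A : dp k i j (dl i' j' A) = dl i' j' (dp k i j A).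
Proof. exact: mulL_dl. Qed.

Lemma fusable_dp h k i j A : fusable h A -> fusable h (dp k i j A).
Proof. exact: fusable_mulL. Qed.

Lemma trunc_dp r k i j A : trunc r A -> trunc r (dp k i j A).
Proof. exact: trunc_mulL. Qed.

Lemma J_dp h k i j p A : fusable h A -> i != h -> j != h ->
  J h p (dp k i j A) = dp k (fuse h i) (fuse h j) (J h p A).
Proof.
move=> lA ih jh; elim: k => // k IHk; rewrite !dpS J_dl ?IHk //.
exact: fusable_dp.
Qed.

Lemma J_dpE h k p A : fusable h A -> J h p (dp k h h.+1 A) = J h (p - k%:Z) A.
Proof.
move=> lA; elim: k p => [|k IHk] p; first by rewrite subr0.
rewrite dpS J_d ?IHk //; last exact: fusable_dp.
by rewrite (_ : p - 1 - k%:Z = p - k.+1%:Z) //; lia.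
Qed.

Definition cube k A := dp k 0 1 (dp k 0 2 (dp k 1 2 A)).

(** Each factor of [t] divides (x_0 - x_1)(x_0 - x_2)(x_1 - x_2) up to sign, so the power [size t]
    of the latter is a multiple of the product over [t]. *)
Lemma mulL_cube t A : validL 3 t -> trunc 3 (mulL t A) ->
  trunc 3 (cube (size t) A).
Proof.
elim: t A => // -[i j] t IH A /= /andP[/and3P[/= i3 j3 ij] vt].
rewrite -mulL_dl => /(IH _ vt); set k := size t => tA.
have cubedl B : cube k (dl i j B) = dl i j (cube k B) by rewrite /cube !dp_dl.
have cubeS B : cube k.+1 B = dl 0 1 (dl 0 2 (dl 1 2 (cube k B))).
  by rewrite /cube !dpS !dp_dl.
rewrite cubedl in tA; rewrite cubeS.
have [i0|[i1|i2]] : i = 0%N \/ i = 1%N \/ i = 2%N by lia.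
- have [j1|j2] : j = 1%N \/ j = 2%N by lia.
  + by rewrite 2!(dlC 0 1); do 2 apply: trunc_dl; move: tA; rewrite i0 j1.
  + by rewrite (dlC 0 2); do 2 apply: trunc_dl; move: tA; rewrite i0 j2.
- have [j0|j2] : j = 0%N \/ j = 2%N by lia.
  + rewrite 2!(dlC 0 1); do 2 apply: trunc_dl; rewrite dl_opp.
    by apply: trunc_opp; move: tA; rewrite i1 j0.
  + by do 2 apply: trunc_dl; move: tA; rewrite i1 j2.
have [j0|j1] : j = 0%N \/ j = 1%N by lia.
  rewrite (dlC 0 2); do 2 apply: trunc_dl; rewrite dl_opp.
  by apply: trunc_opp; move: tA; rewrite i2 j0.
do 2 apply: trunc_dl; rewrite dl_opp.
by apply: trunc_opp; move: tA; rewrite i2 j1.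
Qed.

Lemma cube_le k k' A : (k <= k')%N -> trunc 3 (cube k A) -> trunc 3 (cube k' A).
Proof.
move=> kk'; rewrite -(subnK kk'); set l := (k' - k)%N => tA.
have -> : cube (l + k) A = cube l (cube k A).
  by rewrite /cube !dp_add (dpC k 0 1 l 0 2) (dpC k 0 2 l 1 2) (dpC k 0 1 l 1 2).
by do 3 apply: trunc_dp.
Qed.

(** Multiplication by x0 + x is injective on series bounded below in x0, since the coefficients of
    x0^p are determined by those of x0^(p-1). *)
Lemma s2_inj (G : int -> int -> V) P : (forall p q, p < P -> G p q = 0) ->
  (forall p q, s2 G p q = 0) -> forall p q, G p q = 0.
Proof.
move=> GP sG; suff H (n : nat) : forall p q, p < P + n%:Z -> G p q = 0.
  by move=> p q; apply: (H (absz (p - P)).+1); lia.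
elim: n => [|n IHn] p q pn; first by apply: GP; lia.
have := sG p (q + 1); rewrite /s2 addrK [G (p - 1) _]IHn ?add0r //; lia.
Qed.

Lemma s2_iter_inj k (G H : int -> int -> V) P :
  (forall p q, p < P -> G p q = H p q) ->
  (forall p q, iter k (@s2 K V) G p q = iter k (@s2 K V) H p q) ->
  forall p q, G p q = H p q.
Proof.
move=> GH; have low j p q : p < P -> iter j (@s2 K V) G p q = iter j (@s2 K V) H p q.
  by elim: j p q => [|j IH] p q pP /=; [apply: GH | rewrite /s2 !IH //; lia].
elim: k => // k IHk kGH; apply: IHk => p q.
apply/eqP; rewrite -subr_eq0; apply/eqP.
apply: (@s2_inj (fun p q => iter k (@s2 K V) G p q - iter k (@s2 K V) H p q) P) => {p q}.
  by move=> p q pP; rewrite low // subrr.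
move=> p q; rewrite /s2 addrACA -opprD.
by have := kGH p q; rewrite /= {1 4}/s2 => ->; rewrite subrr.
Qed.

(** The factor x0 + x is the image of x1 under the substitution. *)
Lemma J2_s2 k p (G : int -> int -> V) q : lower_truncated2 G ->
  iter k (@s2 K V) (fun p q => J2 p G q) p q =
  J2 p (fun i j => G (i - k%:Z) j) q.
Proof.
elim: k p q G => [|k IHk] p q G tG; first by apply: eq_J2 => i j; rewrite subr0.
have tG' : lower_truncated2 (fun i j => G (i - k%:Z) j).
  have := trunc2_shift (- k%:Z) 0 tG; by under eq_fun do under eq_fun do rewrite addr0.
rewrite /= {1}/s2 !IHk // -J2_X2 addrC -(J2_d2 charK) // -J2D.
- apply: eq_J2 => i j; rewrite /d2 addrC subrK.
  by congr (G _ _); lia.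
- have := trunc2_shift 0 (- 1) tG'; by under eq_fun do under eq_fun do rewrite addr0.
apply: trunc2D; last apply: trunc2N.
- have := trunc2_shift (- 1) 0 tG'; by under eq_fun do under eq_fun do rewrite addr0.
- have := trunc2_shift 0 (- 1) tG'; by under eq_fun do under eq_fun do rewrite addr0.
Qed.

Lemma J2_X2n (k : nat) p (G : int -> int -> V) q :
  J2 p (fun m n => G m (n + k%:Z)) q = J2 p G (q + k%:Z).
Proof. by apply: eq_isum => m; congr (_ *: G _ _); lia. Qed.

End Powers.

(** * Associativity of n-th products of three fields *)

Section Assoc.
Variables (F : fieldType) (charF : [pchar F] =i pred0).
Variable V : lmodType (laurent F).
Local Notation L := (laurent F).
Variables (a b c : V -> int -> V).
Hypotheses (Ea : Espace a) (Eb : Espace b) (Ec : Espace c).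
Hypotheses (Cab : compat [:: a; b]) (Cbc : compat [:: b; c]) (Cabc : compat [:: a; b; c]).

Let chL := charL charF.

Section FixedPower.
Variable k : nat.
Hypotheses (abk : pairc k a b) (bck : pairc k b c).
Hypothesis abck : forall w, trunc 3 (cube k (prodL [:: a; b; c] w)).
Variables (w : V) (r : int).
Let e : nat -> int := fun=> r.
Let T := prodL [:: a; b; c] w.

Let legT01 : fusable 0 (dp k 0 1 T).
Proof. exact: (@fusable_prodL F V [::] [:: c] a b w k I abk). Qed.

Let legT12 : fusable 1 (dp k 1 2 T).
Proof. exact: (@fusable_prodL F V [:: a] [::] b c w k (conj Ea I) bck). Qed.

(** At a fixed power x^r, [Nf] lists the coefficients of z^p y^q in Y_E(Y_E(a, z) b, y) c, and [Mf]
    those of y_1^i y_2^j in Y_E(a, y_1) Y_E(b, y_2) c. *)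
Let Nf p q := nprod (- q - 1) (nprod (- p - 1) a b) c w r.
Let Mf i j := nprod (- i - 1) a (nprod (- j - 1) b c) w r.

(** The power of x_1 - x_2 needed to fuse a_n b with c depends on n, hence the bound K0. Multiplying
    by z + y amounts to a factor x_0 - x_2 in T, because (x_0 - x_1) + (x_1 - x_2) becomes z + y
    under the two fusions. *)
Let N_iter (j : nat) p : exists K0, forall K, (K0 <= K)%N ->
  let X := J 0 (p + k%:Z) (dp j 0 2 (dp K 1 2 (dp k 0 1 T))) in
  fusable 0 X /\ forall q, iter j (@s2 L V) Nf p q = J 0 (q + K%:Z) X e.
Proof.
elim: j p => [|j IHj] p.
  pose ab := nprod (- p - 1) a b.
  have Eab : Espace ab by apply: (nprod_E charF (- p - 1) Ea Eb abk).
  have [K0 abc0] : exists K, pairc K ab c.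
    by apply: compat_pairc; apply: (@compat_nprod _ charF V [::] [:: c]).
  exists K0 => K K0K; have abcK := pairc_le K0K abc0.
  have XE : dp K 0 1 (prodL [:: ab; c] w) =
      J 0 (p + k%:Z) (dp K 1 2 (dp k 0 1 T)).
    rewrite J_dp //; congr (dp _ _ _ _).
    rewrite /ab (@prodL_nprod F charF V [::] [:: c] a b w k) //=.
    by rewrite (_ : k%:Z - (- p - 1) - 1 = p + k%:Z) //; lia.
  split; first by rewrite /= -XE; apply: (@fusable_prodL F V [::] [::] ab c w K I abcK).
  move=> q; rewrite /= -XE.
  have := @prodL_nprod F charF V [::] [::] ab c w K (- q - 1) I Eab Ec abcK.
  move=> /(congr1 (fun f => f e)); rewrite (_ : K%:Z - (- q - 1) - 1 = q + K%:Z) //.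
  by lia.
have [K0 H0] := IHj p; have [K1 H1] := IHj (p - 1).
exists (maxn K0 K1) => K; rewrite geq_max => /andP[/H0[l0 e0] /H1[l1 e1]].
set Y := dp j 0 2 _ in l0 e0 l1 e1 *.
have lY : fusable 0 Y by do 2 apply: fusable_dp.
have -> : dp j.+1 0 2 (dp K 1 2 (dp k 0 1 T)) = dl 0 2 Y by [].
have XE : J 0 (p + k%:Z) (dl 0 2 Y) =
    J 0 (p - 1 + k%:Z) Y + dl 0 1 (J 0 (p + k%:Z) Y).
  rewrite (dl_split 0 1) JD; try exact: fusable_dl.
  by rewrite (J_d chL) // J_dl // (_ : p - 1 + k%:Z = p + k%:Z - 1) //; lia.
rewrite /= XE; split; first by apply: fusableD => //; apply: fusable_dl.
move=> q; rewrite /s2 e0 e1 JD //; last exact: fusable_dl.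
by rewrite !fctE (J_d chL) // (_ : q - 1 + K%:Z = q + K%:Z - 1) //; lia.
Qed.

(** With x_1, x_2 fused before x_0, the factor x_0 - x_1 = (x_0 - x_2) - (x_1 - x_2) becomes y_1 -
    y_2. *)
Let M_iter (l : nat) j : exists K0, forall K, (K0 <= K)%N ->
  let X := J 1 (j + k%:Z) (dp l 0 1 (dp K 0 2 (dp k 1 2 T))) in
  fusable 0 X /\ forall i, iter l (@d2 L V) Mf i j = J 0 (i + K%:Z) X e.
Proof.
elim: l j => [|l IHl] j.
  pose bc := nprod (- j - 1) b c.
  have Ebc : Espace bc by apply: (nprod_E charF (- j - 1) Eb Ec bck).
  have [K0 abc0] : exists K, pairc K a bc.
    by apply: compat_pairc; apply: (@compat_nprod _ charF V [:: a] [::]).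
  exists K0 => K K0K; have abcK := pairc_le K0K abc0.
  have XE : dp K 0 1 (prodL [:: a; bc] w) =
      J 1 (j + k%:Z) (dp K 0 2 (dp k 1 2 T)).
    rewrite J_dp //; congr (dp _ _ _ _).
    rewrite /bc (@prodL_nprod F charF V [:: a] [::] b c w k) //=.
    by rewrite (_ : k%:Z - (- j - 1) - 1 = j + k%:Z) //; lia.
  split; first by rewrite /= -XE; apply: (@fusable_prodL F V [::] [::] a bc w K I abcK).
  move=> i; rewrite /= -XE.
  have := @prodL_nprod F charF V [::] [::] a bc w K (- i - 1) I Ea Ebc abcK.
  move=> /(congr1 (fun f => f e)); rewrite (_ : K%:Z - (- i - 1) - 1 = i + K%:Z) //.
  by lia.
have [K0 H0] := IHl j; have [K1 H1] := IHl (j - 1).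
exists (maxn K0 K1) => K; rewrite geq_max => /andP[/H0[l0 e0] /H1[l1 e1]].
set Y := dp l 0 1 _ in l0 e0 l1 e1 *.
have lY : fusable 1 Y by do 2 apply: fusable_dp.
have -> : dp l.+1 0 1 (dp K 0 2 (dp k 1 2 T)) = dl 0 1 Y by [].
have XE : J 1 (j + k%:Z) (dl 0 1 Y) =
    dl 0 1 (J 1 (j + k%:Z) Y) - J 1 (j - 1 + k%:Z) Y.
  by rewrite (J_dli chL) // (_ : j - 1 + k%:Z = j + k%:Z - 1) //; lia.
rewrite /= XE; split; first by apply: fusableD; [apply: fusable_dl | apply: fusableN].
move=> i; rewrite /d2 e0 e1 JB //; last exact: fusable_dl.
by rewrite !fctE (J_d chL) // (_ : i - 1 + K%:Z = i + K%:Z - 1) //; lia.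
Qed.

Let Fw := cube k T.
Let tF : trunc 3 Fw. Proof. exact: abck. Qed.

(** For K = K0 + k the factors present are those of [Fw] and a surplus (x_1 - x_2)^K0; the second
    fusion turns the surplus into a shift that cancels K0 from the formula. *)
Let N_final p q : iter k (@s2 L V) Nf p q = J 0 (q + k%:Z) (J 0 (p + k%:Z) Fw) e.
Proof.
have [K0 H] := N_iter k p; have [_ ->] := H (K0 + k)%N (leq_addr _ _).
have -> : dp k 0 2 (dp (K0 + k) 1 2 (dp k 0 1 T)) = dp K0 1 2 Fw.
  by rewrite dp_add (dpC k 0 2) /Fw /cube (dpC k 1 2 k 0 1) (dpC k 0 2 k 0 1).
rewrite J_dp //; last exact: (@trunc_fusable _ _ 2).
rewrite (J_dpE chL); first by rewrite (_ : q + (K0 + k)%N%:Z - K0%:Z = q + k%:Z) //; lia.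
by apply: (@trunc_fusable _ _ 1) => //; apply: trunc_J.
Qed.

Let M_final i j : iter k (@d2 L V) Mf i j = J 0 (i + k%:Z) (J 1 (j + k%:Z) Fw) e.
Proof.
have [K0 H] := M_iter k j; have [_ ->] := H (K0 + k)%N (leq_addr _ _).
have -> : dp k 0 1 (dp (K0 + k) 0 2 (dp k 1 2 T)) = dp K0 0 2 Fw.
  by rewrite dp_add (dpC k 0 1).
rewrite J_dp //; last exact: (@trunc_fusable _ _ 2).
rewrite (J_dpE chL); first by rewrite (_ : i + (K0 + k)%N%:Z - K0%:Z = i + k%:Z) //; lia.
by apply: (@trunc_fusable _ _ 1) => //; apply: trunc_J.
Qed.

Let J0 p i : p < 0 -> J i p Fw = 0. Proof. exact: J_lt0. Qed.

Lemma M_trunc : lower_truncated2 (iter k (@d2 L V) Mf).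
Proof.
exists (- k%:Z) => i j ij; rewrite M_final.
have [ik|ik] := ltP (i + k%:Z) 0; first by rewrite J_lt0.
rewrite (J0 1); last by lia.
by apply: isum0 => m; exact: scaler0.
Qed.

(** Multiplied by (z + y)^k, both sides become fusions of [Fw] in the two possible orders, which
    [J_comp] relates. The factor can be cancelled because both sides vanish for p < - k. *)
Lemma nprod_nprod p q : Nf p q = J2 (p + k%:Z) (iter k (@d2 L V) Mf) q.
Proof.
pose G := iter k (@d2 L V) Mf.
have tG : lower_truncated2 (fun i j => G i j) by exact: M_trunc.
apply: (@s2_iter_inj _ _ k Nf (fun p q => J2 (p + k%:Z) G q) (- k%:Z)).
  move=> {}p {}q pk; rewrite J2_lt0; last by lia.
  have [K0 H] := N_iter 0 p; have [_ /(_ q)/= ->] := H K0 (leqnn _).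
  rewrite [J 0 (p + _) _]J_lt0; last by lia.
  by apply: isum0 => m; exact: scaler0.
move=> {}p {}q; rewrite N_final.
have -> : iter k (@s2 L V) (fun p q => J2 (p + k%:Z) G q) p q =
    iter k (@s2 L V) (fun p q => J2 p G q) (p + k%:Z) q.
  elim: (k in iter k) p q => // j IH p' q' /=; rewrite /s2 !IH.
  by rewrite (_ : p' - 1 + k%:Z = p' + k%:Z - 1) //; lia.
rewrite J2_s2 // J_comp // -J2_X2n; apply: eq_J2 => i j.
by rewrite /G M_final subrK.
Qed.

End FixedPower.

Lemma nprod_assoc : exists k0, forall k, (k0 <= k)%N -> pairc k a b /\
  forall w r, 
  let M := fun i j => nprod (- i - 1) a (nprod (- j - 1) b c) w r in
  forall m n, nprod n (nprod m a b) c w r =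
    J2 (k%:Z - m - 1) (iter k (@d2 L V) M) (- n - 1).
Proof.
have [k1 ab1] := compat_pairc Cab; have [k2 bc2] := compat_pairc Cbc.
have [t vt tT] := Cabc.
exists (maxn (size t) (maxn k1 k2)) => k; rewrite !geq_max => /and3P[tk k1k k2k].
have abk := pairc_le k1k ab1; have bck := pairc_le k2k bc2.
split=> // w r M m n.
have := @nprod_nprod k abk bck _ w r (- m - 1) (- n - 1).
rewrite (_ : - (- n - 1) - 1 = n); last by lia.
rewrite (_ : - (- m - 1) - 1 = m); last by lia.
rewrite (_ : - m - 1 + k%:Z = k%:Z - m - 1); last by lia.
apply=> w'; apply: (cube_le tk); apply: mulL_cube => //; exact: tT.
Qed.

End Assoc.

Lemma isum_ord (M : zmodType) (f : int -> M) (N : nat) :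
  (forall i : int, (i < 0) || (N%:Z <= i) -> f i = 0) ->
  isum f = \sum_(l < N) f l.
Proof.
move=> f0; rewrite (isumE (N := N)) => [|i iN]; last by apply: f0; lia.
rewrite -(big_mkord xpredT (fun l => f (Posz l))) /index_iota subn0.
rewrite -(big_map Posz xpredT f).
have memP i : i \in [seq Posz l | l <- iota 0 N] = (0 <= i < N%:Z).
  apply/mapP/idP => [[l]|iN]; first by rewrite mem_iota => ? ->; lia.
  by exists (absz i); rewrite ?mem_iota; lia.
have uP : uniq [seq Posz l | l <- iota 0 N].
  by rewrite map_inj_uniq ?iota_uniq // => i j [].
rewrite [LHS](bigID (fun i => 0 <= i < N%:Z)) /= [X in _ + X]big1 ?addr0; last first.
  by move=> i iN; apply: f0; lia.
rewrite -[LHS]big_filter; apply: perm_big.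
apply: uniq_perm; rewrite ?filter_uniq ?uniq_window //.
move=> i; rewrite mem_filter memP mem_window andbC.
by apply/andP/idP => [[]//|?]; split => //; lia.
Qed.

(** * The Leibniz rule for the substitution *)

Section Leibniz.
Variables (K : fieldType) (charK : [pchar K] =i pred0) (V : lmodType K).

Implicit Types c : laurent K.

Definition xmul (c : laurent K) (G : int -> int -> V) (m n : int) : V :=
  isum (fun i => c i *: G (m - i) n).

Lemma xmul_fin c (G : int -> int -> V) m n :
  (exists N, forall m, m < N -> G m n = 0) ->
  fin (fun i => c i *: G (m - i) n).
Proof.
move=> [N GN]; have [P cP] := lcoef_truncated c.
apply: (@fin_le _ _ P (m - N)) => i /orP[/cP->|?]; first by rewrite scale0r.
by rewrite GN ?scaler0 //; lia.
Qed.

Lemma trunc2_xmul c G : lower_truncated2 G -> lower_truncated2 (xmul c G).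
Proof.
move=> [N GN]; have [P cP] := lcoef_truncated c.
exists (Num.min N (N + P)) => m n mn; apply: isum0 => i.
have [/cP->|Pi] := ltP i P; first by rewrite scale0r.
by rewrite GN ?scaler0 //; lia.
Qed.

Lemma xmul_d2 c (G : int -> int -> V) :
  (forall n, exists N, forall m, m < N -> G m n = 0) ->
  xmul c (@d2 K V G) = @d2 K V (xmul c G).
Proof.
move=> GN; apply/funext => m; apply/funext => n.
rewrite /xmul /d2 -isumB; try exact: xmul_fin.
apply: eq_isum => i; rewrite scalerBr; congr (_ *: G _ _ - _); lia.
Qed.

Lemma xmul_iter_d2 k c (G : int -> int -> V) :
  (forall n, exists N, forall m, m < N -> G m n = 0) ->
  iter k (@d2 K V) (xmul c G) = xmul c (iter k (@d2 K V) G).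
Proof.
move=> GN; elim: k => //= k ->; rewrite xmul_d2 //.
elim: k => //= k IHk n; have [N HN] := IHk n; have [P HP] := IHk (n - 1).
by exists (Num.min N P) => m mNP; rewrite /d2 HN ?HP ?subrr //; lia.
Qed.

Lemma ldp_subproof l (f : laurent K) :
  lower_truncated (fun n : int => bz K (n + Posz l) l * f (n + Posz l)).
Proof.
have [N fN] := lcoef_truncated f; exists (N - l%:Z) => n nN.
by rewrite fN ?mulr0 //; lia.
Qed.

(* The divided power [(d/dx)^l / l!] *)
Definition ldp l (f : laurent K) : laurent K := Laurent (ldp_subproof l f).

(** Taylor's formula for c(x + x0). Terms with l > p do not reach the coefficient of x0^p, so any N
    > p may serve as a cutoff. *)
Lemma J2_xmul p c G q (N : nat) : p < N%:Z -> lower_truncated2 G ->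
  J2 p (xmul c G) q =
  \sum_(l < N) isum (fun i => ldp l c i *: J2 (p - (l : nat)%:Z) G (q - i)).
Proof.
move=> pN [M GM]; have tG : lower_truncated2 G by exists M.
have [P cP] := lcoef_truncated c.
pose B := (absz M + absz P + absz (q + p)%R)%N.
have Gi i m : (i < P) || (m < M) || (q + p - M < m + i) ->
    c i *: G m (q - m - i + p) = 0.
  move=> H; have [/cP->|Pi] := ltP i P; first by rewrite scale0r.
  by rewrite GM ?scaler0 //; lia.
transitivity (isum (fun i => isum (fun m =>
    bz K (m + i) p *: (c i *: G m (q - m - i + p))))).
  transitivity (isum (fun m => isum (fun i =>
      bz K m p *: (c i *: G (m - i) (q - m + p))))).
    rewrite /J2; apply: eq_isum => m; rewrite -isumZ //.
    by apply: xmul_fin; exists M => j jM; rewrite GM // jM.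
  rewrite isum_exchange.
    apply: eq_isum => i; rewrite (@isum_shift _ _ i).
    apply: eq_isum => m; congr (_ *: (_ *: G _ _)); lia.
  exists (B + B + B + B)%N => m i H.
  have -> : q - m + p = q - (m - i) - i + p by lia.
  by rewrite Gi ?scaler0 //; lia.
transitivity (\sum_(l < N) isum (fun i => isum (fun m =>
    (bz K i (l : nat)%:Z * bz K m (p - (l : nat)%:Z)) *:
      (c i *: G m (q - m - i + p))))); last first.
  apply: eq_bigr => l _; rewrite [LHS](@isum_shift _ _ l).
  apply: eq_isum => i; rewrite /J2 -isumZ; last exact: J2_fin.
  apply: eq_isum => m; rewrite !scalerA /= mulrAC.
  congr (_ *: G _ _); lia.
rewrite -isum_fsum => [|l]; last first.
  apply: fin2_sum; exists (B + B + B)%N => i m H.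
  by rewrite Gi ?scaler0 //; lia.
apply: eq_isum => i; rewrite -isum_fsum => [|l]; last first.
  apply: (@fin_le _ _ M (q + p - M - i)) => m H.
  by rewrite Gi ?scaler0 //; lia.
apply: eq_isum => m; rewrite -scaler_suml addrC bz_Vandermonde //.
congr (_ *: _); apply: isum_ord => l /orP[l0|lN]; first by rewrite bz_lt0 ?mul0r.
by rewrite [bz K m _]bz_lt0 ?mulr0 //; lia.
Qed.

Lemma ldp_ldp m l (f : laurent K) i :
  ldp m (ldp l f) i = bz K (m + l)%N l * ldp (m + l) f i.
Proof.
rewrite /= (_ : i + (m + l)%N%:Z = i + m%:Z + l%:Z); last by lia.
rewrite mulrA [RHS]mulrA; congr (_ * _).
have := bz_trinomial charK (i + m%:Z + l%:Z) (m + l)%N l.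
rewrite addrK (_ : (m + l)%N%:Z - l%:Z = m%:Z); last by lia.
by move=> H; rewrite [LHS]mulrC -H mulrC.
Qed.

Lemma natr_laurent n : n%:R = laurent_const n%:R :> laurent K.
Proof.
elim: n => [|n IHn]; first by apply: laurentP => m /=; rewrite if_same.
by rewrite -!natr1 IHn laurent_constD.
Qed.

Lemma ldpE l (f : laurent K) :
  iter l (@lderiv K) f / l`!%:R = ldp l f.
Proof.
have l0 : l`!%:R != 0 :> laurent K.
  have : l`!%:R != 0 :> K by rewrite ((pcharf0P K).1 charK) -lt0n fact_gt0.
  apply: contraNneq => /(congr1 (fun g : laurent K => g 0)).
  by rewrite natr_laurent /= => ->.
apply/(canLR (mulfK l0)) => {l0}; rewrite mulrC natr_laurent.
elim: l => [|l IHl].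
  by apply: laurentP => n; rewrite laurent_constM /= mul1r bz0 mul1r addr0.
rewrite iterS IHl; apply: laurentP => n.
change ((n + 1)%:~R * laurent_mul (laurent_const l`!%:R) (ldp l f) (n + 1) =
  laurent_mul (laurent_const l.+1`!%:R) (ldp l.+1 f) n).
rewrite !laurent_constM.
rewrite factS natrM /= (_ : n + 1 + l%:Z = n + l.+1%:Z); last by lia.
have := bz_rec charK (n + l.+1%:Z) l%:Z.
rewrite (_ : l%:Z + 1 = l.+1%:Z); last by lia.
rewrite (_ : n + l.+1%:Z - l%:Z = n + 1) => [e|]; last by lia.
transitivity (l`!%:R * ((n + 1)%:~R * bz K (n + l.+1%:Z) l) * f (n + l.+1%:Z)).
  by ring.
by rewrite -e -pmulrn; ring.
Qed.

Lemma taylor_shiftE (f : laurent K) i :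
  taylor_shift f i = if i is Posz l then ldp l f else 0.
Proof. by case: i => // l; rewrite /taylor_shift /= ldpE. Qed.

Lemma lderiv_ldp l (f : laurent K) i :
  lderiv (ldp l f) i = l.+1%:R * ldp l.+1 f i.
Proof.
change ((i + 1)%:~R * (bz K (i + 1 + l%:Z) l * f (i + 1 + l%:Z)) =
  l.+1%:R * (bz K (i + l.+1%:Z) l.+1 * f (i + l.+1%:Z))).
rewrite (_ : i + 1 + l%:Z = i + l.+1%:Z); last by lia.
rewrite [LHS]mulrA [RHS]mulrA; congr (_ * _).
have := bz_rec charK (i + l.+1%:Z) l%:Z.
rewrite (_ : l%:Z + 1 = l.+1%:Z); last by lia.
rewrite (_ : i + l.+1%:Z - l%:Z = i + 1) => [<-|]; last by lia.
by rewrite -pmulrn.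
Qed.

(** The chain rule: d/dx of G(x + x0, x) is (d/dx1 + d/dx2) G after substitution. *)
Lemma J2_deriv p (G : int -> int -> V) q : lower_truncated2 G ->
  J2 p (fun i j => (i + 1)%:~R *: G (i + 1) j + (j + 1)%:~R *: G i (j + 1)) q =
  (q + 1)%:~R *: J2 p G (q + 1).
Proof.
move=> [N GN]; have tG : lower_truncated2 G by exists N.
have t1 : lower_truncated2 (fun i j => (i + 1)%:~R *: G (i + 1) j).
  by exists (N - 1) => m n mn; rewrite GN ?scaler0 //; lia.
have t2 : lower_truncated2 (fun i j => (j + 1)%:~R *: G i (j + 1)).
  by exists (N - 1) => m n mn; rewrite GN ?scaler0 //; lia.
rewrite J2D // {1}/J2 (@isum_shift _ _ (- 1)) {1}/J2.
rewrite -isumD; last 2 first.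
- apply: (@fin_le _ _ N (q + p + 1 - N)) => m mN.
  by rewrite subrK GN ?scaler0 //; lia.
- exact: (J2_fin p q t2).
rewrite /J2 -isumZ; last exact: J2_fin.
apply: eq_isum => m; rewrite !scalerA subrK.
have -> : q - (m - 1) + p = q + 1 - m + p by lia.
have -> : q - m + p + 1 = q + 1 - m + p by lia.
rewrite -scalerDl; congr (_ *: _); rewrite mulrC bz_mulm // mulrC -mulrDr mulrC.
by rewrite -intrD; congr (_%:~R * _); lia.
Qed.

End Leibniz.

(** Binomial coefficients formed in F((t)) are constants, so F-linear maps commute with them. *)
Lemma bz_laurent (F : fieldType) : [pchar F] =i pred0 ->
  forall m p, bz (laurent F) m p = laurent_const (bz F m p).
Proof.
move=> charF m; have charL := charL charF.
have natE n : n%:R = laurent_const n%:R :> laurent F by exact: natr_laurent.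
have intE (n : int) : n%:~R = laurent_const n%:~R :> laurent F.
  case: n => n; first by rewrite -!pmulrn.
  rewrite NegzE !mulrNz -!pmulrn natE; apply: laurentP => i /=.
  by case: ifP; rewrite ?oppr0.
elim/bz_ind_rec => [p p0||p p0 IHp].
- by rewrite !bz_lt0 //; apply: laurentP => i /=; rewrite if_same.
- by rewrite !bz0.
apply: (@intf_inj _ charL (p + 1)); first by lia.
by rewrite bz_rec // IHp !intE -!laurent_const_mul bz_rec.
Qed.

(** * Weak associativity and the Jacobi identity from expansions *)

Section Expansions.
Variables (K : fieldType) (charK : [pchar K] =i pred0) (V : lmodType K).
Implicit Types A B G : int -> int -> V.

(* [A(x0 + x2, x2)], expanded in nonnegative powers of [x2] *)
Definition S02 A (p q : int) : V :=
  isum (fun m => bz K m (m - p) *: A m (q - m + p)).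

Lemma S02_fin A (N p q : int) : (forall m n, n < N -> A m n = 0) ->
  fin (fun m => bz K m (m - p) *: A m (q - m + p)).
Proof.
move=> AN; apply: (@fin_le _ _ p (q + p - N)) => m /orP[?|?].
  by rewrite bz_lt0 ?scale0r //; lia.
by rewrite AN ?scaler0 //; lia.
Qed.

Lemma s2_S02 A N : (forall m n, n < N -> A m n = 0) ->
  s2 (S02 A) = S02 (fun m n => A (m - 1) n).
Proof.
move=> AN; apply/funext => p; apply/funext => q; rewrite /s2 /S02.
rewrite -isumD; try exact: (S02_fin _ _ AN).
rewrite [RHS](@isum_shift _ _ 1); apply: eq_isum => m.
rewrite (_ : q - 1 - m + p = q - m + (p - 1)); last by lia.
rewrite -scalerDl (_ : m + 1 - 1 = m); last by lia.
rewrite (_ : q - (m + 1) + p = q - m + (p - 1)); last by lia.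
rewrite bzS // (_ : m + 1 - p = m - (p - 1)); last by lia.
by rewrite (_ : m - (p - 1) - 1 = m - p) //; lia.
Qed.

Lemma S02_d2 A N p q : (forall m n, n < N -> A m n = 0) ->
  S02 (d2 A) p q = S02 A (p - 1) q.
Proof.
move=> AN; rewrite /S02 /d2.
transitivity (isum (fun m => bz K m (m - p) *: A (m - 1) (q - m + p)) -
  isum (fun m => bz K m (m - p) *: A m (q - 1 - m + p))).
  rewrite -isumB; last exact: (S02_fin _ _ AN).
    apply: eq_isum => m; rewrite scalerBr.
    by rewrite (_ : q - 1 - m + p = q - m + p - 1) //; lia.
  by apply: (@S02_fin (fun m n => A (m - 1) n) N) => m n; apply: AN.
rewrite [X in X - _](@isum_shift _ _ 1) -isumB; last exact: (S02_fin _ _ AN).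
  apply: eq_isum => m; rewrite (_ : m + 1 - 1 = m); last by lia.
  rewrite (_ : q - 1 - m + p = q - m + (p - 1)); last by lia.
  rewrite (_ : q - (m + 1) + p = q - m + (p - 1)); last by lia.
  rewrite -scalerBl bzS // (_ : m + 1 - p = m - (p - 1)); last by lia.
  by rewrite (_ : m - (p - 1) - 1 = m - p) ?addrK //; lia.
apply: (@fin_shift _ (fun m => bz K m (m - p) *: A (m - 1) (q - m + p))).
by apply: (@S02_fin (fun m n => A (m - 1) n) N) => m n; apply: AN.
Qed.

Lemma iter_d2_low k A N : (forall m n, n < N -> A m n = 0) ->
  forall m n, n < N -> iter k (@d2 K V) A m n = 0.
Proof.
move=> AN; elim: k => // k IHk m n nN /=.
by rewrite /d2 !IHk ?subrr //; lia.
Qed.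

Lemma S02_iter_d2 k A N p q : (forall m n, n < N -> A m n = 0) ->
  S02 (iter k (@d2 K V) A) p q = S02 A (p - k%:Z) q.
Proof.
move=> AN; elim: k p q => [|k IHk] p q; first by rewrite subr0.
rewrite iterS (S02_d2 _ _ (iter_d2_low k AN)) IHk.
by rewrite (_ : p - 1 - k%:Z = p - k.+1%:Z) //; lia.
Qed.

Lemma iter_s2_S02 l A N p q : (forall m n, n < N -> A m n = 0) ->
  iter l (@s2 K V) (S02 A) p q = S02 (fun m n => A (m - l%:Z) n) p q.
Proof.
move=> AN; elim: l p q => [|l IHl] p q.
  by congr (S02 _ p q); apply/funext => m; rewrite subr0.
rewrite iterS [in LHS](_ : iter _ _ _ = S02 (fun m n => A (m - l%:Z) n)).
  rewrite (@s2_S02 _ N) => [|m n]; last exact: AN.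
  congr (S02 _ p q); apply/funext => m; apply/funext => n.
  by rewrite (_ : m - 1 - l%:Z = m - l.+1%:Z) //; lia.
by apply/funext => p'; apply/funext => q'; apply: IHl.
Qed.

Lemma iter_s2_shift l (H : int -> int -> V) c p q :
  iter l (@s2 K V) (fun p q => H (p + c) q) p q = iter l (@s2 K V) H (p + c) q.
Proof.
elim: l p q => // l IHl p q; rewrite !iterS {1}/s2 !IHl /s2.
by rewrite (_ : p - 1 + c = p + c - 1) //; lia.
Qed.

(** Both sides expand x0^(-k) G with G = (x1 - x2)^k A in V((x1, x2)). A power of x1 = x0 + x2
    clears the negative exponents of x1 in G; then only nonnegative powers of x0 + x2 occur, whose
    two expansions agree by [bz_sym]. *)
Lemma expand_assoc A N k : (forall m n, n < N -> A m n = 0) ->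
  lower_truncated2 (iter k (@d2 K V) A) ->
  exists l : nat, forall p q, iter l (@s2 K V) (S02 A) p q =
    iter l (@s2 K V) (fun p q => J2 (p + k%:Z) (iter k (@d2 K V) A) q) p q.
Proof.
set G := iter k _ A => AN tG; have [P GP] := tG.
exists (absz P) => p q.
rewrite (iter_s2_shift _ (fun p q => J2 p G q)) (J2_s2 charK) //.
have -> : iter (absz P) (@s2 K V) (S02 A) p q =
    iter (absz P) (@s2 K V) (S02 G) (p + k%:Z) q.
  rewrite -iter_s2_shift; congr (iter _ _ _ p q).
  apply/funext => p'; apply/funext => q'.
  by rewrite (S02_iter_d2 _ _ _ AN) addrK.
rewrite (iter_s2_S02 _ _ _ (iter_d2_low k AN)).
apply: eq_isum => m; have [m0|m0] := ltP m 0; last by rewrite bz_sym.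
by rewrite -/G !GP ?scaler0 //; lia.
Qed.

Definition sg (z : int) : K := (-1) ^+ absz z.

Lemma sgE z : (-1) ^ z = sg z.
Proof.
case: z => n //; rewrite /sg /exprz /=.
by rewrite invr_sign.
Qed.

Lemma sgD a b : sg (a + b) = sg a * sg b.
Proof. by rewrite -!sgE expfzDr // oppr_eq0 oner_eq0. Qed.

Lemma sg_sq a : sg a * sg a = 1.
Proof. by rewrite /sg -expr2 sqrr_sign. Qed.

Lemma sgN a : sg (- a) = sg a.
Proof. by rewrite /sg abszN. Qed.

(* The coefficients of [x1^m x2^n] in the difference of the two expansions of
   [(x1 - x2)^e x1^a x2^b], for [y = m - a]. *)
Lemma delta_coef (e y m : int) :
  sg (e - y) * (bz K e (e - y) - bz K e y) =
  isum (fun i => bz K (m + i) i * sg i * bz K (m - y) (- e - 1 - i)).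
Proof.
have [e0|e0] := leP 0 e.
  rewrite bz_sym // subrr mulr0 isum0 // => i.
  have [i0|i0] := ltP i 0; first by rewrite bz_lt0 ?mul0r.
  by rewrite [bz K (m - y) _]bz_lt0 ?mulr0 //; lia.
pose j := - e - 1.
(* For e < 0 both sides equal this binomial: the right one by Vandermonde after negating an upper
   index, the left one because at most one of its two terms is nonzero, according to the sign of
   y. *)
transitivity (bz K (- y - 1) j); last first.
  rewrite (_ : - y - 1 = (- m - 1) + (m - y)); last by lia.
  rewrite bz_Vandermonde //; apply: eq_isum => -[i|i]; last first.
    by rewrite (@bz_lt0 K (- m - 1)) // (@bz_lt0 K (m + Negz i)) // ?mul0r.
  by rewrite bz_opp // [X in X * _ = _]mulrC.
have eE : e = - j - 1 by rewrite /j; lia.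
have j0 : 0 <= j by rewrite /j; lia.
clearbody j.
have [y0|y0] := leP 0 y.
  rewrite (@bz_lt0 K e (e - y)) ?sub0r; last by lia.
  have := bz_opp charK j (absz y); rewrite gez0_abs // -eE => ->.
  have := bz_opp charK y (absz j); rewrite gez0_abs // => ->.
  rewrite -/(sg y) -/(sg j) (_ : e - y = - (j + y + 1)); last by lia.
  rewrite sgN !sgD -[bz K (j + y) y](bz_sym charK); last by lia.
  rewrite (_ : j + y - y = j); last by lia.
  rewrite (addrC y j) (_ : sg 1 = -1) //.
  transitivity (sg j * (sg y * sg y) * bz K (j + y) j); first by ring.
  by rewrite sg_sq mulr1.
rewrite (@bz_lt0 K e y) // subr0; have [z0|z0] := leP 0 (e - y); last first.
  by rewrite (@bz_lt0 K e (e - y)) // mulr0 bz_gt //; lia.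
have := bz_opp charK j (absz (e - y)%R); rewrite gez0_abs // -eE => ->.
rewrite -/(sg (e - y)) mulrA sg_sq mul1r.
rewrite (_ : j + (e - y) = - y - 1); last by lia.
rewrite -[LHS](bz_sym charK); last by lia.
by rewrite (_ : - y - 1 - (e - y) = j) //; lia.
Qed.

Lemma plc_d2 (e : int) A : 
  (forall a b, fin (fun j => (bz K e j * (-1) ^+ absz j) *: A (a - e + j) (b - j))) ->
  plc (-1) (e + 1) A = plc (-1) e (d2 A).
Proof.
move=> finA; apply/funext => a; apply/funext => b; rewrite plcS //.
rewrite scaleN1r /plc -isumB; try exact: finA.
apply: eq_isum => j; rewrite -scalerBr /d2.
by congr (_ *: (A _ _ - A _ _)); lia.
Qed.

Lemma plc_fin e A N : (forall m n, n < N -> A m n = 0) ->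
  forall a b, fin (fun j => (bz K e j * (-1) ^+ absz j) *: A (a - e + j) (b - j)).
Proof.
move=> AN a b; apply: (@fin_le _ _ 0 (b - N)) => j /orP[?|?].
  by rewrite bz_lt0 ?mul0r ?scale0r.
by rewrite AN ?scaler0 //; lia.
Qed.

Lemma plc_iter_d2 k (e : int) A N : (forall m n, n < N -> A m n = 0) ->
  plc (-1) (e + k%:Z) A = plc (-1) e (iter k (@d2 K V) A).
Proof.
move=> AN; elim: k e => [|k IHk] e; first by rewrite addr0.
rewrite (_ : e + k.+1%:Z = e + 1 + k%:Z); last by lia.
by rewrite IHk (plc_d2 (plc_fin e (iter_d2_low k AN))).
Qed.

Definition flip A (n m : int) := A m n.

Lemma iter_d2_flip k A n m :
  iter k (@d2 K V) (flip A) n m = sg k *: iter k (@d2 K V) A m n.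
Proof.
elim: k n m => [|k IHk] n m; first by rewrite scale1r.
rewrite !iterS {1}/d2 !IHk (_ : k.+1%:Z = k%:Z + 1); last by lia.
by rewrite sgD (_ : sg 1 = -1) // mulrN1 scaleNr -scalerN /d2 opprB scalerBr.
Qed.

(** The two expansions of (x1 - x2)^e G differ by a delta-function term, in which G enters only
    through the substitution x1 = x2 + x0; coefficientwise this is [delta_coef]. *)
Lemma delta_diff (e : int) G m n : lower_truncated2 G ->
  plc (-1) e G m n - sg e *: plc (-1) e (flip G) n m =
  isum (fun i => (bz K (m + i) i * sg i) *:
           J2 (- e - 1 - i) G (n + 1 + m + i)).
Proof.
move=> [N GN]; pose s := m + n - e.
have finG (c : int -> K) : fin (fun a => c a *: G a (s - a)).
  apply: (@fin_le _ _ N (s - N)) => a H; rewrite GN ?scaler0 //; lia.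
transitivity (isum (fun a => (bz K e (a - m + e) * sg (a - m + e)) *: G a (s - a)) -
   isum (fun a => (sg e * (bz K e (m - a) * sg (m - a))) *: G a (s - a))).
  congr (_ - _).
    rewrite /plc (@isum_shift _ _ (- m + e)); apply: eq_isum => a.
    rewrite -/(sg _) (_ : a + (- m + e) = a - m + e); last by lia.
    by congr (_ *: G _ _); rewrite /s; lia.
  rewrite /plc -isumZ; last first.
    apply: (@fin_le _ _ (N - n + e) (m - N)) => a H; rewrite /flip GN ?scaler0 //; lia.
  rewrite (@isum_flip _ _ m); apply: eq_isum => a.
  rewrite -/(sg _) scalerA /flip.
  by congr (_ *: G _ _); rewrite /s; lia.
rewrite -isumB //.
transitivity (isum (fun a => isum (fun i =>
    (bz K (m + i) i * sg i * bz K a (- e - 1 - i)) *: G a (s - a)))).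
  apply: eq_isum => a; rewrite -scalerBl isum_scalel; last first.
    apply: (@fin_le _ _ 0 (- e - 1)) => i /orP[?|?]; first by rewrite bz_lt0 ?mul0r.
    by rewrite [bz K a _]bz_lt0 ?mulr0 //; lia.
  congr (_ *: _); have := delta_coef e (m - a) m.
  rewrite (_ : e - (m - a) = a - m + e); last by lia.
  rewrite (_ : m - (m - a) = a) => [<-|]; last by lia.
  rewrite (_ : sg e * (bz K e (m - a) * sg (m - a)) = bz K e (m - a) * sg (a - m + e)).
    by rewrite mulrBr; congr (_ - _); rewrite mulrC.
  rewrite mulrCA; congr (_ * _); rewrite -sgD -sgN.
  have -> : a - m + e = - (e + (m - a)) + (e + e) by lia.
  by rewrite sgD (sgD e e) sg_sq mulr1.
rewrite isum_exchange; last first.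
  exists (absz N + absz (s - N)%R + absz (- e - 1)%R)%N => a i H.
  have [i0|i0] := ltP i 0; first by rewrite bz_lt0 ?mul0r ?scale0r.
  have [ie|ie] := ltP (- e - 1) i.
    by rewrite [bz K a _]bz_lt0 ?mulr0 ?scale0r //; lia.
  by rewrite GN ?scaler0 //; lia.
apply: eq_isum => i; rewrite /J2 -isumZ; last by apply: J2_fin; exists N.
apply: eq_isum => a; rewrite scalerA; congr (_ *: G _ _); rewrite /s; lia.
Qed.

(** At a fixed power of x0 each delta function on the left is a power of x1 - x2, expanded one way
    for A and the other way for B. Once k factors are split off, both act on the same element of
    V((x1, x2)) and [delta_diff] applies. *)
Lemma expand_jacobi A B k N M : (forall m n, n < N -> A m n = 0) ->
  (forall m n, m < M -> B m n = 0) ->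
  iter k (@d2 K V) A = iter k (@d2 K V) B ->
  lower_truncated2 (iter k (@d2 K V) A) ->
  fmul3 (@delta3 K 1) (fun l m n => cst_series (A m n) l)
  - fmul3 (fun l m n => @delta3 K (-1) l n m) (fun l m n => cst_series (B m n) l)
  = fmul3 (fun l m n => @delta3 K 1 n m l)
      (fun l m n => cst_series (J2 (l + k%:Z) (iter k (@d2 K V) A) n) m).
Proof.
move=> AN BM AB tG; apply/funext => l; apply/funext => m; apply/funext => n.
(* The coefficient of x0^l in x0^-1 delta((x1 - x2) / x0) is (x1 - x2)^e. *)
pose e := - l - 1.
transitivity (plc (-1) e A m n - sg e *: plc (-1) e (flip B) n m).
  rewrite !fctE; congr (_ - _).
    rewrite /fmul3 (@fs_inj _ _ (fun j => (l, e - j, j))) => [|i j []//|[[i j] j'] h].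
      apply: eq_isum => j; rewrite /delta3 /= exp1rz mul1r /pow_lin subrK eqxx /=.
      rewrite /cst_series subrr eqxx; case: ifP => j0; last first.
        by rewrite bz_lt0 ?mul0r ?scale0r //; lia.
      by rewrite bzE //; congr (_ *: A _ _); lia.
    rewrite /delta3 /pow_lin /cst_series /=; case: ifP => [/andP[/eqP jj' _]|_]; last first.
      by rewrite mulr0 scale0r.
    case: eqP => [il|_]; last by rewrite scaler0.
    have := h j'; rewrite (_ : (l, e - j', j') = (i, j, j')) ?eqxx //.
    by congr (_, _, _); rewrite /e; lia.
  rewrite /fmul3 (@fs_inj _ _ (fun j => (l, j, e - j))) => [|i j []//|[[i j] j'] h].
    rewrite /plc -isumZ; last first.
      apply: (@fin_le _ _ 0 (m - M)) => j /orP[?|?].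
        by rewrite bz_lt0 ?mul0r ?scale0r.
      by rewrite /flip BM ?scaler0 //; lia.
    apply: eq_isum => j; rewrite /delta3 /= sgE /pow_lin subrK eqxx /=.
    rewrite /cst_series subrr eqxx scalerA.
    case: ifP => j0; last by rewrite bz_lt0 ?mul0r ?mulr0 ?scale0r //; lia.
    rewrite bzE // (_ : l + 1 = - e) /flip ?sgN; last by rewrite /e; lia.
    by congr (_ *: B _ _); lia.
  rewrite /delta3 /pow_lin /cst_series /=; case: ifP => [/andP[/eqP jj' _]|_]; last first.
    by rewrite mulr0 scale0r.
  case: eqP => [il|_]; last by rewrite scaler0.
  have := h j; rewrite (_ : (l, j, e - j) = (i, j, j')) ?eqxx //.
  by congr (_, _, _); rewrite /e; lia.
(* Of the e factors x1 - x2, k are absorbed into A and B, where they produce the common truncated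
   series. *)
pose e' := e - k%:Z.
have eE : e = e' + k%:Z by rewrite /e' subrK.
rewrite {1}eE (plc_iter_d2 _ _ AN).
have -> : plc (-1) e (flip B) n m = sg k *: plc (-1) e' (flip (iter k (@d2 K V) A)) n m.
  rewrite {1}eE (@plc_iter_d2 _ _ _ M) => [|i j]; last exact: BM.
  rewrite AB /plc -isumZ.
    apply: eq_isum => j; rewrite iter_d2_flip /flip !scalerA; congr (_ *: _); exact: mulrC.
  have [P GP] := tG; apply: (@fin_le _ _ (P - n + e') (m - P)) => j H.
  by rewrite /flip -AB GP ?scaler0 //; lia.
rewrite scalerA {1}eE sgD -mulrA sg_sq mulr1 delta_diff //.
rewrite /fmul3 (@fs_inj _ _ (fun i => (i, m, - 1 - m - i))) => [|i j []//|[[i j] j'] h].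
  apply: eq_isum => i; rewrite /delta3 /= exp1rz mul1r /pow_lin.
  rewrite (_ : (m + i == _) = true); last by lia.
  rewrite /cst_series subrr eqxx; case: ifP => j0; last first.
    by rewrite bz_lt0 ?mul0r ?scale0r //; lia.
  rewrite -bzE // (_ : - (- 1 - m - i) - 1 = m + i); last by lia.
  rewrite (_ : l - i + k%:Z = - e' - 1 - i); last by rewrite /e' /e; lia.
  by rewrite (_ : n - (- 1 - m - i) = n + 1 + m + i) //; lia.
rewrite /delta3 /pow_lin /cst_series /=; case: ifP => [/andP[/eqP jj' _]|_]; last first.
  by rewrite mulr0 scale0r.
case: eqP => [il|_]; last by rewrite scaler0.
have := h i; rewrite (_ : (i, m, - 1 - m - i) = (i, j, j')) ?eqxx //.
by congr (_, _, _); lia.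
Qed.

End Expansions.

Lemma uniform_bound (R : int -> int -> Prop) (lo hi : int) :
  (forall a, exists N : int, forall z, z < N -> R a z) ->
  exists N : int, forall a, lo <= a <= hi -> forall z, z < N -> R a z.
Proof.
move=> H; suff [N HN] : exists N : int, forall a, lo <= a < lo + (absz (hi - lo)).+1%:Z ->
    forall z, z < N -> R a z.
  by exists N => a alh; apply: HN; lia.
elim: (absz _).+1 => [|d [N HN]]; first by exists 0 => a; lia.
have [M HM] := H (lo + d%:Z); exists (Num.min N M) => a al z zN.
have [ad|ad] := eqVneq a (lo + d%:Z); first by rewrite ad; apply: HM; lia.
by apply: HN; lia.
Qed.

Lemma fin2_rows (M : zmodType) (g : int -> int -> M) :
  (exists B : nat, forall i j : int, (B < absz i)%N -> g i j = 0) ->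
  (forall i, fin (g i)) -> fin2 g.
Proof.
move=> [B gB] fg.
have [|N HN] := @uniform_bound (fun i z => forall j, z = - Posz (absz j) -> g i j = 0)
    (- B%:Z) B%:Z.
  move=> i; have [N gN] := fg i; exists (- N%:Z) => z zN j zj; apply: gN; lia.
exists (maxn B (absz N).+1) => i j /orP[iB|jN]; first by apply: gB; lia.
have [iB|iB] := ltnP B (absz i); first exact: gB.
by apply: (HN i _ (- Posz (absz j))); lia.
Qed.

(** The exponents at which the m-th term of [J i p] evaluates its argument. *)
Definition insp i p m (e : nat -> int) := ins i m (e i - m + p) e.

Lemma sub_insp i j a p m e : j != i ->
  sub j a (insp i p m e) = insp i p m (sub (fuse i j) a e).
Proof.
move=> ji; apply/funext => l; rewrite /insp /sub /ins /fuse.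
by case: (leqP j i) => ?; do ?case: ifP => ?; lia.
Qed.

Lemma sub_ins_fst i b m n e : sub i b (ins i m n e) = ins i (m - b) n e.
Proof. by apply/funext => l; rewrite /sub /ins; do ?case: ifP => ?; lia. Qed.

Lemma sub_ins_gt i j b m n e : (i < j)%N ->
  sub j.+1 b (ins i m n e) = ins i m n (sub j b e).
Proof.
by move=> ji; apply/funext => l; rewrite /sub /ins; do ?case: ifP => ?; lia.
Qed.

Lemma ins_sub i a m n e : ins i m n (sub i a e) = ins i m n e.
Proof. by apply/funext => l; rewrite /sub /ins; do ?case: ifP => ?; lia. Qed.

Lemma sub_add i a b e : sub i a (sub i b e) = sub i (a + b) e.
Proof. by apply/funext => l; rewrite /sub; do ?case: ifP => ?; lia. Qed.

Lemma sub0 i e : sub i 0 e = e.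
Proof. by apply/funext => l; rewrite /sub; do ?case: ifP => ?; lia. Qed.

(** * Multiplication by series in two variables *)

Section Multiplication.
Variables (F : fieldType) (charF : [pchar F] =i pred0).
Variable V : lmodType (laurent F).
Local Notation L := (laurent F).
Local Notation L3 := (laurent (laurent L)).
Implicit Types (X Y : (nat -> int) -> V) (f g : L3) (h : laurent L).

Let chL := charL charF.

(* Multiplication by [f(x_i, x_j)], for [f] in [F((t))((x_j))((x_i))] *)
Definition FM f i j X : (nat -> int) -> V :=
  fun e => isum (fun a => SC (f a) j X (sub i a e)).

(* Ensures that the sums defining [FM f i j X] are finite. *)
Definition okf i j X := finl j X /\
  forall e, exists N : int, forall a b, N < a -> X (sub i a (sub j b e)) = 0.

Lemma SC0 j X e : SC (0 : laurent L) j X e = 0.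
Proof. by apply: isum0 => m; rewrite /= if_same scale0r. Qed.

Lemma SC_D h j X Y : finl j X -> finl j Y -> SC h j (X + Y) = SC h j X + SC h j Y.
Proof.
move=> lX lY; apply/funext => e; rewrite -[RHS]/(SC h j X e + SC h j Y e) /SC -isumD;
  try exact: SC_fin.
by apply: eq_isum => m; rewrite fctE scalerDr.
Qed.

Lemma SC_Dl (h h' : laurent L) j X e : finl j X ->
  SC (h + h') j X e = SC h j X e + SC h' j X e.
Proof.
move=> lX; rewrite /SC -isumD; try exact: SC_fin.
by apply: eq_isum => m; rewrite -scalerDl.
Qed.

Lemma SC_SC (h h' : laurent L) j X e : finl j X ->
  SC h j (SC h' j X) e = SC (h * h') j X e.
Proof.
move=> lX; have [N XN] := lX e.
have [P hP] := lcoef_truncated h; have [Q hQ] := lcoef_truncated h'.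
transitivity (isum (fun a => isum (fun b => (h a * h' (b - a)) *: X (sub j b e)))).
  apply: eq_isum => a; rewrite -isumZ; last exact: SC_fin.
  rewrite (@isum_shift _ _ (- a)); apply: eq_isum => b.
  by rewrite scalerA sub_add subrK.
rewrite isum_exchange.
  apply: eq_isum => b; rewrite isum_scalel //.
  apply: (@fin_le _ _ P (b - Q)) => a /orP[/hP->|?]; first by rewrite mul0r.
  by rewrite hQ ?mulr0 //; lia.
exists (absz N + absz P + absz Q)%N => a b H.
have [/hP->|Pa] := ltP a P; first by rewrite mul0r scale0r.
have [ba|ba] := ltP (b - a) Q; first by rewrite hQ ?mulr0 ?scale0r.
by rewrite XN ?scaler0 //; lia.
Qed.

Lemma FM_fin f i j X e : okf i j X -> fin (fun a => SC (f a) j X (sub i a e)).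
Proof.
move=> oX; have [_ /(_ e)[N XN]] := oX; have [P fP] := lcoef_truncated f.
apply: (@fin_le _ _ P N) => a /orP[/fP->|Na]; first exact: SC0.
by apply: isum0 => m; rewrite sub_sub XN ?scaler0.
Qed.

Lemma okfD i j X Y : okf i j X -> okf i j Y -> okf i j (X + Y).
Proof.
move=> [fX oX] [fY oY]; split=> e.
  have [N XN] := fX e; have [M YM] := fY e.
  by exists (Num.max N M) => m NM; rewrite fctE XN ?YM ?addr0 //; lia.
have [N XN] := oX e; have [M YM] := oY e.
by exists (Num.max N M) => a b NM; rewrite fctE XN ?YM ?addr0 //; lia.
Qed.

Lemma okfX i j k X : okf i j X -> okf i j (Xm k X).
Proof.
move=> [fX oX]; split=> e.
  by have [N XN] := fX (dec k e); exists N => m /XN; rewrite /Xm sub_dec.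
by have [N XN] := oX (dec k e); exists N => a b /(XN a b); rewrite /Xm !sub_dec.
Qed.

Lemma okfN i j X : okf i j X -> okf i j (- X).
Proof.
move=> [fX oX]; split=> e.
  by have [N XN] := fX e; exists N => m /XN; rewrite fctE => ->; rewrite oppr0.
by have [N XN] := oX e; exists N => a b /(XN a b); rewrite fctE => ->; rewrite oppr0.
Qed.

Lemma okf_dl i j k l X : okf i j X -> okf i j (dl k l X).
Proof. by move=> oX; rewrite dlE; apply: okfD; [|apply: okfN]; apply: okfX. Qed.

Lemma FM_D f i j X Y : okf i j X -> okf i j Y ->
  FM f i j (X + Y) = FM f i j X + FM f i j Y.
Proof.
move=> oX oY; apply/funext => e; rewrite -[RHS]/(FM f i j X e + FM f i j Y e) /FM -isumD;
  try exact: FM_fin.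
by apply: eq_isum => a; rewrite SC_D //; [case: oX | case: oY].
Qed.

Lemma FM_N f i j X : okf i j X -> FM f i j (- X) = - FM f i j X.
Proof.
move=> oX; apply/funext => e; rewrite -[RHS]/(- FM f i j X e) /FM -isumN; last exact: FM_fin.
apply: eq_isum => a; rewrite /SC -isumN; last by apply: SC_fin; case: oX.
by apply: eq_isum => b; rewrite fctE scalerN.
Qed.

Lemma FM_X f i j k X : FM f i j (Xm k X) = Xm k (FM f i j X).
Proof.
apply/funext => e; rewrite /FM /Xm /SC; apply: eq_isum => a.
by apply: eq_isum => b; rewrite !sub_dec.
Qed.

Lemma FM_dl f i j k l X : okf i j X -> FM f i j (dl k l X) = dl k l (FM f i j X).
Proof.
move=> oX; rewrite !dlE FM_D ?FM_N ?FM_X //; try exact: okfX.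
exact/okfN/okfX.
Qed.

Lemma okf_mulL i j t X : okf i j X -> okf i j (mulL t X).
Proof. by move=> oX; elim: t => //= -[k l] t; apply: okf_dl. Qed.

Lemma FM_mulL f i j t X : okf i j X -> FM f i j (mulL t X) = mulL t (FM f i j X).
Proof.
by move=> oX; elim: t => //= -[k l] t IH; rewrite FM_dl ?IH //; apply: okf_mulL.
Qed.

Lemma FM_sum (I : Type) (r : seq I) (G : I -> (nat -> int) -> V) f i j :
  (forall k, okf i j (G k)) ->
  FM f i j (\sum_(k <- r) G k) = \sum_(k <- r) FM f i j (G k).
Proof.
move=> oG; suff [_ //] : okf i j (\sum_(k <- r) G k) /\
  FM f i j (\sum_(k <- r) G k) = \sum_(k <- r) FM f i j (G k).
elim: r => [|k r [o1 e1]].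
  rewrite !big_nil; split; first by split=> e; exists 0.
  apply/funext => e; apply: isum0 => a; apply: isum0 => b.
  exact: scaler0.
rewrite !big_cons; split; first exact: okfD.
by rewrite FM_D ?e1.
Qed.

Lemma FM_FM f g i j X : i != j -> okf i j X ->
  FM f i j (FM g i j X) = FM (f * g) i j X.
Proof.
move=> ij oX; have [lX uX] := oX; apply/funext => e.
have [P fP] := lcoef_truncated f; have [Q gQ] := lcoef_truncated g.
(* A factor h(x_j) is carried inside the sum over powers of x_i, where [SC_SC] merges it with the
   coefficient g c. *)
have H h e1 : SC h j (FM g i j X) e1 =
    isum (fun c => SC (h * g c) j X (sub i c e1)).
  have [R hR] := lcoef_truncated h.
  have [N XN] := uX e1.
  have SN c b : N < c -> SC (g c) j X (sub i c (sub j b e1)) = 0.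
    by move=> Nc; apply: isum0 => m; rewrite sub_sub sub_add XN ?scaler0.
  transitivity (isum (fun c => isum (fun b =>
      h b *: SC (g c) j X (sub j b (sub i c e1))))); last first.
    by apply: eq_isum => c; rewrite -SC_SC.
  rewrite isum_exchange.
    apply: eq_isum => b; rewrite -isumZ; last exact: FM_fin.
    by apply: eq_isum => c; rewrite sub_sub.
  apply: fin2_rows => [|c].
    exists (absz N + absz Q)%N => c b H.
    have [/gQ->|Qc] := ltP c Q; first by rewrite SC0 scaler0.
    by rewrite -sub_sub SN ?scaler0 //; lia.
  have [M XM] := lX (sub i c e1); have [S gS] := lcoef_truncated (g c).
  apply: (@fin_le _ _ R (M - S)) => b /orP[/hR->|bM]; first by rewrite scale0r.
  rewrite (_ : SC _ _ _ _ = 0) ?scaler0 //; apply: isum0 => m.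
  have [/gS->|Sm] := ltP m S; first by rewrite scale0r.
  by rewrite sub_add XM ?scaler0 //; lia.
transitivity (isum (fun a => isum (fun c => SC (f a * g (c - a)) j X (sub i c e)))).
  apply: eq_isum => a; rewrite H (@isum_shift _ _ (- a)).
  by apply: eq_isum => c; rewrite sub_add subrK.
have [N XN] := uX e.
rewrite isum_exchange; last first.
  exists (absz N + absz P + absz Q)%N => a c Hac.
  have [/fP->|Pa] := ltP a P; first by rewrite mul0r SC0.
  have [ca|ca] := ltP (c - a) Q; first by rewrite gQ // mulr0 SC0.
  by apply: isum0 => m; rewrite sub_sub XN ?scaler0 //; lia.
apply: eq_isum => c.
rewrite (_ : (f * g) c = isum (fun a => f a * g (c - a))) //.
rewrite (@isum_raddf _ _ (fun h => SC h j X (sub i c e))) ?SC0 //.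
  by move=> h h'; rewrite SC_Dl.
apply: (@fin_le _ _ P (c - Q)) => a /orP[/fP->|?]; first by rewrite mul0r.
by rewrite gQ ?mulr0 //; lia.
Qed.

Lemma FM_1 i j X : FM 1 i j X = X.
Proof.
apply/funext => e; rewrite /FM (@isum1 _ _ 0) => [|a a0].
  rewrite sub0 /SC (@isum1 _ _ 0) ?sub0 ?scale1r // => b b0.
  by rewrite /= (negbTE b0) scale0r.
by rewrite (_ : (1 : L3) a = 0) ?SC0 //= (negbTE a0).
Qed.

Lemma lin_subproof l f : lower_truncated (fun a => ldp l (f a)).
Proof.
have [N fN] := lcoef_truncated f; exists N => a /fN->.
by apply: laurentP => b /=; rewrite !if_same mulr0.
Qed.

(* The divided powers of the derivatives of [f] in its inner variable *)
Definition lin l f : L3 := Laurent (lin_subproof l f).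

(* [X] lies in [V((x1, x2))((x0))]. *)
Definition laurent12_0 X := (exists N : int, forall e, e 0%N < N -> X e = 0) /\
  forall c : int, exists N : int, forall e, e 0%N = c ->
    (e 1%N < N) || (e 2%N < N) -> X e = 0.

Lemma laurent12_0_okf j X : (j == 1%N) || (j == 2%N) -> laurent12_0 X -> okf 0 j X.
Proof.
move=> j12 [[N XN] X12]; have j0 : j != 0%N by lia.
split=> e; last first.
  by exists (e 0%N - N) => a b aN; apply: XN; rewrite sub_same sub_ne 1?eq_sym //; lia.
have [M XM] := X12 (e 0%N); exists (e j - M) => m mM; apply: XM.
  by rewrite sub_ne 1?eq_sym.
by case/orP: j12 mM => /eqP-> mM; rewrite sub_same; lia.
Qed.

Lemma laurent12_0_fusable X : laurent12_0 X -> fusable 1 X.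
Proof.
move=> [_ X12] e; have [N XN] := X12 (e 0%N); exists N => m n mn.
by apply: XN.
Qed.

Lemma laurent12_0_SC2 h X : laurent12_0 X -> laurent12_0 (SC h 2 X).
Proof.
move=> [[N XN] X12]; have [P hP] := lcoef_truncated h; split.
  by exists N => e eN; apply: isum0 => m; rewrite XN ?scaler0 // sub_ne.
move=> c; have [M XM] := X12 c; exists (Num.min M (M + P)) => e ec eM.
apply: isum0 => m; have [/hP->|Pm] := ltP m P; first by rewrite scale0r.
rewrite XM ?scaler0 //.
by rewrite sub_ne // sub_same; lia.
Qed.

Lemma laurent12_0_SC1 h X : laurent12_0 X -> laurent12_0 (SC h 1 X).
Proof.
move=> [[N XN] X12]; have [P hP] := lcoef_truncated h; split.
  by exists N => e eN; apply: isum0 => m; rewrite XN ?scaler0 // sub_ne.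
move=> c; have [M XM] := X12 c; exists (Num.min M (M + P)) => e ec eM.
apply: isum0 => m; have [/hP->|Pm] := ltP m P; first by rewrite scale0r.
rewrite XM ?scaler0 //.
by rewrite sub_same sub_ne //; lia.
Qed.

Lemma laurent12_0_FM j g X : (j == 1%N) || (j == 2%N) -> laurent12_0 X -> laurent12_0 (FM g 0 j X).
Proof.
move=> j12 cX; have [[N XN] _] := cX; have [P gP] := lcoef_truncated g.
have j0 : j != 0%N by case: j j12.
have cS a : laurent12_0 (SC (g a) j X).
  by case/orP: j12 => /eqP->; [apply: laurent12_0_SC1 | apply: laurent12_0_SC2].
have low a e : e 0%N - a < N -> SC (g a) j X (sub 0 a e) = 0.
  move=> aN; apply: isum0 => m.
  by rewrite XN ?scaler0 // sub_ne ?sub_same // eq_sym.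
split.
  exists (N + P) => e eN; apply: isum0 => a.
  by have [/gP->|Pa] := ltP a P; [rewrite SC0 | apply: low; lia].
(* At exponent c of x_0 only the powers a with P <= a <= c - N contribute; being finitely many,
   their individual bounds have a common one. *)
move=> c; have [|M HM] := @uniform_bound (fun a z => forall e, e 0%N = c ->
    (e 1%N = z) \/ (e 2%N = z) -> SC (g a) j X (sub 0 a e) = 0) P (c - N).
  move=> a; have [_ /(_ (c - a))[M HM]] := cS a.
  exists M => z zM e ec ez; apply: HM; first by rewrite sub_same ec.
  by rewrite !sub_ne //; apply/orP; case: ez => ->; [left | right].
exists M => e ec eM; apply: isum0 => a.
have [/gP->|Pa] := ltP a P; first by rewrite SC0.
have [aN|aN] := ltP (e 0%N - a) N; first exact: low.
case/orP: eM => eM.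
  by apply: (HM a _ (e 1%N)) => //; [lia | left].
by apply: (HM a _ (e 2%N)) => //; [lia | right].
Qed.

Lemma J_SC i j p h X e : fusable i X -> j != i ->
  fin2 (fun m b => h b *: X (sub j b (insp i p m e))) ->
  J i p (SC h j X) e = SC h (fuse i j) (J i p X) e.
Proof.
move=> lX ji f2.
transitivity (isum (fun m => isum (fun b =>
    bz L m p *: (h b *: X (sub j b (insp i p m e)))))).
  by apply: eq_isum => m; rewrite -isumZ //; apply: fin2_row f2.
rewrite isum_exchange.
  apply: eq_isum => b; rewrite -isumZ; last first.
    exact: (J2_fin p (sub (fuse i j) b e i) (lX (sub (fuse i j) b e))).
  apply: eq_isum => m; rewrite scalerA mulrC -scalerA sub_insp //.
have [N HN] := f2; exists N => m b mb; rewrite HN ?scaler0 //.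
Qed.

Lemma J1_SC2 p h X e : laurent12_0 X -> J 1 p (SC h 2 X) e = SC h 1 (J 1 p X) e.
Proof.
move=> cX; have lX := laurent12_0_fusable cX; rewrite J_SC //.
have [N XN] := lX e; have [P hP] := lcoef_truncated h.
exists (absz N + absz N + absz P + absz (e 1%N + p)%R)%N => m b mb.
have [/hP->|Pb] := ltP b P; first by rewrite scale0r.
rewrite sub_insp // /insp (_ : fuse 1 2 = 1%N) // ins_sub sub_same.
by rewrite XN ?scaler0 //; lia.
Qed.

Lemma J1_fin2 p e X (Z : int -> (nat -> int) -> V) (P : int) :
  (exists N : int, forall a e, e 0%N < N -> Z a e = 0) ->
  (forall a, a < P -> forall e, Z a e = 0) ->
  (forall a, fusable 1 (Z a)) ->
  fin2 (fun a m => bz L m p *: Z a (insp 1 p m (sub 0 a e))).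
Proof.
move=> [N ZN] ZP lZ; apply: fin2_rows => [|a].
  exists (absz P + absz (e 0%N - N)%R)%N => a m aN.
  have [/ZP->|Pa] := ltP a P; first by rewrite scaler0.
  by rewrite ZN ?scaler0 // /insp ins_lt // sub_same; lia.
exact: (J2_fin p (sub 0 a e 1%N) (lZ a (sub 0 a e))).
Qed.

(** The fusion x_1 = x + x0, x_2 = x does not displace x_2, so no derivatives of g appear. *)
Lemma J1_FM02 p g X : laurent12_0 X -> J 1 p (FM g 0 2 X) = FM g 0 1 (J 1 p X).
Proof.
move=> cX; apply/funext => e; have [[N XN] _] := cX.
have [P gP] := lcoef_truncated g.
transitivity (isum (fun m => isum (fun a =>
    bz L m p *: SC (g a) 2 X (insp 1 p m (sub 0 a e))))).
  apply: eq_isum => m; rewrite -isumZ; last first.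
    exact/FM_fin/laurent12_0_okf.
  by apply: eq_isum => a; rewrite sub_insp.
rewrite isum_exchange; last first.
  apply: fin2_swap; apply: (@J1_fin2 p e X (fun a => SC (g a) 2 X) P).
  - exists N => a e' e'N; apply: isum0 => b.
    by rewrite XN ?scaler0 // sub_ne.
  - by move=> a /gP-> e'; rewrite SC0.
  - by move=> a; apply/laurent12_0_fusable/laurent12_0_SC2.
by apply: eq_isum => a; rewrite -J1_SC2.
Qed.

(** Here the inner variable of f is the displaced one, and f is expanded by Taylor's formula in it;
    the outer variable is untouched. *)
Lemma J1_FM01 p f X (N : nat) : p < N%:Z -> laurent12_0 X ->
  J 1 p (FM f 0 1 X) = \sum_(l < N) FM (lin l f) 0 1 (J 1 (p - (l : nat)%:Z) X).
Proof.
move=> pN cX; apply/funext => e; have [[M XM] X12] := cX.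
have lX := laurent12_0_fusable cX; have [P fP] := lcoef_truncated f.
transitivity (isum (fun m => isum (fun a =>
    bz L m p *: SC (f a) 1 X (insp 1 p m (sub 0 a e))))).
  apply: eq_isum => m; rewrite -isumZ; last first.
    exact/FM_fin/laurent12_0_okf.
  by apply: eq_isum => a; rewrite sub_insp.
rewrite isum_exchange; last first.
  apply: fin2_swap; apply: (@J1_fin2 p e X (fun a => SC (f a) 1 X) P).
  - exists M => a e' e'N; apply: isum0 => b.
    by rewrite XM ?scaler0 // sub_ne.
  - by move=> a /fP-> e'; rewrite SC0.
  - by move=> a; apply/laurent12_0_fusable/laurent12_0_SC1.
transitivity (isum (fun a => \sum_(l < N)
    SC (ldp l (f a)) 1 (J 1 (p - (l : nat)%:Z) X) (sub 0 a e))).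
  apply: eq_isum => a; pose G m n := X (ins 1 m n (sub 0 a e)).
  transitivity (J2 p (xmul (f a) G) (e 1%N)).
    apply: eq_isum => m; congr (_ *: _); apply: eq_isum => b.
    by rewrite /G /insp sub_ins_fst sub_ne.
  rewrite (J2_xmul chL _ _ pN); last exact: lX.
  apply: eq_bigr => l _; apply: eq_isum => b; congr (_ *: _).
  rewrite /J sub_same sub_ne //; apply: eq_J2 => m n.
  by rewrite ins_sub.
rewrite isum_fsum => [|l].
  by rewrite fct_sumE.
apply: (@fin_le _ _ P (e 0%N - M)) => a /orP[aP|aM].
  by rewrite (fP _ aP); apply: isum0 => b; rewrite /= if_same mulr0 scale0r.
apply: isum0 => b; rewrite (_ : J _ _ _ _ = 0) ?scaler0 //.
apply: isum0 => m; rewrite XM ?scaler0 // ins_lt // sub_ne // sub_same; lia.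
Qed.

Lemma okf_fin2 f i j X e : okf i j X ->
  fin2 (fun a b => f a b *: X (sub j b (sub i a e))).
Proof.
move=> [lX /(_ e)[N XN]]; have [P fP] := lcoef_truncated f.
apply: fin2_rows => [|a]; last exact: SC_fin.
exists (absz N + absz P)%N => a b aN.
have [/fP->|Pa] := ltP a P; first by rewrite /= if_same scale0r.
by rewrite -sub_sub XN ?scaler0 //; lia.
Qed.

Lemma finl_SC h j X : finl j X -> finl j (SC h j X).
Proof.
move=> lX e; have [N XN] := lX e; have [P hP] := lcoef_truncated h.
exists (N - P) => m mN; apply: isum0 => b.
have [/hP->|Pb] := ltP b P; first by rewrite scale0r.
by rewrite sub_add XN ?scaler0 //; lia.
Qed.

(* [X] lies in [V((x2))((x0, x1))]. *)
Definition laurent2_01 X := (exists N : int, forall e,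
  (e 0%N < N) || (e 1%N < N) -> X e = 0) /\ finl 2 X.

Lemma laurent2_01_okf i X : (i == 0%N) || (i == 1%N) -> laurent2_01 X -> okf i 2 X.
Proof.
move=> i01 [[N XN] X2]; split=> // e; exists (e i - N) => a b aN; apply: XN.
by case/orP: i01 aN => /eqP-> aN; rewrite sub_same (@sub_ne 2) //; lia.
Qed.

Lemma laurent2_01_fusable X : laurent2_01 X -> fusable 0 X.
Proof. by move=> [[N XN] _] e; exists N => m n mn; apply: XN. Qed.

Lemma finl_FM i j f X : i != j -> okf i j X -> finl j (FM f i j X).
Proof.
move=> ij [lX uX] e; have [P fP] := lcoef_truncated f; have [N XN] := uX e.
have [|M HM] := @uniform_bound (fun a z => SC (f a) j X (sub i a (sub j (- z) e)) = 0) P N.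
  move=> a; have [M HM] := finl_SC (f a) lX (sub i a e).
  by exists (- M) => z zM; rewrite sub_sub; apply: HM; lia.
exists (- M) => m mM; apply: isum0 => a.
have [/fP->|Pa] := ltP a P; first by rewrite SC0.
have [Na|Na] := ltP N a; last first.
  by have := HM a _ (- m); rewrite opprK; apply; lia.
by apply: isum0 => b; rewrite sub_sub sub_add XN ?scaler0.
Qed.

Lemma okf_FM i j f X : i != j -> okf i j X -> okf i j (FM f i j X).
Proof.
move=> ij oX; split; first exact: finl_FM.
have [_ uX] := oX; move=> e; have [P fP] := lcoef_truncated f.
have [N XN] := uX e; exists (N - P) => a b aN; apply: isum0 => c.
have [/fP->|Pc] := ltP c P; first by rewrite SC0.
apply: isum0 => d; rewrite (sub_sub j d) (sub_sub i c) sub_add.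
rewrite (_ : sub j d _ = sub i (c + a) (sub j (d + b) e)).
  by rewrite XN ?scaler0 //; lia.
by apply/funext => l; rewrite /sub; do ?case: ifP => ?; lia.
Qed.

Lemma laurent2_01_FM i g X : (i == 0%N) || (i == 1%N) -> laurent2_01 X ->
  laurent2_01 (FM g i 2 X).
Proof.
move=> i01 cX; have [[N XN] X2] := cX; have [P gP] := lcoef_truncated g.
have i2 : i != 2%N by case/orP: i01 => /eqP->.
have oX : okf i 2 X.
  exact: laurent2_01_okf.
split; last exact: finl_FM.
exists (Num.min N (N + P)) => e eN; apply: isum0 => a.
have [/gP->|Pa] := ltP a P; first by rewrite SC0.
apply: isum0 => b; rewrite XN ?scaler0 //.
case/orP: i01 => /eqP->; rewrite 2?[sub 2 _ _ _]sub_ne // sub_same sub_ne //; lia.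
Qed.

Lemma J0_SC2 p h X e : laurent2_01 X -> J 0 p (SC h 2 X) e = SC h 1 (J 0 p X) e.
Proof.
move=> cX; have lX := laurent2_01_fusable cX; rewrite J_SC //.
have [[N XN] X2] := cX; apply: fin2_rows => [|m].
  exists (absz N + absz N + absz (e 0%N + p)%R)%N => m b mN.
  rewrite XN ?scaler0 // !sub_ne // /insp ins_fst ins_snd; lia.
exact: SC_fin.
Qed.

Lemma J0_FM12 p f X : laurent2_01 X -> J 0 p (FM f 1 2 X) = FM f 0 1 (J 0 p X).
Proof.
move=> cX; apply/funext => e; have [[N XN] X2] := cX.
have [P fP] := lcoef_truncated f.
transitivity (isum (fun m => isum (fun a =>
    bz L m p *: SC (f a) 2 X (insp 0 p m (sub 0 a e))))).
  apply: eq_isum => m; rewrite -isumZ; last first.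
    exact/FM_fin/laurent2_01_okf.
  by apply: eq_isum => a; rewrite sub_insp.
rewrite isum_exchange; last first.
  exists (absz N + absz N + absz P + absz (e 0%N + p)%R)%N => m a H.
  have [/fP->|Pa] := ltP a P; first by rewrite SC0 scaler0.
  rewrite (_ : SC _ _ _ _ = 0) ?scaler0 //; apply: isum0 => b.
  rewrite XN ?scaler0 // !sub_ne // /insp ins_fst ins_snd sub_same; lia.
by apply: eq_isum => a; rewrite -J0_SC2.
Qed.

Lemma J0_okf p X : laurent2_01 X -> okf 0 1 (J 0 p X).
Proof.
move=> [[N XN] X2]; split=> e.
  have [|M HM] := @uniform_bound (fun m z => X (insp 0 p m (sub 1 (- z) e)) = 0)
      N (e 0%N + p - N).
    move=> m; have [M HM] := X2 (insp 0 p m e); exists (- M) => z zM.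
    by rewrite -(@sub_insp 0 2) //; apply: HM; lia.
  exists (- M) => b bM; apply: isum0 => m.
  have [mN|mN] := boolP (N <= m <= e 0%N + p - N).
    by have := HM m mN (- b); rewrite opprK /insp => ->; rewrite ?scaler0 //; lia.
  by rewrite XN ?scaler0 // ins_fst ins_snd sub_ne //; lia.
exists (e 0%N - (N + N - p)) => a b aN; apply: isum0 => m.
by rewrite XN ?scaler0 // ins_fst ins_snd sub_same sub_ne //; lia.
Qed.

Lemma col_subproof g b : lower_truncated (fun a => g a b).
Proof.
have [N gN] := lcoef_truncated g; exists N => a /gN->.
by rewrite /= if_same.
Qed.

(** The coefficient of the b-th power of the inner variable, as a series in the outer one. Taylor
    expansion in the outer variable is done column by column. *)
Definition col g b : laurent L := Laurent (col_subproof g b).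

Lemma ldp_col l g b a : ldp l (col g b) a = ldp l g a b.
Proof.
change (bz L (a + l%:Z) l * g (a + l%:Z) b =
  (bz (laurent L) (a + l%:Z) l * g (a + l%:Z)) b).
rewrite (bz_laurent chL).
exact/esym/(laurent_constM _ (g (a + l%:Z))).
Qed.

Lemma J0_FM02 p g X (N : nat) : p < N%:Z -> laurent2_01 X ->
  J 0 p (FM g 0 2 X) = \sum_(l < N) FM (ldp l g) 0 1 (J 0 (p - (l : nat)%:Z) X).
Proof.
move=> pN cX; apply/funext => e; have [[M XM] X2] := cX.
have lX := laurent2_01_fusable cX; have [P gP] := lcoef_truncated g.
have oX : okf 0 2 X by exact: laurent2_01_okf.
pose Z m a b := g a b *: X (sub 2 b (sub 0 a (insp 0 p m e))).
have Z2 m : fin2 (Z m) by exact: okf_fin2.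
(* Powers b of x_2 are put outside and powers a of x_0 inside, so that for each b the fusion meets
   multiplication by the single series [col g b]. *)
transitivity (isum (fun m => isum (fun b => bz L m p *: isum (fun a => Z m a b)))).
  apply: eq_isum => m; rewrite isumZ; last exact/fin2_sum/fin2_swap.
  by rewrite -isum_exchange.
rewrite isum_exchange; last first.
  apply: fin2_rows => [|m].
    exists (absz (P + M)%R + absz (e 0%N + p - M)%R)%N => m b mB.
    rewrite isum0 ?scaler0 // => a.
    have [aP|Pa] := ltP a P; first by rewrite /Z (gP _ aP) /= if_same scale0r.
    rewrite /Z XM ?scaler0 // (@sub_ne 2 _ _ 0) // (@sub_ne 2 _ _ 1) // sub_same.
    by rewrite sub_ne // /insp ins_fst ins_snd; lia.
  have [B HB] := fin2_sum (fin2_swap (Z2 m)); exists B => b bB.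
  by rewrite HB ?scaler0.
pose G b m n := X (ins 0 m n (sub 1 b e)).
have tG b : lower_truncated2 (G b) by exact: lX.
have JG b q l : J2 (p - l%:Z) (G b) (e 0%N - q) =
    J 0 (p - l%:Z) X (sub 1 b (sub 0 q e)).
  rewrite sub_sub /J sub_same sub_ne //; apply: eq_J2 => m n.
  by rewrite ins_sub.
transitivity (isum (fun b => \sum_(l < N) isum (fun a =>
    ldp l g a b *: J 0 (p - (l : nat)%:Z) X (sub 1 b (sub 0 a e))))).
  apply: eq_isum => b; transitivity (J2 p (xmul (col g b) (G b)) (e 0%N)).
    apply: eq_isum => m; congr (_ *: _); apply: eq_isum => a.
    by rewrite /Z /insp sub_ins_fst sub_ins_gt.
  rewrite (J2_xmul chL _ _ pN) //.
  by apply: eq_bigr => l _; apply: eq_isum => a; rewrite ldp_col JG.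
have f2 l := okf_fin2 (ldp l g) e (J0_okf (p - l%:Z) cX).
rewrite isum_fsum => [|l]; last exact/fin2_sum/fin2_swap/f2.
by rewrite fct_sumE; apply: eq_bigr => l _; rewrite -isum_exchange.
Qed.

End Multiplication.

Lemma powserM (R : comNzRingType) (f g : powser R) n :
  (f * g) n = \sum_(i < n.+1) f i * g (n - i)%N.
Proof. by []. Qed.

Lemma powserD (R : zmodType) (f g : powser R) n : (f + g) n = f n + g n.
Proof. by []. Qed.

Lemma powserMn (R : zmodType) (f : powser R) m n : (f *+ m) n = f n *+ m.
Proof. by elim: m => // m IHm; rewrite !mulrS powserD IHm. Qed.

Lemma powser_sum (R : zmodType) (I : Type) (r : seq I) (f : I -> powser R) n :
  (\sum_(i <- r) f i) n = \sum_(i <- r) f i n.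
Proof. by elim/big_rec2: _ => // i x y _ <-. Qed.

Lemma laurent_sum (K : fieldType) (I : Type) (r : seq I) (f : I -> laurent K) n :
  (\sum_(i <- r) f i) n = \sum_(i <- r) f i n.
Proof. by elim/big_rec2: _ => [|i x y _ <-] //=; rewrite if_same. Qed.

Lemma laurentM (K : fieldType) (f g : laurent K) n :
  (f * g) n = isum (fun i => f i * g (n - i)).
Proof. by []. Qed.

Lemma laurent_fin (K : fieldType) (f g : laurent K) n :
  fin (fun i => f i * g (n - i)).
Proof.
have [P fP] := lcoef_truncated f; have [Q gQ] := lcoef_truncated g.
apply: (@fin_le _ _ P (n - Q)) => i /orP[/fP->|?]; first by rewrite mul0r.
by rewrite gQ ?mulr0 //; lia.
Qed.

Lemma lseriesM (K : fieldType) (s s' : nat -> K) :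
  lseries s * lseries s' = lseries (fun n => \sum_(i < n.+1) s i * s' (n - i)%N).
Proof.
apply: laurentP => n; rewrite laurentM; case: n => n; last first.
  apply: isum0 => -[i|i] /=; last by rewrite mul0r.
  by rewrite (_ : Negz n - i%:Z = Negz (n + i)) ?mulr0 //; lia.
rewrite (@isum_ord _ _ n.+1) => [|[i|i] /= H].
- apply: eq_bigr => i _ /=.
  by rewrite (_ : n%:Z - i%:Z = (n - i)%N%:Z) //; have := ltn_ord i; lia.
- by case E: (n%:Z - i%:Z) => [k|k]; [lia | rewrite mulr0].
by rewrite mul0r.
Qed.

Lemma lderivM (K : fieldType) (f g : laurent K) :
  lderiv (f * g) = lderiv f * g + f * lderiv g.
Proof.
apply: laurentP => n.
rewrite -[RHS]/((lderiv f * g) n + (f * lderiv g) n) !laurentM.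
rewrite [X in X + _](@isum_shift _ _ (- 1)) -isumD; last exact: laurent_fin.
  rewrite -[LHS]/((n + 1)%:~R * (f * g) (n + 1)) laurentM.
  rewrite (@isum_raddf _ _ ( *%R (n + 1)%:~R)) ?mulr0 //; last exact: laurent_fin.
    apply: eq_isum => i; rewrite /= subrK.
    rewrite (_ : n - (i - 1) = n + 1 - i); last by lia.
    rewrite (_ : n - i + 1 = n + 1 - i); last by lia.
    rewrite (_ : (n + 1)%:~R = i%:~R + (n + 1 - i)%:~R); last first.
      by rewrite -intrD; congr (_%:~R); lia.
    by move: (f i) (g _) => a b; ring.
  exact: mulrDr.
exact: (@fin_shift _ (fun i => lderiv f i * g (n - i)) _ (laurent_fin _ _ _)).
Qed.

(** * The series f(t + x1, t + x2) *)

Section Morphisms.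
Variables (F : fieldType) (charF : [pchar F] =i pred0).
Local Notation L := (laurent F).
Local Notation L3 := (laurent (laurent L)).
Local Notation P2 := (powser2 F).
Implicit Types g h p : P2.

Lemma incl_B : {morph @incl_t21 F : x y / x - y}.
Proof.
move=> x y; apply: laurentP => a; apply: laurentP => b; apply: laurentP => n.
case: a => a; [case: b => b; [case: n => n|]|] => //=.
- by rewrite subr0.
- by rewrite !if_same subr0.
by rewrite !if_same /= if_same subr0.
Qed.

Lemma incl_M : {morph @incl_t21 F : x y / x * y}.
Proof.
move=> x y; rewrite /incl_t21 lseriesM; congr lseries; apply/funext => a.
under eq_bigr do rewrite lseriesM.
apply: laurentP => b; rewrite laurent_sum; case: b => b; last by rewrite big1.
rewrite /=; under eq_bigr do under eq_bigr do rewrite lseriesM.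
apply: laurentP => n; rewrite laurent_sum; under eq_bigr do rewrite laurent_sum.
case: n => n; last by rewrite /= big1 // => i _; rewrite big1.
rewrite /= !powser_sum.
transitivity (\sum_(i < n.+1) \sum_(i0 < b.+1) \sum_(i1 < a.+1)
    x i i0 i1 * y (n - i)%N (b - i0)%N (a - i1)%N).
  apply: eq_bigr => i _; rewrite powserM powser_sum.
  by apply: eq_bigr => i0 _; rewrite powserM.
rewrite exchange_big [RHS]exchange_big /=; apply: eq_bigr => i0 _.
by rewrite exchange_big.
Qed.

Lemma incl_1 : @incl_t21 F 1 = 1.
Proof.
apply: laurentP => a; apply: laurentP => b; apply: laurentP => n.
case: a => [[|a]|a]; case: b => [[|b]|b]; case: n => [[|n]|n] //=;
  by rewrite ?if_same.
Qed.

HB.instance Definition _ := GRing.isZmodMorphism.Build (powser3 F) L3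
  (@incl_t21 F) incl_B.
HB.instance Definition _ := GRing.isMonoidMorphism.Build (powser3 F) L3
  (@incl_t21 F) (incl_1, incl_M).

Lemma incl_inj : injective (@incl_t21 F).
Proof.
move=> x y xy; apply: powserP => n; apply: powserP => b; apply: powserP => a.
by have := congr1 (fun f : L3 => f a b n) xy.
Qed.

Definition dsum g : P2 := dx1 g + dx2 g.

Lemma dx1D g h : dx1 (g + h) = dx1 g + dx1 h.
Proof. by apply: powserP => b; apply: powserP => a /=; rewrite mulrnDl. Qed.

Lemma dx2D g h : dx2 (g + h) = dx2 g + dx2 h.
Proof. by apply: powserP => b; apply: powserP => a /=; rewrite mulrnDl. Qed.

(** The Leibniz rule on coefficients: n + 1 splits as i + (n + 1 - i). *)
Lemma conv_deriv (R : pzRingType) (f g : nat -> R) n :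
  (\sum_(i < n.+2) f i * g (n.+1 - i)%N) *+ n.+1 =
  \sum_(i < n.+1) (f i.+1 *+ i.+1) * g (n - i)%N +
  \sum_(i < n.+1) f i * (g (n - i).+1 *+ (n - i).+1).
Proof.
rewrite -sumrMnl.
transitivity (\sum_(i < n.+2) (f i * g (n.+1 - i)%N) *+ i +
    \sum_(i < n.+2) (f i * g (n.+1 - i)%N) *+ (n.+1 - i)).
  rewrite -big_split /=; apply: eq_bigr => i _.
  by rewrite -mulrnDr subnKC // -ltnS.
congr (_ + _).
  rewrite big_ord_recl mulr0n add0r; apply: eq_bigr => i _.
  by rewrite /= /bump leq0n add1n subSS mulrnAl.
rewrite big_ord_recr /= subnn mulr0n addr0; apply: eq_bigr => i _.
by rewrite subSn ?mulrnAr // -ltnS.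
Qed.

Lemma dx2M g h : dx2 (g * h) = dx2 g * h + g * dx2 h.
Proof.
apply: powserP => b; apply: powserP => a.
have dE k (x : P2) : dx2 x k = x k.+1 *+ k.+1.
  by apply: powserP => c; rewrite powserMn.
transitivity ((\sum_(i < b.+1) dx2 g i * h (b - i)%N +
  \sum_(i < b.+1) g i * dx2 h (b - i)%N) a); last by [].
rewrite -[LHS]/((g * h) b.+1 a *+ b.+1) -powserMn powserM conv_deriv.
congr (pcoef (_ + _) a); apply: eq_bigr => i _; congr (_ * _);
  exact/esym/dE.
Qed.

Lemma dx1M g h : dx1 (g * h) = dx1 g * h + g * dx1 h.
Proof.
apply: powserP => b; apply: powserP => a.
transitivity ((dx1 g * h) b a + (g * dx1 h) b a); last by [].
rewrite -[LHS]/((g * h) b a.+1 *+ a.+1) !powserM !powser_sum -sumrMnl -big_split.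
by apply: eq_bigr => i _; rewrite !powserM conv_deriv.
Qed.

Lemma dsumD g h : dsum (g + h) = dsum g + dsum h.
Proof. by rewrite /dsum dx1D dx2D addrACA. Qed.

Lemma dsumM g h : dsum (g * h) = dsum g * h + g * dsum h.
Proof. by rewrite /dsum dx1M dx2M; ring. Qed.

Lemma dx12 g : dx1 (dx2 g) = dx2 (dx1 g).
Proof. by apply: powserP => b; apply: powserP => a /=; rewrite -!mulrnA mulnC. Qed.

Lemma dx1_dsum n g : iter n dsum (dx1 g) = dx1 (iter n dsum g).
Proof. by elim: n => //= n ->; rewrite /dsum dx1D dx12. Qed.

Lemma dx2_dsum n g : iter n dsum (dx2 g) = dx2 (iter n dsum g).
Proof. by elim: n => //= n ->; rewrite /dsum dx2D dx12. Qed.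

Lemma fact_F n : n`!%:R != 0 :> F.
Proof. by rewrite ((pcharf0P F).1 charF) -lt0n fact_gt0. Qed.

Lemma P2_natr n (g : P2) b a : (n%:R * g) b a = n%:R * g b a.
Proof.
rewrite mulr_natl mulr_natl; elim: n => [|n IHn]; first by rewrite !mulr0n.
by rewrite !mulrS !powserD IHn.
Qed.

Lemma exp_shiftE g n : n`!%:R * exp_shift g n = iter n dsum g.
Proof.
apply: powserP => b; apply: powserP => a; rewrite P2_natr /= mulrC divfK //.
exact: fact_F.
Qed.

Lemma P2_torsion n (x y : P2) : n.+1%:R * x = n.+1%:R * y -> x = y.
Proof.
move=> xy; apply: powserP => b; apply: powserP => a.
have := congr1 (fun g : P2 => g b a) xy; rewrite !P2_natr => /mulfI; apply.
by have := @natS_neq0 F charF n.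
Qed.

(** The differential equation d/dt E = (d/dx1 + d/dx2) E for E = g(t + x1, t + x2), read on
    coefficients of t. It determines E from its value at t = 0 and yields multiplicativity without
    further factorials. *)
Lemma exp_shiftS g n : n.+1%:R * exp_shift g n.+1 = dsum (exp_shift g n).
Proof.
have N0 : n`!%:R != 0 :> P2.
  apply/eqP => /(congr1 (fun g : P2 => g 0 0)%N)/eqP.
  by rewrite -[n`!%:R]mulr1 P2_natr /= mulr1 (negbTE (fact_F n)).
apply: (mulfI N0); rewrite mulrA -natrM mulnC -factS exp_shiftE iterS -exp_shiftE.
have : dsum (n`!%:R : P2) = 0.
  elim: (n`!) => [|m IHm]; first by apply: (addrI (dsum 0)); rewrite -dsumD !addr0.
  rewrite -natr1 dsumD IHm add0r.
  by have := dsumM 1 1; rewrite !mulr1 mul1r => /eqP;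
    rewrite -subr_eq0 opprD addNKr oppr_eq0 => /eqP.
by rewrite dsumM => ->; rewrite mul0r add0r.
Qed.

Lemma exp_shiftS' g n : exp_shift g n.+1 *+ n.+1 = dsum (exp_shift g n).
Proof. by rewrite -exp_shiftS mulr_natl. Qed.

Lemma exp_shift0 g : exp_shift g 0 = g.
Proof. by have := exp_shiftE g 0; rewrite mul1r. Qed.

Lemma exp_shift_M : {morph @exp_shift F : g h / g * h}.
Proof.
move=> g h; apply: powserP => n; elim: n => [|n IHn].
  by rewrite powserM big_ord_recl big_ord0 addr0 !exp_shift0.
apply: (@P2_torsion n); rewrite exp_shiftS IHn !powserM mulr_natl conv_deriv.
have dS (I : Type) (r : seq I) (f : I -> P2) :
    dsum (\sum_(i <- r) f i) = \sum_(i <- r) dsum (f i).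
  elim: r => [|i r IHr]; last by rewrite !big_cons dsumD IHr.
  by rewrite !big_nil; apply: (addrI (dsum 0)); rewrite -dsumD !addr0.
rewrite dS -big_split /=; apply: eq_bigr => i _.
by rewrite dsumM -!exp_shiftS'.
Qed.

Lemma iter_dsum_B n g h : iter n dsum (g - h) = iter n dsum g - iter n dsum h.
Proof.
have dN x : dsum (- x) = - dsum x.
  apply: (addrI (dsum x)); rewrite -dsumD !subrr.
  by apply: (addrI (dsum 0)); rewrite -dsumD !addr0.
by elim: n => //= n ->; rewrite dsumD dN.
Qed.

Lemma exp_shift_B : {morph @exp_shift F : g h / g - h}.
Proof.
move=> g h; apply: powserP => n; apply: powserP => b; apply: powserP => a.
rewrite /= -/(iter n dsum _) iter_dsum_B.
exact: mulrBl.
Qed.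

Lemma exp_shift_1 : @exp_shift F 1 = 1.
Proof.
apply: powserP => -[|n]; first exact: exp_shift0.
apply: (@P2_torsion n); rewrite exp_shiftS mulr0.
elim: n => [|n IHn].
  rewrite exp_shift0.
  by have := dsumM 1 1; rewrite !mulr1 mul1r => /eqP;
    rewrite -subr_eq0 opprD addNKr oppr_eq0 => /eqP.
have -> : exp_shift 1 n.+1 = 0 :> P2.
  by apply: (@P2_torsion n); rewrite exp_shiftS IHn mulr0.
by apply: (addrI (dsum 0)); rewrite -dsumD !addr0.
Qed.

HB.instance Definition _ := GRing.isZmodMorphism.Build P2 (powser3 F)
  (@exp_shift F) exp_shift_B.
HB.instance Definition _ := GRing.isMonoidMorphism.Build P2 (powser3 F)
  (@exp_shift F) (exp_shift_1, exp_shift_M).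

Lemma exp_shift_inj : injective (@exp_shift F).
Proof.
by move=> g h gh; rewrite -(exp_shift0 g) -(exp_shift0 h) gh.
Qed.

(** The series g(t + x1, t + x2) in F((t))((x2))((x1)). *)
Definition phi g : L3 := incl_t21 (exp_shift g).

Lemma phi_M g h : phi (g * h) = phi g * phi h.
Proof. by rewrite /phi exp_shift_M incl_M. Qed.

Lemma phi_1 : phi 1 = 1.
Proof. by rewrite /phi exp_shift_1 incl_1. Qed.

Lemma phi_natr n : phi n%:R = n%:R.
Proof. exact: (rmorph_nat (@incl_t21 F \o @exp_shift F) n). Qed.

Lemma phi_neq0 p : p != 0 -> phi p != 0.
Proof.
apply: contraNneq => p0; apply/eqP/exp_shift_inj/incl_inj.
by rewrite -/(phi p) p0 !raddf0.
Qed.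

Lemma iota_shiftE g p : p != 0 ->
  iota_t21 (frac_shift (tofrac g / tofrac p)) = phi g / phi p.
Proof.
move=> p0; rewrite /frac_shift /iota_t21.
rewrite (@frac_liftE _ _ (@tofrac _ \o @exp_shift F)) //; last first.
  by move=> x y /eqP; rewrite /= tofrac_eq => /eqP; exact: exp_shift_inj.
rewrite (@frac_liftE _ _ (@incl_t21 F)) //; first exact: incl_inj.
by apply: contraNneq p0 => /(congr1 (@incl_t21 F)); rewrite raddf0 => e;
  apply/contraT => /phi_neq0; rewrite /phi e eqxx.
Qed.

(* The images of [f(t + x1, t + x2)] for [f] in the localization *)
Definition shifted : set L3 := [set h : L3 | exists g p : P2,
  [/\ p != 0, is_polynomial p & h = phi g / phi p]].

Lemma shifted_iota f : Fstar2 f -> shifted (iota_t21 (frac_shift f)).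
Proof. by move=> [g [p [p0 pp ->]]]; exists g, p; rewrite iota_shiftE. Qed.

Lemma iota_shifted (h : L3) : shifted h -> exists2 f, Fstar2 f & h = iota_t21 (frac_shift f).
Proof.
move=> [g [p [p0 pp ->]]]; exists (tofrac g / tofrac p); last by rewrite iota_shiftE.
by exists g, p.
Qed.

Lemma poly_M p q : is_polynomial p -> is_polynomial q -> is_polynomial (p * q).
Proof.
move=> [N pN] [M qM]; exists (N + M)%N => a b H.
rewrite powserM powser_sum big1 // => i _; rewrite powserM big1 // => j _.
have [iN|iN] := boolP ((N <= j)%N || (N <= i)%N); first by rewrite pN ?mul0r.
by rewrite qM ?mulr0 //; have := ltn_ord i; have := ltn_ord j; lia.
Qed.

Lemma shifted1 : shifted 1.
Proof.
exists 1, 1; split; [exact: oner_neq0| |by rewrite phi_1 divr1].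
exists 1%N => a b; case: b => [|b] /=; first by case: a.
by case: a.
Qed.

Lemma shifted_M (h h' : L3) : shifted h -> shifted h' -> shifted (h * h').
Proof.
move=> [g [p [p0 pp ->]]] [g' [p' [p0' pp' ->]]]; exists (g * g'), (p * p').
split; [exact: mulf_neq0|exact: poly_M|].
by rewrite (phi_M g g') (phi_M p p') mulf_div.
Qed.

Lemma shifted_natr n (h : L3) : shifted h -> shifted (h / n.+1%:R).
Proof.
move=> [g [p [p0 [N pN] ->]]]; exists g, (n.+1%:R * p); split.
- by apply: contraNneq p0 => e; apply/eqP/(@P2_torsion n); rewrite e mulr0.
- by exists N => a b H; rewrite P2_natr pN ?mulr0.
by rewrite phi_M phi_natr invfM mulrA mulrAC.
Qed.

(** The quotient rule, obtained by applying the Leibniz rule to (g / p) p; the new denominator p * p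
    is again a polynomial. *)
Lemma shifted_derivation (D : L3 -> L3) (d : P2 -> P2) :
  (forall f g : L3, D (f * g) = D f * g + f * D g) ->
  (forall g, D (phi g) = phi (d g)) -> forall h : L3, shifted h -> shifted (D h).
Proof.
move=> DM Dd h [g [p [p0 pp ->]]]; exists (d g * p - g * d p), (p * p).
split; [exact: mulf_neq0|exact: poly_M|].
have P0 := phi_neq0 p0; set h' := phi g / phi p.
have hp : h' * phi p = phi g by rewrite divfK.
have eD : D h' * phi p = phi (d g) - h' * phi (d p).
  by have := DM h' (phi p); rewrite hp !Dd => ->; rewrite addrK.
have phiB (x y : P2) : phi (x - y) = phi x - phi y.
  by rewrite /phi exp_shift_B incl_B.
have eq : phi (p * p) = phi p * phi p by exact: phi_M.
have P1 : phi (p * p) != 0 by rewrite eq mulf_neq0.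
apply: (mulIf P1); rewrite divfK // phiB eq mulrA eD mulrBl mulrAC hp.
by rewrite (phi_M (d g)) (phi_M g).
Qed.

Lemma laurent_mulrn (K : fieldType) (f : laurent K) m n : (f *+ m) n = f n *+ m.
Proof.
elim: m => [|m IHm]; first by rewrite /= if_same.
by rewrite !mulrS -IHm.
Qed.

Lemma laurent_intr (K : fieldType) (f : laurent K) (z n : int) :
  (z%:~R * f) n = z%:~R * f n.
Proof.
rewrite !mulrzl; case: z => z; first exact: laurent_mulrn.
by rewrite NegzE !mulrNz -!pmulrn -laurent_mulrn.
Qed.

Lemma phiE g a b n :
  phi g a b n = if (a, b, n) is (Posz a, Posz b, Posz n)
    then exp_shift g n b a else 0.
Proof.
by case: a => a; case: b => b; case: n => n //=; rewrite ?if_same //= ?if_same.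
Qed.

Lemma lderiv_phi g : lderiv (phi g) = phi (dx1 g).
Proof.
apply: laurentP => a; apply: laurentP => b; apply: laurentP => n.
rewrite -[lderiv _ a]/((a + 1)%:~R * phi g (a + 1)) !laurent_intr !phiE.
case: a => [a|[|a]]; last by rewrite (_ : Negz a.+1 + 1 = Negz a) ?mulr0 //; lia.
  rewrite (_ : a%:Z + 1 = a.+1%:Z); last by lia.
  case: b => b; last by rewrite mulr0.
  case: n => n; last by rewrite mulr0.
  rewrite -pmulrn mulr_natl /= -/(iter n dsum _) -/(iter n dsum _) dx1_dsum.
  by rewrite mulrnAl.
by rewrite mul0r.
Qed.

Lemma dlin_subproof (h : L3) : lower_truncated (fun a => lderiv (h a)).
Proof.
have [N hN] := lcoef_truncated h; exists N => a /hN ->.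
by apply: laurentP => n /=; rewrite !if_same mulr0.
Qed.

(** The derivation d/dx2, which acts on each coefficient in the outer variable x1. *)
Definition dlin (h : L3) : L3 := Laurent (dlin_subproof h).

Lemma dlin_phi g : dlin (phi g) = phi (dx2 g).
Proof.
apply: laurentP => a; apply: laurentP => b; apply: laurentP => n.
rewrite -[dlin _ a b]/((b + 1)%:~R * phi g a (b + 1)) !laurent_intr !phiE.
case: a => a; last by rewrite mulr0.
case: b => [b|[|b]]; last by rewrite (_ : Negz b.+1 + 1 = Negz b) ?mulr0 //; lia.
  rewrite (_ : b%:Z + 1 = b.+1%:Z); last by lia.
  case: n => n; last by rewrite mulr0.
  rewrite -pmulrn mulr_natl /= -/(iter n dsum _) -/(iter n dsum _) dx2_dsum.
  by rewrite mulrnAl.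
by rewrite mul0r.
Qed.

Lemma dlinM (f g : L3) : dlin (f * g) = dlin f * g + f * dlin g.
Proof.
apply: laurentP => a.
rewrite -[RHS]/((dlin f * g) a + (f * dlin g) a) !laurentM -isumD;
  try exact: laurent_fin.
rewrite -[LHS]/(lderiv ((f * g) a)) laurentM.
rewrite (@isum_raddf _ _ (@lderiv L)); last exact: laurent_fin.
- by apply: eq_isum => i; exact: lderivM.
- by apply: laurentP => n /=; rewrite !if_same mulr0.
by move=> x y; apply: laurentP => n /=; rewrite mulrDr.
Qed.

Lemma fact_L3 l : l`!%:R != 0 :> L3.
Proof.
have c3 : [pchar L3] =i pred0 := charL (charL (charL charF)).
by rewrite ((pcharf0P L3).1 c3) -lt0n fact_gt0.
Qed.

Lemma shifted_fact l (h : L3) : shifted h -> shifted (h / l`!%:R).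
Proof. by move=> Hh; rewrite -(prednK (fact_gt0 l)); exact: shifted_natr. Qed.

Lemma shifted_ldp l (h : L3) : shifted h -> shifted (ldp l h).
Proof.
move=> Hh; rewrite -(ldpE (charL (charL charF))); apply: shifted_fact.
elim: l => //= l IHl; exact: (shifted_derivation (@lderivM _) lderiv_phi).
Qed.

Lemma shifted_lin l (h : L3) : shifted h -> shifted (lin l h).
Proof.
move=> Hh; rewrite (_ : lin l h = iter l dlin h / l`!%:R).
  apply: shifted_fact; elim: l => //= l IHl; exact: (shifted_derivation dlinM dlin_phi).
apply/(canRL (mulfK (fact_L3 l))); apply: laurentP => a.
rewrite mulrC (pmulrn 1) laurent_intr -pmulrn.
rewrite -[lin l h a]/(ldp l (h a)) -(ldpE (charL charF)) mulrC divfK.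
  by elim: l => //= l ->.
by rewrite ((pcharf0P (laurent L)).1 (charL (charL charF))) -lt0n fact_gt0.
Qed.

End Morphisms.

Lemma isum_pair (M : zmodType) (g : int -> int -> M) : fin2 g ->
  \sum_(i \in [set: int * int]) g i.1 i.2 = isum (fun a => isum (g a)).
Proof.
move=> g2; have [N gN] := g2.
have gN1 i : (N < absz i)%N -> isum (g i) = 0.
  by move=> iN; apply: isum0 => j; rewrite gN ?iN.
rewrite (isumE gN1) (fsbigE [seq (i, j) | i <- window N, j <- window N]).
- under eq_bigl do rewrite in_setT.
  rewrite big_allpairs_dep /=; apply: eq_bigr => i _.
  by rewrite (isumE (N := N)) // => j jN; rewrite gN // jN orbT.
- by apply: allpairs_uniq; rewrite ?uniq_window // => -[a b] [c d].
  by [].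
move=> [i j] _ ij; apply: gN; apply: contraNT ij; rewrite negb_or -!leqNgt => /andP[iN jN].
by apply/allpairsP; exists (i, j); rewrite !mem_window.
Qed.

Lemma skip_dec i j e : skip i (dec (bump i j) e) = dec j (skip i e).
Proof. by apply/funext => m; rewrite /skip /dec (inj_eq (can_inj (bumpK i))). Qed.

Lemma skip_sub i j m e : skip i (sub (bump i j) m e) = sub j m (skip i e).
Proof. by apply/funext => l; rewrite /skip /sub (inj_eq (can_inj (bumpK i))). Qed.

Lemma dec_bump i j e : dec (bump i j) e i = e i.
Proof. by rewrite /dec (negbTE (neq_bump i j)) subr0. Qed.

Lemma sub_bump i j m e : sub (bump i j) m e i = e i.
Proof. by rewrite sub_ne // neq_bump. Qed.

Lemma skip_same i m e : skip i (sub i m e) = skip i e.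
Proof.
by apply/funext => l; rewrite /skip sub_ne // eq_sym neq_bump.
Qed.

(** * Propagation of locality *)

Section Lifting.
Variables (F : fieldType) (charF : [pchar F] =i pred0).
Variable V : lmodType (laurent F).
Local Notation L := (laurent F).
Local Notation L3 := (laurent (laurent L)).
Implicit Types (X Y : (nat -> int) -> V) (f g : L3) (T : laurent L).

(* [b(x1) a(x0) w] *)
Definition swap (b a : V -> int -> V) (w : V) : (nat -> int) -> V :=
  fun e => b (a w (e 0%N)) (e 1%N).

(* [b(x_i) X], where the variables of [X] are those other than [x_i] *)
Definition lift i (b : V -> int -> V) X : (nat -> int) -> V := fun e => b (X (skip i e)) (e i).

(* [X] applied to [c(x_i) w] *)
Definition plug i (c : V -> int -> V) (X : V -> (nat -> int) -> V) (w : V) : (nat -> int) -> V :=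
  fun e => X (c w (e i)) (skip i e).

Definition bumps i (t : seq (nat * nat)) := [seq (bump i jk.1, bump i jk.2) | jk <- t].

Lemma validL_bumps i r t : validL r t -> validL r.+1 (bumps i t).
Proof.
move=> vt; apply/allP => _ /mapP[[j k] /(allP vt) /and3P[/= jr kr jk] ->] /=.
by rewrite (inj_eq (can_inj (bumpK i))) jk /bump; lia.
Qed.

Lemma lift_dl i b j k X : Espace b ->
  lift i b (dl j k X) = dl (bump i j) (bump i k) (lift i b X).
Proof.
move=> Eb; apply/funext => e; rewrite /lift /dl (EB Eb).
by rewrite !dec_bump !skip_dec.
Qed.

Lemma lift_mulL i b t X : Espace b ->
  lift i b (mulL t X) = mulL (bumps i t) (lift i b X).
Proof. by move=> Eb; elim: t => //= -[j k] t IH; rewrite lift_dl ?IH. Qed.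

Lemma lift_FM i b f j k X : Espace b -> okf j k X ->
  lift i b (FM f j k X) = FM f (bump i j) (bump i k) (lift i b X).
Proof.
move=> Eb oX; apply/funext => e; rewrite /lift /FM (Eisum Eb); last exact: FM_fin.
apply: eq_isum => m; rewrite /SC (Eisum Eb); last by apply: SC_fin; case: oX.
apply: eq_isum => n; rewrite (EZ Eb) /lift.
by rewrite !sub_bump !skip_sub.
Qed.

Lemma lift_D i b X Y : Espace b -> lift i b (X + Y) = lift i b X + lift i b Y.
Proof. by move=> Eb; apply/funext => e; rewrite /lift !fctE (ED Eb). Qed.

Lemma lift_B i b X Y : Espace b -> lift i b (X - Y) = lift i b X - lift i b Y.
Proof. by move=> Eb; apply/funext => e; rewrite /lift !fctE (EB Eb). Qed.

Lemma lift_0 i b : Espace b -> lift i b 0 = 0.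
Proof. by move=> Eb; apply/funext => e; rewrite /lift (E0 Eb). Qed.

Lemma plug_dl i c j k (X : V -> (nat -> int) -> V) w :
  plug i c (fun v => dl j k (X v)) w = dl (bump i j) (bump i k) (plug i c X w).
Proof. by apply/funext => e; rewrite /plug /dl !dec_bump !skip_dec. Qed.

Lemma plug_mulL i c t (X : V -> (nat -> int) -> V) w :
  plug i c (fun v => mulL t (X v)) w = mulL (bumps i t) (plug i c X w).
Proof. by elim: t => //= -[j k] t <-; rewrite -plug_dl. Qed.

Lemma plug_FM i c f j k (X : V -> (nat -> int) -> V) w :
  plug i c (fun v => FM f j k (X v)) w = FM f (bump i j) (bump i k) (plug i c X w).
Proof.
apply/funext => e; rewrite /plug /FM; apply: eq_isum => m; apply: eq_isum => n.
by rewrite !sub_bump !skip_sub.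
Qed.

Lemma okf_lift1 b X : Espace b -> finl 0 X -> okf 0 1 (lift 1 b X).
Proof.
move=> Eb lX; split=> e.
  have [N bN] := Etrunc Eb (X (skip 1 e)); exists (e 1%N - N) => m mN.
  by rewrite /lift skip_same bN // sub_same; lia.
have [N XN] := lX (skip 1 e); exists N => m n mN.
rewrite /lift -[0%N]/(bump 1 0) skip_sub skip_same XN //.
exact: E0.
Qed.

Lemma okf_plug1 c (X : V -> (nat -> int) -> V) w : Espace c ->
  X 0 = 0 -> (forall v, finl 1 (X v)) -> okf 1 2 (plug 1 c X w).
Proof.
move=> Ec X0 lX; split=> e.
  have [N XN] := lX (c w (e 1%N)) (skip 1 e); exists N => m mN.
  by rewrite /plug -[2%N]/(bump 1 1) sub_bump skip_sub XN.
have [N cN] := Etrunc Ec w; exists (e 1%N - N) => m n mN.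
by rewrite /plug cN ?X0 // sub_same sub_ne //; lia.
Qed.

Lemma okf01 X : finl 1 X -> (exists N : int, forall e, e 0%N < N -> X e = 0) ->
  okf 0 1 X.
Proof.
move=> lX [N XN]; split=> // e; exists (e 0%N - N) => a b aN.
by apply: XN; rewrite sub_same sub_ne //; lia.
Qed.

Lemma swap_low b a w : Espace a -> Espace b ->
  exists N : int, forall e, e 0%N < N -> swap b a w e = 0.
Proof.
move=> Ea Eb; have [N aN] := Etrunc Ea w; exists N => e eN.
by rewrite /swap aN // (E0 Eb).
Qed.

Lemma finl_swap b a w : Espace b -> finl 1 (swap b a w).
Proof.
move=> Eb e; have [N bN] := Etrunc Eb (a w (e 0%N)).
by exists (e 1%N - N) => m mN; rewrite /swap sub_ne // sub_same bN //; lia.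
Qed.

Lemma okf_swap b a w : Espace a -> Espace b -> okf 0 1 (swap b a w).
Proof. by move=> Ea Eb; apply: okf01; [apply: finl_swap | apply: swap_low]. Qed.

Lemma FM_low f X : (exists N : int, forall e, e 0%N < N -> X e = 0) ->
  exists N : int, forall e, e 0%N < N -> FM f 0 1 X e = 0.
Proof.
move=> [N XN]; have [P fP] := lcoef_truncated f; exists (N + P) => e eN.
apply: isum0 => a; have [/fP->|Pa] := ltP a P; first exact: SC0.
by apply: isum0 => b; rewrite XN ?scaler0 // sub_ne // sub_same; lia.
Qed.

Lemma FM_0 f i j : FM f i j 0 = 0 :> ((nat -> int) -> V).
Proof.
by apply/funext => e; apply: isum0 => a; apply: isum0 => b; exact: scaler0.
Qed.

Lemma FM_const T X : FM (laurent_const T) 0 1 X = SC T 1 X.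
Proof.
apply/funext => e; rewrite /FM (@isum1 _ _ 0) /= ?sub0 // => a a0.
by rewrite (negbTE a0) SC0.
Qed.

Lemma outer_subproof T : lower_truncated (fun a => laurent_const (T a)).
Proof.
have [N TN] := lcoef_truncated T; exists N => a /TN->.
by apply: laurentP => b /=; rewrite if_same.
Qed.

(* [T(x0)], as an element of [F((t))((x1))((x0))] *)
Definition outer T : L3 := Laurent (outer_subproof T).

Lemma FM_outer T X : FM (outer T) 0 1 X = SC T 0 X.
Proof.
apply/funext => e; apply: eq_isum => a; rewrite /SC (@isum1 _ _ 0) ?sub0 // => b b0.
by rewrite /= (negbTE b0) scale0r.
Qed.

Lemma FM_C f g X : okf 0 1 X -> FM f 0 1 (FM g 0 1 X) = FM g 0 1 (FM f 0 1 X).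
Proof. by move=> oX; rewrite !FM_FM // mulrC. Qed.

Lemma swap_scale1 T (b a : V -> int -> V) w : swap (Escale T b) a w = SC T 1 (swap b a w).
Proof.
by apply/funext => e; apply: eq_isum => m; rewrite /swap sub_same sub_ne.
Qed.

Lemma swap_scale0 T b a w : Espace a -> Espace b ->
  swap b (Escale T a) w = SC T 0 (swap b a w).
Proof.
move=> Ea Eb; apply/funext => e; rewrite /swap [Escale _ _ _ _](erefl (isum _)) (Eisum Eb).
  by apply: eq_isum => m; rewrite (EZ Eb) /swap sub_same sub_ne.
exact: (@xmul_fin _ V T (fun m _ => a w m) _ 0 (Etrunc Ea w)).
Qed.

Lemma fmul21E h (G : int -> int -> V) e :
  okf 0 1 (fun e => G (e 0%N) (e 1%N)) ->
  fmul21 h G (e 0%N) (e 1%N) = FM h 0 1 (fun e => G (e 0%N) (e 1%N)) e.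
Proof.
by move=> oG; exact: (isum_pair (okf_fin2 h e oG)).
Qed.

Lemma mulL_d2 k (G : int -> int -> V) e :
  mulL (nseq k (0, 1)%N) (fun e => G (e 0%N) (e 1%N)) e =
  iter k (@d2 L V) G (e 0%N) (e 1%N).
Proof.
elim: k e => //= k IHk e; rewrite /dl !IHk /d2 /dec /=.
by rewrite !subr0.
Qed.

End Lifting.

(** * Exchange relations and their extension to n-th products *)

Section Locality.
Variables (F : fieldType) (charF : [pchar F] =i pred0).
Variable V : lmodType (laurent F).
Local Notation L := (laurent F).
Local Notation L3 := (laurent (laurent L)).
Local Notation ser := ((nat -> int) -> V).
Variable psi : V -> V -> int -> V.
Hypothesis psi_E : forall v, Espace (psi v).
Hypothesis psi_pairc : forall u v, exists k, pairc k (psi u) (psi v).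
Hypothesis psi_nprod : forall u n v,
  psi (mode (psi u) n v) = nprod n (psi u) (psi v).
Hypothesis psi_scale : forall f v,
  psi (f *: v) = Escale (taylor_shift f) (psi v).
Hypothesis psiD : forall u v, psi (u + v) = psi u + psi v.
Implicit Types (P : V -> Prop) (X Y Z : V -> ser).

Let shifted := @shifted F.
Let chL := charL charF.

(** Finite sums as an inductive predicate, so that the number of terms never has to be tracked while
    relations are transformed. *)
Inductive sums (G : (V -> ser) -> Prop) : (V -> ser) -> Prop :=
| sums0 : sums G (fun=> 0)
| sumsD X Y : sums G X -> sums G Y -> sums G (fun w => X w + Y w)
| sums_gen X : G X -> sums G X.

Lemma eq_sums G X Y : X =1 Y -> sums G X -> sums G Y.
Proof. by move=> /funext->. Qed.

Lemma sums_sum G n (X : 'I_n -> V -> ser) :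
  (forall l, sums G (X l)) -> sums G (fun w => \sum_l X l w).
Proof.
elim: n X => [|n IHn] X GX.
  by apply: eq_sums (sums0 G) => w; rewrite big_ord0.
apply: eq_sums (sumsD (IHn (fun i => X (widen_ord (leqnSn n) i)) _) (GX ord_max)).
  by move=> w; rewrite big_ord_recr.
by move=> i; apply: GX.
Qed.

(* The right-hand sides [\sum_i f_i(x0, x1) v_i(x1) u_i(x0) w], with
   the [u_i] in [P] *)
Inductive exchange P : (V -> ser) -> Prop :=
  Exchange h u v : shifted h -> P u ->
    exchange P (fun w => FM h 0 1 (swap (psi v) (psi u) w)).

Definition exchanged P := sums (exchange P).

Lemma exchanged_gen P h u v : shifted h -> P u ->
  exchanged P (fun w => FM h 0 1 (swap (psi v) (psi u) w)).
Proof. by move=> Hh Pu; apply: sums_gen. Qed.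

Lemma exchanged_prop P X : exchanged P X -> [/\ forall w, finl 1 (X w),
  forall w, exists N : int, forall e, e 0%N < N -> X w e = 0 & X 0 = 0].
Proof.
elim=> {X} [|X Y _ [X1 X2 X3] _ [Y1 Y2 Y3]|_ [h u v Hh Pu]].
- by split=> // w; [move=> e|]; exists 0.
- split=> [w e|w|]; last by rewrite X3 Y3 addr0.
    have [N XN] := X1 w e; have [M YM] := Y1 w e.
    by exists (Num.max N M) => m mN; rewrite fctE XN ?YM ?addr0 //; lia.
  have [N XN] := X2 w; have [M YM] := Y2 w.
  by exists (Num.min N M) => m mN; rewrite fctE XN ?YM ?addr0 //; lia.
split=> [w|w|]; first by apply: finl_FM => //; apply: okf_swap.
  by apply: FM_low; apply: swap_low.
apply/funext => e; apply: isum0 => a; apply: isum0 => b.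
by rewrite /swap (E0 (psi_E u)) (E0 (psi_E v)) scaler0.
Qed.

Lemma exchanged_okf P X w : exchanged P X -> okf 0 1 (X w).
Proof. by case/exchanged_prop => X1 X2 _; apply: okf01. Qed.

Lemma exchanged_scale1 P f X : exchanged P X ->
  exchanged P (fun w => SC (taylor_shift f) 1 (X w)).
Proof.
elim=> {X} [|X Y RX PX RY PY|_ [h u v Hh Pu]].
- by apply: eq_sums (sums0 _) => w; rewrite -FM_const FM_0.
- apply: eq_sums (sumsD PX PY) => w; rewrite -!FM_const FM_D //;
    [exact: exchanged_okf RX | exact: exchanged_okf RY].
apply: eq_sums (exchanged_gen (f *: v) Hh Pu) => w.
rewrite psi_scale swap_scale1 -!FM_const FM_C //.
exact: okf_swap.
Qed.

(** The scalar is absorbed by the field at x_0, which is the one constrained by [P]; hence the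
    stability hypothesis. *)
Lemma exchanged_scale0 P f X : (forall u, P u -> P (f *: u)) -> exchanged P X ->
  exchanged P (fun w => SC (taylor_shift f) 0 (X w)).
Proof.
move=> Pf; elim=> {X} [|X Y RX PX RY PY|_ [h u v Hh Pu]].
- by apply: eq_sums (sums0 _) => w; rewrite -FM_outer FM_0.
- apply: eq_sums (sumsD PX PY) => w; rewrite -!FM_outer FM_D //;
    [exact: exchanged_okf RX | exact: exchanged_okf RY].
apply: eq_sums (exchanged_gen v Hh (Pf _ Pu)) => w.
rewrite psi_scale swap_scale0 // -!FM_outer FM_C //.
exact: okf_swap.
Qed.

(** Locality of one pair of fields, up to an unspecified list of factors uniform in w; [P] tells
    where the fields that act on w first are taken from. *)
Definition comm P u v := exists2 X, exchanged P X & exists2 t, validL 2 t &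
  forall w, mulL t (prodL [:: psi u; psi v] w - X w) = 0.

Lemma comm_sub P Q u v : (forall x, P x -> Q x) -> comm P u v -> comm Q u v.
Proof.
move=> PQ [X PX tX]; exists X => //; elim: PX => {X tX}.
- exact: sums0.
- by move=> X Y _ RX _ RY; apply: sumsD.
by move=> _ [h u' v' Hh /PQ Qu]; apply: exchanged_gen.
Qed.

Lemma mulL_add0 t t' (A B : ser) : mulL t A = 0 -> mulL t' B = 0 ->
  mulL (t ++ t') (A + B) = 0.
Proof.
by move=> tA tB; rewrite mulLD !mulL_cat tB mulLC tA !mulL0 addr0.
Qed.

Lemma validL_cat r t t' : validL r t -> validL r t' -> validL r (t ++ t').
Proof. by move=> vt vt'; rewrite /validL all_cat; apply/andP. Qed.

Lemma addrBD (A B A' B' : ser) : A + A' - (B + B') = (A - B) + (A' - B').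
Proof. by rewrite opprD addrACA. Qed.

Lemma comm_sum P u v u1 v1 u2 v2 :
  (forall w, prodL [:: psi u; psi v] w =
    prodL [:: psi u1; psi v1] w + prodL [:: psi u2; psi v2] w) ->
  comm P u1 v1 -> comm P u2 v2 -> comm P u v.
Proof.
move=> uvE [X PX [t vt tE]] [X' PX' [t' vt' tE']]; exists (fun w => X w + X' w).
  exact: sumsD.
exists (t ++ t') => [|w]; first exact: validL_cat.
by rewrite uvE addrBD mulL_add0.
Qed.

Lemma commDr P u v v' : comm P u v -> comm P u v' -> comm P u (v + v').
Proof.
apply: comm_sum => w; apply/funext => e.
by rewrite /= psiD !fctE (ED (psi_E u)).
Qed.

Lemma commDl P u u' v : comm P u v -> comm P u' v -> comm P (u + u') v.
Proof. by apply: comm_sum => w; apply/funext => e; rewrite /= psiD. Qed.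

Lemma FM_B f i j (A B : ser) : okf i j A -> okf i j B ->
  FM f i j (A - B) = FM f i j A - FM f i j B.
Proof. by move=> oA oB; rewrite FM_D ?FM_N //; apply: okfN. Qed.

Lemma finl_prodL2 u v w : finl 1 (prodL [:: psi u; psi v] w) /\
  finl 0 (prodL [:: psi u; psi v] w).
Proof.
have Eu := psi_E u; have Ev := psi_E v; split.
  exact: (@finl_prodL _ _ [:: psi u] [::]).
exact: (@finl_prodL _ _ [::] [:: psi v]).
Qed.

Lemma finlB i (A B : ser) : finl i A -> finl i B -> finl i (A - B).
Proof.
move=> lA lB e; have [N AN] := lA e; have [M BM] := lB e.
by exists (Num.max N M) => m mN; rewrite !fctE AN ?BM ?subr0 //; lia.
Qed.

Lemma finl_low i (A : ser) : (exists N : int, forall e, e i < N -> A e = 0) ->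
  finl i A.
Proof.
by move=> [N AN] e; exists (e i - N) => m mN; apply: AN; rewrite sub_same; lia.
Qed.

Lemma SC_B T j (A B : ser) : finl j A -> finl j B ->
  SC T j (A - B) = SC T j A - SC T j B.
Proof.
move=> lA lB; apply/funext => e; rewrite !fctE /SC -isumB; try exact: SC_fin.
by apply: eq_isum => m; rewrite scalerBr.
Qed.

Lemma SC_0 T j : SC T j 0 = 0 :> ser.
Proof. by apply/funext => e; apply: isum0 => m; rewrite scaler0. Qed.

Lemma commZr P f u v : comm P u v -> comm P u (f *: v).
Proof.
move=> [X PX [t vt tE]]; exists (fun w => SC (taylor_shift f) 1 (X w)).
  exact: exchanged_scale1.
exists t => // w; have [X1 _ _] := exchanged_prop PX.
have [l1 _] := finl_prodL2 u v w.
rewrite psi_scale (@prodL_scale _ _ [:: psi u] [::]) //= -SC_B // SC_mulL.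
  by rewrite tE SC_0.
exact: finlB.
Qed.

Lemma commZl P f u v : (forall x, P x -> P (f *: x)) ->
  comm P u v -> comm P (f *: u) v.
Proof.
move=> Pf [X PX [t vt tE]]; exists (fun w => SC (taylor_shift f) 0 (X w)).
  exact: exchanged_scale0.
exists t => // w; have [_ X0 _] := exchanged_prop PX.
have [_ l0] := finl_prodL2 u v w; have lX := finl_low (X0 w).
rewrite psi_scale (@prodL_scale _ _ [::] [:: psi v]) //= -SC_B // SC_mulL.
  by rewrite tE SC_0.
exact: finlB.
Qed.

Definition approximable G X := exists2 Z, sums G Z & exists2 t, validL 3 t &
  forall w, mulL t (X w - Z w) = 0.

Lemma approximable0 G : approximable G (fun=> 0).
Proof.
exists (fun=> 0); first exact: sums0.
by exists [::] => // w; rewrite subr0.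
Qed.

Lemma approximableD G X Y : approximable G X -> approximable G Y ->
  approximable G (fun w => X w + Y w).
Proof.
move=> [Z GZ [t vt tE]] [Z' GZ' [t' vt' tE']].
exists (fun w => Z w + Z' w); first exact: sumsD.
exists (t ++ t') => [|w]; first exact: validL_cat.
by rewrite addrBD mulL_add0.
Qed.

(** Required for all large k, so that the terms of a finite sum can be fused with a common power. *)
Definition fuses P i Z := exists k0, forall k, (k0 <= k)%N ->
  (forall w, fusable i (dp k i i.+1 (Z w))) /\
  forall p, exchanged P (fun w => J i p (dp k i i.+1 (Z w))).

Lemma sums_fuse P i G Z : (forall X, G X -> fuses P i X) -> sums G Z -> fuses P i Z.
Proof.
move=> Gf; elim=> {Z} [|X Y _ [k kX] _ [k' kY]|]; last exact: Gf.
  have d0 k : dp k i i.+1 0 = 0 :> ser by exact: mulL0.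
  exists 0%N => k _; split=> [w|p]; first by rewrite d0 => e; exists 0.
  apply: eq_sums (sums0 _) => w; rewrite d0.
  by apply/funext => e; rewrite /J J2_0.
exists (maxn k k') => l; rewrite geq_max => /andP[/kX[lX RX] /kY[lY RY]].
have dD w : dp l i i.+1 (X w + Y w) = dp l i i.+1 (X w) + dp l i i.+1 (Y w).
  exact: mulLD.
split=> [w|p]; first by rewrite dD; apply: fusableD.
by apply: eq_sums (sumsD (RX p) (RY p)) => w; rewrite dD JD.
Qed.

(* [f(x0, x1) f'(x0, x2) b(x1) c(x2) a(x0) w] *)
Inductive exchange02 P : (V -> ser) -> Prop :=
  Exchange02 f f' a b c : shifted f -> shifted f' -> P a -> exchange02 P (fun w =>
    FM f 0 1 (FM f' 0 2 (lift 1 (psi b) (swap (psi c) (psi a) w)))).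

Lemma exchange02_lift P f b Y : shifted f -> exchanged P Y ->
  sums (exchange02 P) (fun w => FM f 0 1 (lift 1 (psi b) (Y w))).
Proof.
move=> Hf; elim=> {Y} [|X Y RX PX RY PY|_ [h u v Hh Pu]].
- by apply: eq_sums (sums0 _) => w; rewrite lift_0 // FM_0.
- have [_ X0 _] := exchanged_prop RX; have [_ Y0 _] := exchanged_prop RY.
  apply: eq_sums (sumsD PX PY) => w.
  by rewrite lift_D // FM_D //; apply: okf_lift1 => //; apply: finl_low.
apply: eq_sums (sums_gen (Exchange02 b v Hf Hh Pu)) => w.
rewrite lift_FM //; exact: okf_swap.
Qed.

(** In a term f(x_0, x_1) b(x_1) a(x_0) c(x_2) w the field a lies in [P], so the hypothesis allows
    it to be moved past c as well; this step is what [P] is for. *)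
Lemma exchange02_plug P X c : exchanged P X -> (forall a, P a -> comm P a c) ->
  approximable (exchange02 P) (plug 2 (psi c) X).
Proof.
move=> RX Pc; elim: RX => {X} [|X Y _ IHX _ IHY|_ [f a b Hf Pa]].
- exact: approximable0.
- exact: (approximableD IHX IHY).
have [Y RY [t vt tE]] := Pc a Pa; have [_ Y0 _] := exchanged_prop RY.
exists (fun w => FM f 0 1 (lift 1 (psi b) (Y w))); first exact: exchange02_lift.
exists (bumps 1 t) => [|w]; first exact: validL_bumps.
have [_ l0] := finl_prodL2 a c w; have lY := finl_low (Y0 w).
rewrite plug_FM -[bump 2 0]/0%N -[bump 2 1]/1%N.
have -> : plug 2 (psi c) (swap (psi b) (psi a)) w =
    lift 1 (psi b) (prodL [:: psi a; psi c] w) by [].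
have oL A : finl 0 A -> okf 0 1 (lift 1 (psi b) A) by exact: okf_lift1.
rewrite -FM_B; [|exact: oL|exact: oL].
rewrite -lift_B // -FM_mulL; last by apply: oL; apply: finlB.
by rewrite -lift_mulL // tE lift_0 // FM_0.
Qed.

Lemma dp_lift k a b c w : dp k 1 2 (lift 1 b (swap c a w)) =
  fun e => iter k (@d2 L V) (prod12 b c (a w (e 0%N))) (e 1%N) (e 2%N).
Proof.
elim: k => // k IHk; rewrite dpS IHk; apply/funext => e.
by rewrite /dl /d2 /dec /= !subr0.
Qed.

Lemma J_swap1 k p a b c w : pairc k (psi b) (psi c) ->
  J 1 p (dp k 1 2 (lift 1 (psi b) (swap (psi c) a w))) =
  swap (psi (mode (psi b) (k%:Z - p - 1) c)) a w.
Proof.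
move=> bck; apply/funext => e; rewrite psi_nprod dp_lift /swap.
rewrite (nprodE charF _ _ _ (psi_E b) (psi_E c) bck).
by rewrite (_ : k%:Z - (k%:Z - p - 1) - 1 = p) //; lia.
Qed.

Lemma laurent12_0_lift k a b c w : pairc k (psi b) (psi c) -> Espace a ->
  laurent12_0 (dp k 1 2 (lift 1 (psi b) (swap (psi c) a w))).
Proof.
move=> bck Ea; rewrite dp_lift; split.
  have [N aN] := Etrunc Ea w; exists N => e eN; rewrite aN //.
  have := prod12_d2Z k (0 : L) (0 : V) (e 1%N) (e 2%N) (psi_E b) (psi_E c).
  by rewrite !scale0r.
by move=> z; have [N H] := bck (a w z); exists N => e -> en; apply: H.
Qed.

(** Fusing x_1 and x_2 turns b(x_1) c(x_2) into the field of a mode b_n c. The displaced x_1 in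
    f(x_0, x_1) produces finitely many divided derivatives, which stay in [shifted], while f'(x_0,
    x_2) is only renamed. *)
Lemma exchange02_fuses P Z : exchange02 P Z -> fuses P 1 Z.
Proof.
move=> [f f' a b c Hf Hf' Pa].
have [k0 bck0] := psi_pairc b c; exists k0 => k k0k.
have bck := pairc_le k0k bck0; have Ea := psi_E a.
pose X w : ser := lift 1 (psi b) (swap (psi c) (psi a) w).
have cX w : laurent12_0 (dp k 1 2 (X w)) by exact: laurent12_0_lift.
have oS w : okf 0 1 (swap (psi c) (psi a) w) by exact: okf_swap.
have o2 w : okf 0 2 (X w).
  split=> e.
    have [N cN] := Etrunc (psi_E c) (psi a w (e 0%N)); exists (e 2%N - N) => m mN.
    by rewrite /X /lift /swap /skip /= (cN (sub 2 m e 2%N)) ?E0 // sub_same; lia.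
  have [N aN] := Etrunc Ea w; exists (e 0%N - N) => m n mN.
  by rewrite /X /lift /swap /skip /= aN ?E0 // sub_same sub_ne //; lia.
have o1 w : okf 0 1 (FM f' 0 2 (X w)).
  rewrite -[2%N]/(bump 1 1) -[X in FM _ X _]/(bump 1 0) -lift_FM //.
  by apply: okf_lift1 => //; apply/finl_low/FM_low/swap_low.
have dpE w : dp k 1 2 (FM f 0 1 (FM f' 0 2 (X w))) =
    FM f 0 1 (FM f' 0 2 (dp k 1 2 (X w))).
  by rewrite /dp -!FM_mulL.
have cX2 w : laurent12_0 (FM f' 0 2 (dp k 1 2 (X w))) by exact: laurent12_0_FM.
split=> [w|p]; rewrite -/(X _).
  by rewrite dpE; apply/laurent12_0_fusable/laurent12_0_FM.
pose N := (absz p).+1; have pN : p < N%:Z by rewrite /N; lia.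
pose Y l w := FM (lin l f * f') 0 1
  (swap (psi (mode (psi b) (k%:Z - (p - l%:Z) - 1) c)) (psi a) w).
apply: (@eq_sums _ (fun w => \sum_(l < N) Y l w)); last first.
  apply: sums_sum => l; apply: exchanged_gen => //.
  by apply: shifted_M => //; apply: shifted_lin.
move=> w; rewrite -/(X w) dpE (J1_FM01 charF f pN) //; apply: eq_bigr => l _.
by rewrite (J1_FM02 _ _ (cX w)) J_swap1 // FM_FM //; apply: okf_swap.
Qed.

(** An equality valid up to factors x_i - x_j survives fusion: this is [collapse] for the predicate
    of being zero. *)
Lemma fuse_relation i s k q (T Z : V -> ser) : (i < 2)%N -> validL 3 s ->
  (forall w, fusable i (dp k i i.+1 (T w))) -> (forall w, fusable i (dp k i i.+1 (Z w))) ->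
  (forall w, mulL s (T w - Z w) = 0) -> exists2 s', validL 2 s' & forall w,
  mulL s' (J i q (dp k i i.+1 (T w)) - J i q (dp k i i.+1 (Z w))) = 0.
Proof.
move=> i2 vs lT lZ TZ; have [s' vs' s'P] := @collapse _ chL V 2 i s i2 vs (absz q).
exists s' => // w; have := s'P (eq^~ 0) (dp k i i.+1 (T w - Z w)).
have -> : dp k i i.+1 (T w - Z w) = dp k i i.+1 (T w) - dp k i i.+1 (Z w).
  exact: mulLB.
rewrite -JB //; apply; last by lia.
- by move=> A B -> ->; rewrite addr0.
- by move=> A ->; rewrite oppr0.
- by move=> j j' A ->; rewrite dl0.
- by [].
- exact: fusableD (fusableN _).
move=> q'; rewrite -mulLB -/(dp k i _ _) /dp mulLC TZ mulL0.
by apply/funext => e; rewrite /J J2_0.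
Qed.

(** In a(x_0) b(x_1) c(x_2) w the field a is moved to the right past b, then past c, and only then
    are x_1 and x_2 fused. *)
Lemma comm_moder P a b c n : comm P a b -> (forall a', P a' -> comm P a' c) ->
  comm P a (mode (psi b) n c).
Proof.
move=> [X RX [t vt tE]] Pc.
have [Z RZ [t' vt' tE']] := exchange02_plug RX Pc.
have [k0 kZ] := sums_fuse (@exchange02_fuses P) RZ; have [k1 bck1] := psi_pairc b c.
pose k := maxn k0 k1; have bck := pairc_le (leq_maxr k0 k1) bck1.
have [lZ RJ] := kZ k (leq_maxl k0 k1); pose q := k%:Z - n - 1.
exists (fun w => J 1 q (dp k 1 2 (Z w))) => //.
pose T w := prodL [:: psi a; psi b; psi c] w.
have [|w|w|s vs sE] := @fuse_relation 1 (bumps 2 t ++ t') k q T Z isT _ _ lZ.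
- by apply: validL_cat => //; apply: validL_bumps.
- exact: (@fusable_prodL _ _ [:: psi a] [::] (psi b) (psi c) w k).
(* The intermediate form has a moved past b but not yet past c. *)
- have -> : T w - Z w = (T w - plug 2 (psi c) X w) + (plug 2 (psi c) X w - Z w).
    by rewrite addrA subrK.
  rewrite (_ : T w - plug 2 (psi c) X w =
    plug 2 (psi c) (fun v => prodL [:: psi a; psi b] v - X v) w) //.
  apply: mulL_add0 => //; rewrite -plug_mulL.
  by apply/funext => e; rewrite /plug tE.
exists s => // w; rewrite psi_nprod.
rewrite (@prodL_nprod _ charF _ [:: psi a] [::] (psi b) (psi c) w k) //.
exact: sE.
Qed.

(* [f(x1, x2) f'(x0, x2) v(x2) a(x0) b(x1) w] *)
Inductive exchange12 : (V -> ser) -> Prop :=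
  Exchange12 f f' a b v : shifted f -> shifted f' -> exchange12 (fun w =>
    FM f 1 2 (FM f' 0 2 (plug 1 (psi b) (swap (psi v) (psi a)) w))).

Let any : V -> Prop := fun=> True.

Lemma exchange12_plug f b Y : shifted f -> exchanged any Y ->
  sums exchange12 (fun w => FM f 1 2 (plug 1 (psi b) Y w)).
Proof.
move=> Hf; elim=> {Y} [|X Y RX PX RY PY|_ [h u v Hh _]].
- by apply: eq_sums (sums0 _) => w; exact/esym/FM_0.
- have [X1 _ X0] := exchanged_prop RX; have [Y1 _ Y0] := exchanged_prop RY.
  apply: eq_sums (sumsD PX PY) => w.
  by rewrite -FM_D //; apply: okf_plug1.
apply: eq_sums (sums_gen (Exchange12 u b v Hf Hh)) => w.
by rewrite plug_FM.
Qed.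

Lemma prodL2_0 u v : prodL [:: psi u; psi v] 0 = 0.
Proof. by apply/funext => e; rewrite /= !E0. Qed.

(** Moving the last field left past b has produced terms f v(x_2) b(x_1) with an arbitrary v, which
    must now pass a; hence a hypothesis on a and every v. *)
Lemma exchange12_lift X a : exchanged any X -> (forall v, comm any a v) ->
  approximable exchange12 (fun w => lift 0 (psi a) (X w)).
Proof.
move=> RX Pa; elim: RX => {X} [|X Y _ IHX _ IHY|_ [f b v Hf _]].
- rewrite (_ : (fun=> _) = fun=> 0); first exact: approximable0.
  by apply/funext => w; rewrite lift_0.
- rewrite (_ : (fun=> _) = fun w => lift 0 (psi a) (X w) + lift 0 (psi a) (Y w)).
    exact: approximableD.
  by apply/funext => w; rewrite lift_D.
have [Y RY [t vt tE]] := Pa v; have [Y1 _ Y0] := exchanged_prop RY.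
exists (fun w => FM f 1 2 (plug 1 (psi b) Y w)); first exact: exchange12_plug.
exists (bumps 1 t) => [|w]; first exact: validL_bumps.
have l1 u := proj1 (finl_prodL2 a v u).
rewrite lift_FM //; last exact: okf_swap.
rewrite -[bump 0 0]/1%N -[bump 0 1]/2%N.
have -> : lift 0 (psi a) (swap (psi v) (psi b) w) =
    plug 1 (psi b) (prodL [:: psi a; psi v]) w by [].
rewrite -FM_B; try by apply: okf_plug1 => //; exact: prodL2_0.
rewrite (_ : _ - _ = plug 1 (psi b) (fun u => prodL [:: psi a; psi v] u - Y u) w) //.
rewrite -FM_mulL; last first.
  apply: okf_plug1 => // [|u]; last exact: finlB.
  by rewrite prodL2_0 Y0 subr0.
rewrite -plug_mulL (_ : plug _ _ _ _ = 0) ?FM_0 //.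
by apply/funext => e; rewrite /plug tE.
Qed.

Lemma dp_plug k a b v w : Espace v -> dp k 0 1 (plug 1 b (swap v a) w) =
  fun e => v (iter k (@d2 L V) (prod12 a b w) (e 0%N) (e 1%N)) (e 2%N).
Proof.
move=> Ev; elim: k => // k IHk; rewrite dpS IHk; apply/funext => e.
by rewrite /dl -(EB Ev) /d2 /dec /= !subr0.
Qed.

Lemma J_swap0 k p a b v w : pairc k (psi a) (psi b) -> Espace v ->
  J 0 p (dp k 0 1 (plug 1 (psi b) (swap v (psi a)) w)) =
  swap v (psi (mode (psi a) (k%:Z - p - 1) b)) w.
Proof.
move=> abk Ev; apply/funext => e; rewrite psi_nprod dp_plug // /swap.
rewrite (nprodE charF _ _ _ (psi_E a) (psi_E b) abk) (EJ2 Ev) //.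
by rewrite (_ : k%:Z - (k%:Z - p - 1) - 1 = p) //; lia.
Qed.

Lemma laurent2_01_plug k a b v w : pairc k (psi a) (psi b) -> Espace v ->
  laurent2_01 (dp k 0 1 (plug 1 (psi b) (swap v (psi a)) w)).
Proof.
move=> abk Ev; rewrite dp_plug //; split=> [|e].
  by have [N H] := abk w; exists N => e en; rewrite H // E0.
have [N vN] := Etrunc Ev (iter k (@d2 L V) (prod12 (psi a) (psi b) w) (e 0%N) (e 1%N)).
by exists (e 2%N - N) => m mN; rewrite (@sub_ne 2 _ _ 0) // (@sub_ne 2 _ _ 1) //
      vN // sub_same; lia.
Qed.

(** Fusing x_0 and x_1 displaces the outer variable of f'(x_0, x_2), whence divided derivatives in
    that variable; f(x_1, x_2) is not displaced and multiplies each term. *)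
Lemma exchange12_fuses Z : exchange12 Z -> fuses any 0 Z.
Proof.
move=> [f f' a b v Hf Hf'].
have [k0 abk0] := psi_pairc a b; exists k0 => k k0k.
have abk := pairc_le k0k abk0; have Ev := psi_E v.
pose X w : ser := plug 1 (psi b) (swap (psi v) (psi a)) w.
have cX w : laurent2_01 (dp k 0 1 (X w)) by exact: laurent2_01_plug.
have S0 : swap (psi v) (psi a) 0 = 0 by apply/funext => e; rewrite /swap !E0.
have oX w : okf 0 2 (X w).
  split=> e.
    have [N vN] := Etrunc Ev (psi a (psi b w (e 1%N)) (e 0%N)); exists (e 2%N - N) => m mN.
    by rewrite /X /plug /swap /skip /= (@sub_ne 2 _ _ 0) // (@sub_ne 2 _ _ 1) //
      vN // sub_same; lia.
  have [N aN] := Etrunc (psi_E a) (psi b w (e 1%N)); exists (e 0%N - N) => m n mN.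
  rewrite /X /plug /swap /skip /= (@sub_ne 0 _ _ 1) // (@sub_ne 2 _ _ 1) //.
  by rewrite aN ?E0 // sub_same sub_ne //; lia.
have o1 w : okf 1 2 (FM f' 0 2 (X w)).
  rewrite /X -[2%N]/(bump 1 1) -[X in FM _ X _]/(bump 1 0) -plug_FM.
  apply: okf_plug1 => // [|u]; first by rewrite S0 FM_0.
  by apply: finl_FM => //; apply: okf_swap.
have dpE w : dp k 0 1 (FM f 1 2 (FM f' 0 2 (X w))) =
    FM f 1 2 (FM f' 0 2 (dp k 0 1 (X w))).
  by rewrite /dp -!FM_mulL.
have cX2 w : laurent2_01 (FM f' 0 2 (dp k 0 1 (X w))) by exact: laurent2_01_FM.
split=> [w|p].
  by rewrite dpE; apply/laurent2_01_fusable/laurent2_01_FM.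
pose N := (absz p).+1; have pN : p < N%:Z by rewrite /N; lia.
pose Y l w := FM (f * ldp l f') 0 1
  (swap (psi v) (psi (mode (psi a) (k%:Z - (p - l%:Z) - 1) b)) w).
apply: (@eq_sums _ (fun w => \sum_(l < N) Y l w)); last first.
  apply: sums_sum => l; apply: exchanged_gen => //.
  by apply: shifted_M => //; apply: shifted_ldp.
move=> w; rewrite -/(X w) dpE J0_FM12 // (J0_FM02 charF f' pN) //.
rewrite FM_sum => [|l]; last by apply: okf_FM => //; apply: J0_okf.
by apply: eq_bigr => l _; rewrite J_swap0 // FM_FM //; apply: okf_swap.
Qed.

(** The asymmetry of the hypotheses matches the induction: b is a general vector known to exchange
    with v, while a is a generator already known to exchange with everything. *)
Lemma comm_model a b v n : (forall v', comm any a v') -> comm any b v ->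
  comm any (mode (psi a) n b) v.
Proof.
move=> Pa [X RX [t vt tE]].
have [Z RZ [t' vt' tE']] := exchange12_lift RX Pa.
have [k0 kZ] := sums_fuse exchange12_fuses RZ; have [k1 abk1] := psi_pairc a b.
pose k := maxn k0 k1; have abk := pairc_le (leq_maxr k0 k1) abk1.
have [lZ RJ] := kZ k (leq_maxl k0 k1); pose q := k%:Z - n - 1.
exists (fun w => J 0 q (dp k 0 1 (Z w))) => //.
pose T w := prodL [:: psi a; psi b; psi v] w.
have [|w|w|s vs sE] := @fuse_relation 0 (bumps 0 t ++ t') k q T Z isT _ _ lZ.
- by apply: validL_cat => //; apply: validL_bumps.
- exact: (@fusable_prodL _ _ [::] [:: psi v] (psi a) (psi b) w k).
- have -> : T w - Z w = (T w - lift 0 (psi a) (X w)) + (lift 0 (psi a) (X w) - Z w).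
    by rewrite addrA subrK.
  apply: mulL_add0 => //.
  rewrite (_ : T w - _ = lift 0 (psi a) (prodL [:: psi b; psi v] w - X w)).
    by rewrite -lift_mulL // tE lift_0.
  by rewrite lift_B.
exists s => // w; rewrite psi_nprod.
rewrite (@prodL_nprod _ charF _ [::] [:: psi v] (psi a) (psi b) w k) //.
exact: sE.
Qed.

End Locality.

(** * The vertex algebra structure *)

Section Bridge.
Variables (F : fieldType) (charF : [pchar F] =i pred0).
Variable V : lmodType (laurent F).
Local Notation L := (laurent F).

(** Reads a series indexed by row vectors as one indexed by functions, so that the number of
    variables may change without casts. *)
Definition unrow r (A : 'rV[int]_r -> V) : (nat -> int) -> V :=
  fun e => A (\row_(i < r) e i).

Lemma unrow_mulXB r (i j : 'I_r) A :
  unrow (@mulXB L V r i j A) = dl i j (unrow A).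
Proof.
have rowE (h : 'I_r) e : \row_(k < r) (dec h e) k = (\row_(k < r) e k) - delta_mx 0 h.
  by apply/rowP => k; rewrite !mxE /dec eqxx /= natz.
by apply/funext => e; rewrite /dl /unrow !rowE.
Qed.

Lemma unrow_vandermonde r k : exists2 t, validL r t &
  forall A, unrow (@mul_vandermonde L V r k A) = mulL t (unrow A).
Proof.
pose P (op : ('rV[int]_r -> V) -> 'rV[int]_r -> V) :=
  exists2 t, validL r t & forall A, unrow (op A) = mulL t (unrow A).
have P1 : P idfun by exists [::].
have Pcomp op op' : P op -> P op' -> P (op \o op').
  move=> [t vt tE] [t' vt' tE']; exists (t ++ t').
    by rewrite /validL all_cat; apply/andP.
  by move=> A; rewrite /= tE tE' mulL_cat.
rewrite /mul_vandermonde; apply: (@big_ind _ P) => // i _.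
apply: (@big_ind _ P) => // j ij.
exists (nseq k (nat_of_ord i, nat_of_ord j)).
  apply/allP => x /nseqP[-> _] /=; rewrite !ltn_ord /=.
  by rewrite neq_ltn ij.
by move=> A; elim: k => //= k IHk; rewrite unrow_mulXB IHk.
Qed.

Lemma unrow_prodn (l : seq (V -> int -> V)) w :
  unrow (@prodn L V (size l) (fun i => nth (@one_field F V) l i) w) = prodL l w.
Proof.
apply/funext => e; rewrite /unrow /prodn.
set g : nat -> V -> V := fun i v => nth (@one_field F V) l i v (e i).
transitivity (foldr g w (iota 0 (size l))).
  rewrite -val_enum_ord foldr_map; congr foldr.
  by apply/funext => i; apply/funext => v; rewrite mxE.
rewrite {}/g; elim: l e => //= a l IHl e; congr (a _ _).
rewrite -IHl -[1%N]/(1 + 0)%N iotaDl foldr_map; congr foldr.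
Qed.

Lemma compatible_compat (S : set (V -> int -> V)) l : compatible S -> allS S l -> compat l.
Proof.
move=> cS Sl; have Snth i : (i < size l)%N -> S (nth (@one_field F V) l i).
  elim: l Sl i => //= a l IHl [Sa Sl] [|i] //; rewrite ltnS.
  exact: IHl.
have [k [_ kT]] := cS _ (fun i : 'I_(size l) => nth (@one_field F V) l i)
  (fun i => Snth i (ltn_ord i)).
have [t vt tE] := unrow_vandermonde (size l) k.
exists t => // w; rewrite -unrow_prodn -tE; have [N AN] := kT w.
exists N => e j jl eN; apply: (AN _ (Ordinal jl)).
by rewrite mxE.
Qed.

End Bridge.

(** * Fields attached to vectors, and compatibility of the map [psi] with products *)

Section Main.
Variables (F : fieldType) (charF : [pchar F] =i pred0).
Variables (V : lmodType (laurent F)) (vac : V) (D : V -> V).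
Local Notation L := (laurent F).
Hypothesis D_linear : linear (D : over_base V -> over_base V).
Variable U : set V.
Variable Y0 : V -> V -> int -> V.
Hypothesis Y0_hom : forall u, U u -> Espace (Y0 u).
Hypothesis D_vac : D vac = 0.
Hypothesis D_deriv : forall (f : laurent F) (v : V),
     D (f *: v) = f *: D v + lderiv f *: v.
Hypothesis D_Y0 : forall u, U u -> forall (v : V) (n : int),
     D (Y0 u v n) - Y0 u (D v) n = (n + 1)%:~R *: Y0 u v (n + 1).
Hypothesis Y0_creation : forall u, U u ->
     (forall n : int, n < 0 -> Y0 u vac n = 0) /\ Y0 u vac 0 = u.
Hypothesis Ux_compatible : compatible (Y0 @` U).
Hypothesis V_spanned : linear_span (monomials U Y0 vac) = setT.
Variable psi : V -> V -> int -> V.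
Hypothesis psi_linear : linear (psi : over_base V -> V -> int -> over_base V).
Hypothesis psi_scale : forall (f : laurent F) (v : V),
     psi (f *: v) = Escale (taylor_shift f) (psi v).
Hypothesis psi_vac : psi vac = @one_field F V.
Hypothesis psi_mode : forall u (n : int) (v : V), U u ->
     psi (mode (Y0 u) n v) = nprod n (Y0 u) (psi v).

Let chL := charL charF.

Lemma psiD u v : psi (u + v) = psi u + psi v.
Proof.
have := psi_linear 1 u v; rewrite !scale1r => e.
by rewrite -[RHS]e; congr psi; rewrite -[in RHS](scale1r (u : over_base V)).
Qed.

Lemma psi0 : psi 0 = 0.
Proof. by apply: (addrI (psi 0)); rewrite -psiD !addr0. Qed.

Lemma psi_bz m p v w n : psi (bz L m p *: v) w n = bz L m p *: psi v w n.
Proof.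
rewrite bz_laurent //; set c := bz F m p.
have := psi_linear c v 0; rewrite addr0.
rewrite [psi (0 : over_base V)]psi0 addr0 => /(congr1 (fun f => f w n)).
by [].
Qed.

Lemma V_ind (P : V -> Prop) : P vac ->
  (forall u n v, U u -> P v -> P (mode (Y0 u) n v)) ->
  (forall f v, P v -> P (f *: v)) -> (forall u v, P u -> P v -> P (u + v)) ->
  forall v, P v.
Proof.
move=> Pvac Pmode PZ PD v.
have : linear_span (monomials U Y0 vac) v by rewrite V_spanned.
move=> [r [f [w [wm ->]]]]; elim/big_ind: _ => //.
  by rewrite -(scale0r vac); apply: PZ.
move=> i _; apply: PZ; have [s [Us ->]] := wm i.
elim: s Us => //= -[u n] s IHs Us; apply: Pmode.
  by apply: (Us (u, n)); rewrite mem_head.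
by apply: IHs => um ums; apply: Us; rewrite inE ums orbT.
Qed.

Let S := Y0 @` U.

Let S_E : S `<=` @Espace F V.
Proof. by move=> _ [u Uu <-]; apply: Y0_hom. Qed.

Let S_C l : allS S l -> compat l.
Proof. exact: compatible_compat. Qed.

Lemma psi_good v : good S (psi v).
Proof.
elim/V_ind: v => [|u n v Uu gv|f v gv|u v gu gv].
- by rewrite psi_vac; apply: good_one.
- by rewrite psi_mode //; apply: good_nprod => //; exists u.
- by rewrite psi_scale; apply: good_scale.
by rewrite psiD; apply: good_add.
Qed.

Lemma psi_E v : Espace (psi v).
Proof. by have [] := psi_good v. Qed.

Lemma psi_compat2 u v : compat [:: psi u; psi v].
Proof.
by apply: (good_compat S_E S_C); split; [|split] => //; apply: psi_good.
Qed.

Lemma psi_compat3 u v w : compat [:: psi u; psi v; psi w].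
Proof.
by apply: (good_compat S_E S_C); split; [|split; [|split]] => //; apply: psi_good.
Qed.

Lemma psi_pairc u v : exists k, pairc k (psi u) (psi v).
Proof. exact/compat_pairc/psi_compat2. Qed.

Lemma prod12_one a w m n : prod12 a (@one_field F V) w m n =
  if n == 0 then a w m else a 0 m.
Proof. by rewrite /prod12 /one_field /cst_series; case: ifP. Qed.

Lemma nprod_one a : Espace a -> nprod (-1) a (@one_field F V) = a.
Proof.
move=> Ea; have a1 : pairc 0 a (@one_field F V).
  move=> w; have [N aN] := Etrunc Ea w; exists (Num.min N 0) => m n mn /=.
  rewrite prod12_one; case: eqP => [n0|_]; last exact: E0.
  by apply: aN; lia.
apply/funext => w; apply/funext => q.
rewrite (nprodE charF _ _ _ Ea (@Espace_one F V) a1) (_ : _ - 1 = 0) //.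
rewrite /J2 (@isum1 _ _ q) => [|m mq].
  by rewrite bz0 scale1r /= prod12_one ifT //; lia.
rewrite /= prod12_one ifF ?(E0 Ea) ?scaler0 //; lia.
Qed.

Lemma one_nprod n b : Espace b -> nprod n (@one_field F V) b =
  if n == -1 then b else 0.
Proof.
move=> Eb; have b1 : pairc 0 (@one_field F V) b.
  move=> w; have [N bN] := Etrunc Eb w; exists (Num.min N 0) => m k mk /=.
  rewrite /prod12 /one_field /cst_series; case: eqP => // m0.
  by apply: bN; lia.
apply/funext => w; apply/funext => q.
rewrite (nprodE charF _ _ _ (@Espace_one F V) Eb b1).
rewrite /J2 (@isum1 _ _ 0) => [|m m0]; last first.
  by rewrite /= /prod12 /one_field /cst_series (negbTE m0) scaler0.
rewrite /= /prod12 /one_field /cst_series eqxx; have [->|n1] := eqVneq n (-1).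
  by rewrite bz0 scale1r subr0 addr0.
rewrite (_ : bz _ _ _ = 0) ?scale0r //; have [n0|n0] := ltP n (-1).
  by rewrite bz_gt //; lia.
by rewrite bz_lt0 //; lia.
Qed.

(** By the creation property u = u_(-1) 1, and u(x)_(-1) 1_V = u(x). *)
Lemma psi_U u : U u -> psi u = Y0 u.
Proof.
move=> Uu; have := psi_mode (-1) vac Uu.
rewrite psi_vac nprod_one; last exact: Y0_hom.
by rewrite /mode opprK subrr (proj2 (Y0_creation Uu)).
Qed.

Definition psi_hom_at u :=
  forall n v, psi (mode (psi u) n v) = nprod n (psi u) (psi v).

Lemma psi_isum f w q : fin f -> psi (isum f) w q = isum (fun i => psi (f i) w q).
Proof.
move=> ff; rewrite (@isum_raddf _ _ (fun v => psi v w q)) ?psi0 //.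
by move=> u v; rewrite psiD.
Qed.

Lemma prod12_low (a b : V -> int -> V) w : Espace a -> forall n, exists N : int, forall m,
  m < N -> prod12 a b w m n = 0.
Proof. by move=> Ea n; apply: (Etrunc Ea). Qed.

Lemma Escale_prod12 (f : laurent L) (a b : V -> int -> V) w :
  prod12 (Escale f a) b w = xmul f (prod12 a b w) :> (int -> int -> V).
Proof. by []. Qed.

(** The factor f(x1) becomes f(x + x0); the power x0^l of its Taylor expansion turns the n-th
    product into the (n + l)-th. *)
Lemma nprod_scale (f : laurent L) (a b : V -> int -> V) n k w q (N : nat) : Espace a -> Espace b ->
  pairc k a b -> k%:Z - n - 1 < N%:Z ->
  nprod n (Escale f a) b w q =
  \sum_(l < N) fmul1 (ldp l f) (nprod (n + (l : nat)%:Z) a b w) q.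
Proof.
move=> Ea Eb abk nN; have Efa := Escale_E f Ea.
have iterE u : iter k (@d2 L V) (prod12 (Escale f a) b u) =
    xmul f (iter k (@d2 L V) (prod12 a b u)).
  by rewrite Escale_prod12 xmul_iter_d2 //; apply: prod12_low.
have fabk : pairc k (Escale f a) b.
  by move=> u; rewrite iterE; apply: trunc2_xmul.
rewrite (nprodE charF _ _ _ Efa Eb fabk) iterE (J2_xmul chL _ _ nN) //.
apply: eq_bigr => l _; apply: eq_isum => i.
rewrite (nprodE charF _ _ _ Ea Eb abk).
by rewrite (_ : k%:Z - (n + (l : nat)%:Z) - 1 = k%:Z - n - 1 - (l : nat)%:Z) //; lia.
Qed.

(** One side carries (d/dt)^l f / l! shifted from t to t + x, the other the divided derivative
    (d/dx)^l / l! of f(t + x); these series coincide. *)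
Lemma psi_hom_scale f u : psi_hom_at u -> psi_hom_at (f *: u).
Proof.
move=> Pu n v; rewrite psi_scale; have Eu := psi_E u; have Ev := psi_E v.
(* For i >= N the product u(x)_(n+i) v(x) is the coefficient of a negative power in the substituted
   series, hence 0. *)
have [k uvk] := psi_pairc u v; pose N := (absz (k%:Z - n - 1)%R).+1.
apply/funext => w; apply/funext => q.
rewrite (@nprod_scale (taylor_shift f) (psi u) (psi v) n k w q N Eu Ev uvk);
  last by rewrite /N; lia.
have -> : mode (Escale (taylor_shift f) (psi u)) n v =
    isum (fun i => taylor_shift f i *: psi u v (- n - 1 - i)) by [].
rewrite psi_isum; last first.
  apply: (@xmul_fin _ V (taylor_shift f) (fun m _ => psi u v m) _ 0).
  exact: (Etrunc Eu).
rewrite (@isum_ord _ _ N) => [|i /orP[i0|iN]]; last 2 first.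
- by case: i i0 => // i _; rewrite taylor_shiftE //= scale0r psi0.
- rewrite psi_scale (_ : - n - 1 - i = - (n + i) - 1); last by lia.
  have p0 : k%:Z - (n + i) - 1 < 0 by rewrite /N in iN; lia.
  rewrite (Pu (n + i)); apply: isum0 => j.
  by rewrite (nprodE charF _ _ _ Eu Ev uvk) (J2_lt0 _ _ p0) scaler0.
apply: eq_bigr => l _; rewrite psi_scale.
rewrite (_ : - n - 1 - l%:Z = - (n + l%:Z) - 1); last by lia.
rewrite (Pu (n + l%:Z)) taylor_shiftE //; apply: eq_isum => j; congr (_ *: _).
rewrite taylor_shiftE //; case: j => j.
  change (ldp j (ldp l f) =
    bz L (j%:Z + l%:Z) l * taylor_shift f (j%:Z + l%:Z)).
  rewrite (_ : j%:Z + l%:Z = (j + l)%N%:Z) // taylor_shiftE // bz_laurent //.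
  apply: laurentP => i; rewrite ldp_ldp //.
  exact/esym/(laurent_constM _ (ldp (j + l) f)).
change (0 = bz L (Negz j + l%:Z) l * taylor_shift f (Negz j + l%:Z)).
rewrite taylor_shiftE //; case jl: (Negz j + l%:Z) => [i|i]; last by rewrite mulr0.
by rewrite bz_gt ?mul0r //; lia.
Qed.

Lemma psi_hom_add u u' : psi_hom_at u -> psi_hom_at u' -> psi_hom_at (u + u').
Proof.
move=> Pu Pu' n v; have Eu := psi_E u; have Eu' := psi_E u'; have Ev := psi_E v.
have [k uvk] := psi_pairc u v; have [k' uvk'] := psi_pairc u' v.
have [k'' uvk''] := psi_pairc (u + u') v.
have {}uvk := pairc_le (leq_trans (leq_maxl k k') (leq_maxl _ k'')) uvk.
have {}uvk' := pairc_le (leq_trans (leq_maxr k k') (leq_maxl _ k'')) uvk'.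
have {}uvk'' := pairc_le (leq_maxr (maxn k k') k'') uvk''.
apply/funext => w; apply/funext => q.
rewrite (nprodE charF _ _ _ (psi_E _) Ev uvk'').
have -> : mode (psi (u + u')) n v = mode (psi u) n v + mode (psi u') n v.
  by rewrite psiD.
rewrite (psiD (mode (psi u) n v)) Pu Pu' !fctE (nprodE charF _ _ _ Eu Ev uvk).
rewrite (nprodE charF _ _ _ Eu' Ev uvk') -J2D //; apply: eq_J2 => i j.
rewrite psiD; move: (maxn _ _) => h; elim: h i j => // h IHh i j.
by rewrite /= /d2 -!IHh opprD addrACA.
Qed.

(** The vector (a_m b)_n v is a finite binomial combination of vectors a_i b_j v; [psi] passes
    through it, and the hypotheses on a and b turn each term into the matching term of
    [nprod_assoc]. *)
Lemma psi_hom_mode a m b : U a -> psi_hom_at b -> psi_hom_at (mode (Y0 a) m b).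
Proof.
move=> Ua Pb n v; rewrite -(psi_U Ua).
have Pa : psi_hom_at a by move=> n' v'; rewrite (psi_U Ua) psi_mode.
rewrite (Pa m b).
have [k0 H] := nprod_assoc charF (psi_E a) (psi_E b) (psi_E v)
  (psi_compat2 a b) (psi_compat2 b v) (psi_compat3 a b v).
have [abk /(_ _ _ m n) kE] := H k0 (leqnn _).
apply/funext => w; apply/funext => r; rewrite kE.
rewrite {1}/mode (nprodE charF _ _ _ (psi_E a) (psi_E b) abk).
rewrite (@J2_raddf _ _ _ (fun x => psi x w r)) //; last 2 first.
- by move=> x y; rewrite psiD.
- by move=> h x; rewrite psi_bz.
apply: eq_J2; elim: k0 {H abk kE} => [|k IHk] i j /=; last first.
  rewrite /d2 -!IHk; have := psiD (iter k (@d2 L V) (prod12 (psi a) (psi b) v) (i - 1) j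
    - iter k (@d2 L V) (prod12 (psi a) (psi b) v) i (j - 1))
    (iter k (@d2 L V) (prod12 (psi a) (psi b) v) i (j - 1)).
  by rewrite subrK => ->; rewrite !fctE addrK.
rewrite -Pb -Pa /mode /prod12.
by rewrite (_ : - (- i - 1) - 1 = i) 1?(_ : - (- j - 1) - 1 = j) //; lia.
Qed.

Lemma psi_hom u : psi_hom_at u.
Proof.
elim/V_ind: u => [n v||f u|u v].
- rewrite psi_vac one_nprod; last exact: psi_E.
  rewrite /mode /one_field /cst_series (_ : (- n - 1 == 0) = (n == -1)); last by lia.
  by case: ifP => // _; rewrite psi0.
- by move=> u n v Uu; apply: psi_hom_mode.
- exact: psi_hom_scale.
- exact: psi_hom_add.
Qed.

(** * The derivation D and the creation property *)

Lemma D_add u v : D (u + v) = D u + D v.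
Proof.
have := D_linear 1 u v; rewrite !scale1r => e.
by rewrite -[RHS]e; congr D; rewrite -[in RHS](scale1r (u : over_base V)).
Qed.

Lemma D0 : D 0 = 0.
Proof. by apply: (addrI (D 0)); rewrite -D_add !addr0. Qed.

Lemma D_opp u : D (- u) = - D u.
Proof. by apply: (addrI (D u)); rewrite -D_add !subrr D0. Qed.

Lemma D_bz m p v : D (bz L m p *: v) = bz L m p *: D v.
Proof.
rewrite bz_laurent //; set c := bz F m p.
have := D_linear c (v : over_base V) 0.
by rewrite [D (0 : over_base V)]D0 !addr0.
Qed.

(** The third condition, D Y(v, x) 1 = d/dx Y(v, x) 1, is not part of the creation property; it is
    what lets the induction on v pass through the modes. *)
Definition created v := [/\ forall n : int, n < 0 -> psi v vac n = 0,
  psi v vac 0 = v &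
  forall n, D (psi v vac n) = (n + 1)%:~R *: psi v vac (n + 1)].

Lemma created_vac : created vac.
Proof.
split; rewrite psi_vac /one_field /cst_series //.
  by move=> n n0; rewrite lt_eqF.
move=> n; have [->|n0] := eqVneq n 0; first by rewrite D_vac add0r /= scaler0.
rewrite D0; case: eqP => [->|_]; last by rewrite scaler0.
by rewrite scale0r.
Qed.

Lemma created_add u v : created u -> created v -> created (u + v).
Proof.
move=> [u1 u2 u3] [v1 v2 v3]; split=> [n n0||n]; rewrite psiD !fctE.
- by rewrite u1 ?v1 ?addr0.
- by rewrite u2 v2.
by rewrite D_add u3 v3 scalerDr.
Qed.

Lemma created_scale f v : created v -> created (f *: v).
Proof.
move=> [v1 v2 v3]; set g := psi v vac in v1 v2 v3.
have T0 i : i < 0 -> taylor_shift f i = 0.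
  by move=> i0; rewrite taylor_shiftE //; case: i i0.
have gE n : psi (f *: v) vac n = isum (fun i => taylor_shift f i *: g (n - i)).
  by rewrite psi_scale.
have fing n : fin (fun i => taylor_shift f i *: g (n - i)).
  apply: (@fin_le _ _ 0 n) => i /orP[/T0->|?]; first by rewrite scale0r.
  by rewrite v1 ?scaler0 //; lia.
(* The derivations d/dt and d/dx agree on f(t + x), so the term f'(t) in the rule for D supplies the
   missing derivative of the product. *)
have TS i : lderiv (taylor_shift f i) = (i + 1)%:~R * taylor_shift f (i + 1).
  rewrite !taylor_shiftE //; case: i => [l|[|l]].
  - have -> : Posz l + 1 = Posz l.+1 by lia.
    apply: laurentP => i; rewrite lderiv_ldp // -pmulrn natr_laurent.
    exact/esym/(laurent_constM _ (ldp l.+1 f)).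
  - rewrite (_ : Negz 0 + 1 = 0) // mul0r.
    by apply: laurentP => i /=; rewrite !if_same mulr0.
  have -> : Negz l.+1 + 1 = Negz l by lia.
  by rewrite mulr0; apply: laurentP => i /=; rewrite !if_same mulr0.
split=> [n n0||n]; rewrite !gE.
- apply: isum0 => i; have [/T0->|i0] := ltP i 0; first by rewrite scale0r.
  by rewrite v1 ?scaler0 //; lia.
- rewrite (@isum1 _ _ 0) => [|i i0].
    rewrite taylor_shiftE // subr0 v2; congr (_ *: _).
    by apply: laurentP => i; rewrite /= bz0 mul1r addr0.
  have [/T0->|i0'] := ltP i 0; first by rewrite scale0r.
  by rewrite v1 ?scaler0 //; lia.
rewrite (@isum_raddf _ _ D) ?D0 //; [|exact: D_add].
pose a i := taylor_shift f i *: ((n - i + 1)%:~R *: g (n - i + 1)).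
pose b i := ((i + 1)%:~R * taylor_shift f (i + 1)) *: g (n - i).
have fina : fin a.
  apply: (@fin_le _ _ 0 (n + 1)) => i /orP[/T0 Ti|?]; rewrite /a.
    by rewrite Ti scale0r.
  by rewrite v1 ?scaler0 //; lia.
have finb : fin b.
  apply: (@fin_le _ _ (- 1) n) => i /orP[?|?]; rewrite /b.
    by rewrite T0 ?mulr0 ?scale0r //; lia.
  by rewrite v1 ?scaler0 //; lia.
transitivity (isum a + isum b).
  rewrite -isumD //; apply: eq_isum => i.
  by rewrite D_deriv v3 TS.
rewrite [isum b](@isum_shift _ _ (- 1)) -isumD //; last exact: fin_shift.
rewrite -isumZ //; apply: eq_isum => i; rewrite /a /b subrK.
have -> : n - i + 1 = n + 1 - i by lia.
have -> : n - (i - 1) = n + 1 - i by lia.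
rewrite scalerA -scalerDl scalerA; congr (_ *: _).
by rewrite mulrC -mulrDl -intrD; congr (_%:~R * _); lia.
Qed.

Lemma created_mode u m b : U u -> created b -> created (mode (Y0 u) m b).
Proof.
move=> Uu [b1 b2 b3]; set g := psi b vac in b1 b2 b3.
have Eu := Y0_hom Uu; have Eb := psi_E b.
have [k ubk] := psi_pairc u b; rewrite psi_U // in ubk.
pose G j := iter j (@d2 L V) (prod12 (Y0 u) (psi b) vac).
have G2 j i n : n < 0 -> G j i n = 0.
  elim: j i n => [|j IHj] i n n0; first by rewrite /G /prod12 /= -/g b1 ?(E0 Eu).
  by rewrite /G /= /d2 -/(G j) !IHj ?subrr //; lia.
(* At x_2 = 0 the series psi(b, x_2) 1 reduces to b, and x_1 - x_2 to x_1. *)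
have G0 j i : G j i 0 = Y0 u b (i - j%:Z).
  elim: j i => [|j IHj] i; first by rewrite subr0 /G /= /prod12 -/g b2.
  rewrite {1}/G /= /d2 -/(G j) IHj G2 // subr0.
  by congr (Y0 u b _); lia.
have scaleS (i : int) (x : V) : (i + 1)%:~R *: x = i%:~R *: x + x.
  by rewrite intrD scalerDl scale1r.
have telescope (x y z s t : V) : (x + y) - (z + s) = (x + t - z) + (y - (s + t)).
  rewrite [x + t - z]addrAC [- (s + t)]opprD [y + (_ + _)]addrA.
  by rewrite [RHS]addrACA subrr addr0 [RHS]addrACA -opprD.
(* For j = 0 this combines the commutator of D with u(x_1) and the condition on b; it persists
   because d/dx_1 + d/dx_2 annihilates x_1 - x_2. *)
have DG j i n : D (G j i n) =
    (i + 1)%:~R *: G j (i + 1) n + (n + 1)%:~R *: G j i (n + 1).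
  elim: j i n => [|j IHj] i n.
    rewrite /G /= /prod12 -/g -(D_Y0 Uu) b3 (EZ Eu).
    by rewrite subrK.
  rewrite /G /= /d2 -/(G j) D_add D_opp !IHj !subrK !addrK.
  rewrite !scalerBr [(i + 1)%:~R *: G j i n]scaleS [(n + 1)%:~R *: G j i n]scaleS.
  exact: telescope.
have [N GN] := ubk vac.
(* The relation [DG] at (i - 1, n) expresses i G(i, n) through coefficients with first exponent i -
   1. These vanish far below, and the integer i can be cancelled as long as i < 0. *)
have G1 i n : i < 0 -> G k i n = 0.
  suff H (d : nat) : forall i n, i < N + d%:Z -> i < 0 -> G k i n = 0.
    by apply: (H (absz (i - N)).+1); lia.
  elim: d => [|d IHd] {}i {}n iN i0; first by apply: GN; lia.
  have := DG k (i - 1) n; rewrite subrK (IHd (i - 1)) 1?(IHd (i - 1)); try lia.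
  rewrite D0 scaler0 addr0 => /esym/eqP.
  rewrite scaler_eq0 (negbTE (intf_neq0 chL _)) /=; last by lia.
  by move/eqP.
have psiE q : psi (mode (Y0 u) m b) vac q = J2 (k%:Z - m - 1) (G k) q.
  by rewrite psi_mode // (nprodE charF _ _ _ Eu Eb ubk).
set p := k%:Z - m - 1 in psiE; have tG : lower_truncated2 (G k) by exists N.
split=> [q q0||q]; rewrite !psiE.
- apply: isum0 => i; have [i0|i0] := ltP i 0; first by rewrite G1 ?scaler0.
  have [ip|ip] := ltP i p; first by rewrite bz_gt ?scale0r.
  by rewrite G2 ?scaler0 //; lia.
- have pE : G k p 0 = mode (Y0 u) m b.
    by rewrite G0 /mode; congr (Y0 u b _); rewrite /p; lia.
  rewrite -pE; have [p0|p0] := ltP p 0; first by rewrite J2_lt0 ?G1.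
  (* Only i = p survives: i < 0 is excluded by [G1], 0 <= i < p by the binomial C(i, p), and i > p
     by the negative exponent p - i of x_2. *)
  rewrite /J2 (@isum1 _ _ p) => [|i ip].
    by rewrite bz_diag // scale1r sub0r addNr.
  have [i0|i0] := ltP i 0; first by rewrite G1 ?scaler0.
  have [ip'|ip'] := ltP i p; first by rewrite bz_gt ?scale0r.
  by rewrite G2 ?scaler0 //; lia.
rewrite -(J2_deriv chL) // (@J2_raddf _ _ _ D) //; [|exact: D_add|by move=> h x; rewrite D_bz].
by apply: eq_J2 => i n; rewrite DG.
Qed.

Lemma psi_created v : created v.
Proof.
elim/V_ind: v => *; [exact: created_vac | exact: created_mode
  | exact: created_scale | exact: created_add].
Qed.

Lemma psi_nprod u n v : psi (mode (psi u) n v) = nprod n (psi u) (psi v).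
Proof. exact: psi_hom. Qed.

Lemma psi_psi k u v w p q : pairc k (psi u) (psi v) ->
  psi (psi u v p) w q = J2 (p + k%:Z) (iter k (@d2 L V) (prod12 (psi u) (psi v) w)) q.
Proof.
move=> uvk; have := psi_nprod u (- p - 1) v; rewrite /mode.
rewrite (_ : - (- p - 1) - 1 = p); last by lia.
move=> ->; rewrite (nprodE charF _ _ _ (psi_E u) (psi_E v) uvk).
by congr (J2 _ _ _); lia.
Qed.

Lemma psi_low u v w : exists N : int, forall m n, n < N ->
  prod12 (psi u) (psi v) w m n = 0.
Proof.
have [N vN] := Etrunc (psi_E v) w; exists N => m n nN.
by rewrite /prod12 vN // (E0 (psi_E u)).
Qed.

Lemma psi_weak_assoc : weak_associativity (psi : over_base V -> over_base V -> int -> over_base V).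
Proof.
move=> u v w; have [N AN] := psi_low u v w; have [k uvk] := psi_pairc u v.
have [l lE] := expand_assoc chL AN (uvk w); exists l.
rewrite !fmul2_pow_lin !(plc1_iter charF).
apply/funext => p; apply/funext => q.
transitivity (iter l (@s2 L V) (S02 (prod12 (psi u) (psi v) w)) p q).
  congr (iter l _ _ p q); apply/funext => p'; apply/funext => q'.
  rewrite subst_02E; apply: eq_isum => m; rewrite bz_laurent //.
rewrite lE; congr (iter l _ _ p q).
by apply/funext => p'; apply/funext => q'; rewrite (psi_psi w p' q' uvk).
Qed.

Lemma psi_nonlocal : nonlocal_vertex_Ft_algebra psi vac.
Proof.
split; last first.
  move=> f g u v; apply/funext => n; rewrite psi_scale /Escale /fmul1.
  apply: eq_fsbigr => i _; congr (_ *: _).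
  exact: (EZ (psi_E u)).
split.
- exact: psi_linear.
- move=> v; split; last exact: (Etrunc (psi_E v)).
  move=> c u w; apply/funext => n.
  by rewrite (ED (psi_E v)) (EZ (psi_E v)).
- by move=> v; rewrite psi_vac.
- by move=> v; have [v1 v2 _] := psi_created v.
exact: psi_weak_assoc.
Qed.

(** * Extension of locality and the Jacobi identity *)

Let cmm := comm psi.
Let any : V -> Prop := fun=> True.

Lemma comm_vacr P u : P u -> cmm P u vac.
Proof.
move=> Pu; exists (fun w => FM 1 0 1 (swap (psi vac) (psi u) w)).
  by apply: exchanged_gen => //; exact: shifted1.
exists [::] => // w; rewrite FM_1 psi_vac; apply/funext => e.
rewrite !fctE /swap /= /one_field /cst_series; case: ifP => _.
  exact: subrr.
by rewrite (E0 (psi_E u)) subr0.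
Qed.

Lemma comm_vacl v : cmm any vac v.
Proof.
exists (fun w => FM 1 0 1 (swap (psi v) (psi vac) w)).
  by apply: exchanged_gen => //; exact: shifted1.
exists [::] => // w; rewrite FM_1 psi_vac; apply/funext => e.
rewrite !fctE /swap /= /one_field /cst_series; case: ifP => _.
  exact: subrr.
by rewrite (E0 (psi_E v)) subr0.
Qed.

Lemma FM_fmul21 h u v w e : FM h 0 1 (swap (psi v) (psi u) w) e =
  fmul21 h (prod21 (psi v) (psi u) w) (e 0%N) (e 1%N).
Proof.
have o := okf_swap w (psi_E u) (psi_E v).
by rewrite (@fmul21E _ V h (prod21 (psi v) (psi u) w) e).
Qed.

Lemma prodL_prod12 u v w : prodL [:: psi u; psi v] w =
  fun e => prod12 (psi u) (psi v) w (e 0%N) (e 1%N).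
Proof. by []. Qed.

Hypothesis U_local : St_local S.

Lemma comm_U u v : U u -> U v -> cmm U u v.
Proof.
move=> Uu Uv; have Su : S (Y0 u) by exists u.
have Sv : S (Y0 v) by exists v.
have [r [u' [v' [f [k [H E]]]]]] := U_local Su Sv.
have /choice[x xE] i : exists x, U x /\ psi x = u' i.
  by have [[z Uz <-] _ _] := H i; exists z; rewrite psi_U.
have /choice[y yE] i : exists x, U x /\ psi x = v' i.
  by have [_ [z Uz <-] _] := H i; exists z; rewrite psi_U.
pose h i := iota_t21 (frac_shift (f i)).
exists (fun w => \sum_i FM (h i) 0 1 (swap (psi (x i)) (psi (y i)) w)).
  apply: sums_sum => i; have [_ _ Ff] := H i.
  by apply: exchanged_gen; [exact: shifted_iota | have [] := yE i].
exists (nseq k (0, 1)%N) => [|w]; first by apply/allP => z /nseqP[->].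
apply/funext => e; rewrite mulLB !fctE prodL_prod12 mulL_d2.
have -> : \sum_i FM (h i) 0 1 (swap (psi (x i)) (psi (y i)) w) =
    fun e => (\sum_i fmul21 (h i) (prod21 (u' i) (v' i) w)) (e 0%N) (e 1%N).
  apply/funext => e'; rewrite !fct_sumE; apply: eq_bigr => i _.
  by rewrite FM_fmul21 (proj2 (xE i)) (proj2 (yE i)).
rewrite mulL_d2; have := E w; rewrite !fmul2_pow_lin !(plcN1_iter chL).
by rewrite -!psi_U // => ->; rewrite subrr.
Qed.

(** The induction on v keeps u general in U, because exchanging u with a generator yields further
    elements of U that must pass the remaining field. *)
Lemma comm_Ul u v : U u -> cmm U u v.
Proof.
elim/V_ind: v u => [u|u n c Uu IH a Ua|f v IH u Uu|v v' IH IH' u Uu].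
- exact: comm_vacr.
- rewrite -(psi_U Uu); apply: (comm_moder charF) => //; try exact: psi_E.
  + exact: psi_pairc.
  + exact: psi_nprod.
  exact: comm_U.
- by apply: commZr => //; [exact: psi_E | exact: IH].
by apply: commDr => //; [exact: psi_E | exact: psiD | exact: IH | exact: IH'].
Qed.

Lemma comm_all u v : cmm any u v.
Proof.
elim/V_ind: u v => [v|u n b Uu IH v|f u IH v|u u' IH IH' v].
- exact: comm_vacl.
- rewrite -(psi_U Uu); apply: (comm_model charF) => //; try exact: psi_E.
  + exact: psi_pairc.
  + exact: psi_nprod.
  + by move=> v'; apply: (@comm_sub _ _ _ U) => //; exact: comm_Ul.
  exact: IH.
- by apply: commZl => //; [exact: psi_E | exact: IH].
by apply: commDl => //; [exact: psiD | exact: IH | exact: IH'].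
Qed.

Lemma exchanged_family X : exchanged psi any X ->
  exists r (u' v' : 'I_r -> V) (f : 'I_r -> {fraction powser2 F}),
  (forall i, Fstar2 (f i)) /\ forall w e, X w e =
    (\sum_i fmul21 (iota_t21 (frac_shift (f i)))
      (prod21 (psi (v' i)) (psi (u' i)) w)) (e 0%N) (e 1%N).
Proof.
elim=> {X} [|X Y _ [r [u [v [f [Ff XE]]]]] _ [r' [u' [v' [f' [Ff' YE]]]]]|_ [h u v Hh _]].
- exists 0%N, (fun=> vac), (fun=> vac), (fun=> 0); split=> [[]//|w e].
  by rewrite big_ord0.
- pose glue T (a : 'I_r -> T) (a' : 'I_r' -> T) (i : 'I_(r + r')) :=
    match fintype.split i with inl j => a j | inr j => a' j end.
  have gl T (a : 'I_r -> T) a' j : glue T a a' (lshift r' j) = a j.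
    by rewrite /glue (unsplitK (inl j)).
  have gr T (a : 'I_r -> T) a' j : glue T a a' (rshift r j) = a' j.
    by rewrite /glue (unsplitK (inr j)).
  exists (r + r')%N, (glue _ u u'), (glue _ v v'), (glue _ f f'); split=> [i|w e].
    by rewrite /glue; case: (fintype.split i).
  have addE (P P' Q Q' : int -> int -> V) m n : P = P' -> Q = Q' ->
    P m n + Q m n = (P' + Q') m n by move=> -> ->.
  rewrite fctE XE YE big_split_ord /=; apply: addE; apply: eq_bigr => i _.
    by rewrite !gl.
  by rewrite !gr.
have [f Ff hE] := iota_shifted charF Hh.
exists 1%N, (fun=> u), (fun=> v), (fun=> f); split=> // w e.
by rewrite big_ord1 FM_fmul21 hE.
Qed.

Lemma psi_jacobi u v : exists r (u' v' : 'I_r -> V)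
  (f : 'I_r -> {fraction powser2 F}),
  (forall i, Fstar2 (f i)) /\ jacobi_identity psi u v u' v' f.
Proof.
have [X RX [t vt tE]] := comm_all u v.
have [r [u' [v' [f [Ff XE]]]]] := exchanged_family RX.
exists r, u', v', f; split=> // w.
set B := \sum_i _; pose A := prod12 (psi u) (psi v) w.
have XB : X w = fun e => B (e 0%N) (e 1%N) by apply/funext => e; exact: XE.
(* One power must both make the two products equal and bring the result into V((x1, x2)). *)
have [k1 uvk1] := psi_pairc u v; pose k := maxn (size t) k1.
have AB : iter k (@d2 L V) A = iter k (@d2 L V) B.
  rewrite /k -(subnK (leq_maxl (size t) k1)) !iterD; congr (iter _ _ _).
  apply/funext => m; apply/funext => n; pose e j := if j is 0%N then m else n.
  have [c [c0 _ cE]] := mulL2 (prodL [:: psi u; psi v] w - X w) vt.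
  have := tE w; rewrite cE => /(congr1 (fun Z => Z e))/eqP.
  rewrite scaler_eq0 (negbTE c0) orFb mulLB XB prodL_prod12 !fctE subr_eq0.
  by rewrite !mulL_d2 => /eqP.
have [N AN] := psi_low u v w.
have [M BM] : exists M : int, forall m n, m < M -> B m n = 0.
  have [_ X0 _] := exchanged_prop psi_E RX; have [M XM] := X0 w; exists M => m n mM.
  by have := XM (fun j => if j is 0%N then m else n) mM; rewrite XB.
have uvk := pairc_le (leq_maxr (size t) k1) uvk1.
rewrite (expand_jacobi chL AN BM AB (uvk w)); congr fmul3.
apply/funext => l; apply/funext => m; apply/funext => n.
by rewrite (psi_psi w l n uvk).
Qed.

End Main.

Theorem theorem5p5 (F : fieldType) (charF : [pchar F] =i pred0)
  (V : lmodType (laurent F)) (vac : V) (D : V -> V)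
  (D_linear : linear (D : over_base V -> over_base V))
  (U : set V) (U_submod : submod_closed [in U])
  (Y0 : V -> V -> int -> V)
  (Y0_hom : forall u, U u -> Espace (Y0 u))
  (Y0_linear : forall (c : F) (u v : over_base V), U u -> U v ->
     Y0 (c *: u + v) = c *: (Y0 u : V -> int -> over_base V) + Y0 v)
  (D_vac : D vac = 0)
  (D_deriv : forall (f : laurent F) (v : V),
     D (f *: v) = f *: D v + lderiv f *: v)
  (D_Y0 : forall u, U u -> forall (v : V) (n : int),
     D (Y0 u v n) - Y0 u (D v) n = (n + 1)%:~R *: Y0 u v (n + 1))
  (Y0_creation : forall u, U u ->
     (forall n : int, n < 0 -> Y0 u vac n = 0) /\ Y0 u vac 0 = u)
  (Y0_scale : forall (f : laurent F) u, U u ->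
     Y0 (f *: u) = Escale (taylor_shift f) (Y0 u))
  (Ux_compatible : compatible (Y0 @` U))
  (V_spanned : linear_span (monomials U Y0 vac) = setT)
  (psi : V -> V -> int -> V)
  (psi_linear : linear (psi : over_base V -> V -> int -> over_base V))
  (psi_span : forall v, Espan (generated (Y0 @` U)) (psi v))
  (psi_scale : forall (f : laurent F) (v : V),
     psi (f *: v) = Escale (taylor_shift f) (psi v))
  (psi_vac : psi vac = @one_field F V)
  (psi_mode : forall u (n : int) (v : V), U u ->
     psi (mode (Y0 u) n v) = nprod n (Y0 u) (psi v)) :
  (forall u, U u -> psi u = Y0 u) /\
  nonlocal_vertex_Ft_algebra psi vac /\
  (St_local (Y0 @` U) -> weak_quantum_vertex_Ft_algebra psi vac).
Proof.
split=> [u Uu|].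
  exact: (psi_U charF Y0_hom Y0_creation psi_vac psi_mode).
have nonlocal : nonlocal_vertex_Ft_algebra psi vac.
  exact: (psi_nonlocal charF D_linear Y0_hom D_vac D_deriv D_Y0 Y0_creation
    Ux_compatible V_spanned psi_linear psi_scale psi_vac psi_mode).
split=> // U_local; split=> // u v.
exact: (psi_jacobi charF Y0_hom Y0_creation Ux_compatible V_spanned
  psi_linear psi_scale psi_vac psi_mode U_local u v).
Qed.
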